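(* Let $X$ be the nonsingular projective curve over $\mathbf{Q}$ (of genus $55$) with plane model $\mathcal{Q}(x,y)=0$, where \begin{align*} \mathcal{Q}(x,y)&= x^{11}y - x^7y^5 - x^6y^6 - x^4y^8 + xy^{11} + y^{12} + x^{11} - x^{10}y + x^8y^3 - x^6y^5 + x^5y^6 + x^3y^8 - x^2y^9 - xy^{10} \\ &\quad + y^{11} + x^{10} + x^9y - x^8y^2 + x^7y^3 + x^6y^4 + x^5y^5 - x^4y^6 + xy^9 +y^{10} - x^9 + x^8y+ x^7y^2 + x^6y^3 + x^5y^4 \\ &\quad + x^4y^5 + x^3y^6 - x^2y^7 + y^9 + x^8 - x^7y + x^6y^2 - x^5y^3 + xy^7 + y^8 + x^7 + x^6y +x^5y^2 - x^2y^5 - xy^6 \\ &\quad + y^7 - x^6 - x^4y^2 - x^2y^4 + xy^5 - x^5 + x^3y^2 - x^2y^3 + y^5 - x^4 + x^3y + x^2y^2 + xy^3 + y^4 - x^2y - xy^2 \\ &\quad + y^3 - x^2 - xy + x + y. \end{align*} Then the Jacobian of $X$ has positive Mordell--Weil rank over $\mathbf{Q}$.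
   Context: The projective closure of $\mathcal{Q}(x,y)=0$ is a smooth plane curve of degree $12$. *)

(* Defs.v *)
From HB Require Import structures.
From mathcomp Require Import all_boot all_order all_algebra all_field.
From mathcomp Require Import freeg mpoly.
From mathcomp Require Import boolp classical_sets constructive_ereal.

Set Implicit Arguments.
Unset Strict Implicit.
Unset Printing Implicit Defensive.

Import Order.TTheory GRing.Theory Num.Theory.
Local Open Scope ring_scope.

(* Throughout, f is an affine equation over Q whose projective closure is a   *)
(* smooth (hence geometrically irreducible) plane curve X_f; the definitions  *)
(* below are meaningful in that case.  The algebraic closure of Q is algC.    *)

(* The coordinates 'X_0, 'X_1, 'X_2 are the homogeneous versions of x, y, 1.  *)
(* The total degree of f is (msize f).-1.                                     *)
Definition homogenization (f : {mpoly rat[2]}) : {mpoly rat[3]} :=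
  \sum_(m <- msupp f)
    f@_m *: ('X_0 ^+ m 0 * 'X_1 ^+ m 1 * 'X_2 ^+ ((msize f).-1 - mdeg m)).

Definition curve_form (f : {mpoly rat[2]}) : {mpoly algC[3]} :=
  map_mpoly ratr (homogenization f).

(* A point of P^2(algC) is represented by its unique coordinate vector whose  *)
(* first nonzero coordinate is 1.                                             *)
Definition normalized (v : {ffun 'I_3 -> algC}) : bool :=
  [exists i, (v i == 1) && [forall j : 'I_3, (j < i)%N ==> (v j == 0)]].

Definition on_curve (f : {mpoly rat[2]}) (v : {ffun 'I_3 -> algC}) : bool :=
  normalized v && ((curve_form f).@[v] == 0).

Definition point (f : {mpoly rat[2]}) : Type :=
  {v : {ffun 'I_3 -> algC} | on_curve f v}.

(* Every ring endomorphism s of algC is an automorphism over Q, so these are  *)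
(* exactly the elements of the absolute Galois group of Q.                    *)
Definition conj_coords (s : {rmorphism algC -> algC})
    (v : {ffun 'I_3 -> algC}) : {ffun 'I_3 -> algC} :=
  [ffun i => s (v i)].

Lemma on_curve_conj f (s : {rmorphism algC -> algC}) v :
  on_curve f v -> on_curve f (conj_coords s v).
Proof.
case/andP=> /existsP[i /andP[/eqP vi /forallP vj]] /eqP fv; apply/andP; split.
  apply/existsP; exists i; rewrite ffunE vi rmorph1 eqxx /=.
  apply/forallP=> j; apply/implyP=> ji; rewrite ffunE.
  by move: (vj j); rewrite ji => /eqP ->; rewrite rmorph0.
apply/eqP; rewrite -[RHS](rmorph0 s) -fv /curve_form !mevalE.
move: (homogenization f) => F; rewrite rmorph_sum /=.
apply: eq_bigr => m _; rewrite rmorphM rmorph_prod mcoeff_map_mpoly /= fmorph_rat.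
by congr (_ * _); apply: eq_bigr => j _; rewrite rmorphXn ffunE.
Qed.

Definition conj_point f (s : {rmorphism algC -> algC}) (P : point f) : point f :=
  exist _ (conj_coords s (val P)) (on_curve_conj s (valP P)).

Definition divisor (f : {mpoly rat[2]}) : Type := {freeg (point f)}.
HB.instance Definition _ (f : {mpoly rat[2]}) := GRing.Zmodule.on (divisor f).
HB.instance Definition _ (f : {mpoly rat[2]}) := GRing.Lmodule.on (divisor f).

Definition conj_divisor f (s : {rmorphism algC -> algC}) (D : divisor f) :
    divisor f :=
  fglift (fun P => << conj_point s P >> : divisor f) D.

(* Membership in the homogeneous ideal I_P of the point P of P^2: vanishing   *)
(* on the whole line spanned by v in affine 3-space.                          *)
Definition in_point_ideal (v : {ffun 'I_3 -> algC}) (G : {mpoly algC[3]}) : Prop :=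
  forall c : algC, G.@[fun i => c * v i] = 0.

Definition in_point_ideal_exp (v : {ffun 'I_3 -> algC}) (n : nat)
    (G : {mpoly algC[3]}) : Prop :=
  exists2 s : seq ({mpoly algC[3]} * n.-tuple {mpoly algC[3]}),
    (forall t, t \in s -> forall i, in_point_ideal v (tnth t.2 i))
    & G = \sum_(t <- s) t.1 * \prod_(i < n) tnth t.2 i.

(* F lies in the n-th power of the maximal ideal of the local ring of X_f at  *)
(* P: some multiple S * F with S(P) <> 0 lies in I_P ^ n modulo the equation. *)
Definition vanishes_to_order f (P : point f) (n : nat) (F : {mpoly algC[3]}) : Prop :=
  exists S B : {mpoly algC[3]},
    S.@[val P] != 0 /\ in_point_ideal_exp (val P) n (S * F - B * curve_form f).

Definition has_order f (P : point f) (F : {mpoly algC[3]}) (n : nat) : Prop :=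
  vanishes_to_order P n F /\ ~ vanishes_to_order P n.+1 F.

Definition vanishes_on_curve (f : {mpoly rat[2]}) (F : {mpoly algC[3]}) : Prop :=
  exists B : {mpoly algC[3]}, F = B * curve_form f.

(* D is the divisor of the rational function F / G on X_f over algC. *)
Definition principal f (D : divisor f) : Prop :=
  exists (d : nat) (F G : {mpoly algC[3]}),
    [/\ F \is d.-homog, G \is d.-homog,
        ~ vanishes_on_curve f F, ~ vanishes_on_curve f G &
        forall P : point f, exists m n : nat,
          [/\ has_order P F m, has_order P G n & coeff P D = m%:Z - n%:Z]].

Definition linearly_equivalent f (D E : divisor f) : Prop := principal (D - E).

(* The class of D lies in J(Q), where J is the Jacobian of X_f:               *)
(* J(algC) = Pic^0 of X_f over algC and J(Q) is its Galois-invariant part.    *)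
Definition rational_jacobian_class f (D : divisor f) : Prop :=
  deg D = 0 /\
  forall s : {rmorphism algC -> algC}, linearly_equivalent (conj_divisor s D) D.

Definition independent_classes f n (D : 'I_n -> divisor f) : Prop :=
  forall a : 'I_n -> int,
    linearly_equivalent (\sum_(i < n) D i *~ a i) 0 -> forall i, a i = 0.

(* The rank of J(Q): the supremum (a priori possibly infinite) of the sizes   *)
(* of its Z-linearly independent families.                                    *)
Definition mordell_weil_rank (f : {mpoly rat[2]}) : \bar int :=
  supremum 0%E
    [set n%:Z%:E | n in [set n : nat | exists2 D : 'I_n -> divisor f,
       (forall i, rational_jacobian_class (D i)) & independent_classes D]]%classic.

Definition calQ : {mpoly rat[2]} :=
  let x := 'X_0 in
  let y := 'X_1 in
    x^+11*y - x^+7*y^+5 - x^+6*y^+6 - x^+4*y^+8 + x*y^+11 + y^+12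
  + x^+11 - x^+10*y + x^+8*y^+3 - x^+6*y^+5 + x^+5*y^+6 + x^+3*y^+8
    - x^+2*y^+9 - x*y^+10 + y^+11
  + x^+10 + x^+9*y - x^+8*y^+2 + x^+7*y^+3 + x^+6*y^+4 + x^+5*y^+5
    - x^+4*y^+6 + x*y^+9 + y^+10
  - x^+9 + x^+8*y + x^+7*y^+2 + x^+6*y^+3 + x^+5*y^+4
    + x^+4*y^+5 + x^+3*y^+6 - x^+2*y^+7 + y^+9
  + x^+8 - x^+7*y + x^+6*y^+2 - x^+5*y^+3 + x*y^+7 + y^+8
  + x^+7 + x^+6*y + x^+5*y^+2 - x^+2*y^+5 - x*y^+6 + y^+7
  - x^+6 - x^+4*y^+2 - x^+2*y^+4 + x*y^+5
  - x^+5 + x^+3*y^+2 - x^+2*y^+3 + y^+5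
  - x^+4 + x^+3*y + x^+2*y^+2 + x*y^+3 + y^+4
  - x^+2*y - x*y^+2 + y^+3
  - x^+2 - x*y
  + x + y.

(* Main.v *)
(** Write Q = y gamma + x beta with gamma in Z[y], let P be the origin and let D be 12 P minus the
    fiber x = 0; D is Galois invariant and of degree 0, so it suffices that D is not torsion.
    If n D is principal, comparing orders gives a form C of degree n over algC meeting the curve
    only at P, i.e. with gamma^(12 n) C divisible by x^(12 n) in the ring of the curve.  This is a
    linear condition on C with integer coefficients, so there is such a form F over Z that is
    nonzero modulo 3, and the contradiction is obtained from the reduction modulo 3.

    There the curve is smooth and has no nonzero logarithmic differential (its Hasse-Witt
    condition is checked on monomials), so a form all of whose orders are divisible by 3 is a
    cube.  The forms F0 and K, of degrees 14 and 16, satisfy F0 K = G0^3 modulo (3, Q) and have no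
    common zero, so their orders are divisible by 3.  Let n = 3^j u, q = 3^j; replacing F by its
    square we may take u = 1 mod 3, and then F F0^q and F K^(2 q) become 3 q-th powers of forms
    V and T modulo 3.  Over Z, write F F0^q = c V^(3 q) + 3^(i+1) G and
    F K^(2 q) = c T^(3 q) + 3^(i+1) Y.  For i < j, eliminating F shows that G and Y are again
    multiples of F F0^q and F K^(2 q) modulo 3, which allows i to be increased.  For i = j the
    elimination involves the quotient R in F0 K = G0^3 + 3 R and yields R = K s - F0 t modulo
    (3, Q); an explicit linear functional shows that this is impossible. *)

(* Reduction modulo 3 alone cannot rule out torsion, because every divisor class of degree 0 over a
   finite field is torsion. What is used instead is a failure to lift. Let H be the class of a line
   section. If u (12 P - H) = 0 with u = 1 mod 3, then L = 4 u P - ((u - 1) / 3) H satisfies 3 L =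
   H. The absence of logarithmic differentials over F_3 means that there is no rational 3-torsion
   modulo 3, so such an L is unique there. The divisors of F0 and K are three times divisors of
   classes 5 H - L and 5 H + L, which explains the degrees 14, 16 and 10. The quotient R records
   what happens to L modulo 9, and the functional shows that this cube root of O(1) does not lift.
   The power 3^j in n is the remaining difficulty: increasing i replays with explicit forms the fact
   that the kernel of reduction has no 3-torsion, 3 being odd and unramified. Everything is phrased
   with forms and divisibility on two affine charts, so that commutative algebra and linear algebra
   over Z suffice. *)
Require Import Defs.
From Stdlib Require Import BinNat BinInt.
From HB Require Import structures.
From mathcomp Require Import all_boot all_order all_algebra all_field.
From mathcomp Require Import qpoly polydiv.
From mathcomp Require Import ring zify.
Set Implicit Arguments.
Unset Strict Implicit.
Unset Printing Implicit Defensive.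
Import Order.TTheory GRing.Theory Num.Theory.
Local Open Scope ring_scope.

(** * Affine rings of plane curves *)

Section QuotientByMonic.

Variables (R : comNzRingType) (q : {poly R}).
Hypotheses (q_monic : q \is monic) (q_gt1 : (1 < size q)%N).

Notation cl := (in_qpoly q).
Implicit Types (f g : {poly R}) (a b : {poly %/ q}).

(** [{poly %/ q}] is built on [mk_monic q], which replaces a [q] that is not monic of positive
    degree by a default modulus; the section hypotheses exclude this. *)
Lemma mk_monic_id : mk_monic q = q.
Proof. by rewrite /mk_monic q_gt1 q_monic. Qed.

Lemma clE f : cl f = Pdiv.CommonRing.rmodp f q :> {poly R}.
Proof. by rewrite /= mk_monic_id. Qed.

Lemma size_qpoly_lt (a : {poly %/ q}) : (size a < size q)%N.
Proof. by rewrite -[X in (_ < size (polyseq X))%N]mk_monic_id size_mk_monic. Qed.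

Lemma cl_id (a : {poly %/ q}) : cl a = a.
Proof. exact: val_inj (in_qpoly_small (size_mk_monic a)). Qed.

Lemma cl_small f : (size f < size q)%N -> cl f = f :> {poly R}.
Proof. by move=> sf; apply: in_qpoly_small; rewrite mk_monic_id. Qed.

Lemma cl_divE f : exists e : {poly R}, f = (cl f : {poly R}) + e * q.
Proof.
exists (Pdiv.CommonRing.rdivp f q).
by rewrite clE addrC -Pdiv.RingMonic.rdivp_eq.
Qed.

Lemma cl_q : cl q = 0.
Proof.
have cq : (cl q : {poly R}) = 0 by rewrite clE Pdiv.RingMonic.rmodpp.
exact: val_inj.
Qed.

Lemma cl_eq0 f : cl f = 0 <-> exists e : {poly R}, f = e * q.
Proof.
split=> [f0|[e ->]]; last by rewrite rmorphM /= cl_q mulr0.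
by have [e] := cl_divE f; rewrite f0 add0r => fe; exists e.
Qed.

Lemma cl_eq f g : cl f = cl g <-> exists e : {poly R}, f = g + e * q.
Proof.
split=> [/eqP|[e ->]]; last by rewrite rmorphD rmorphM /= cl_q mulr0 addr0.
rewrite -subr_eq0 -rmorphB => /eqP/cl_eq0[e ef]; exists e.
by rewrite -ef addrC subrK.
Qed.

Lemma cl_inj f g :
  (size f < size q)%N -> (size g < size q)%N -> cl f = cl g -> f = g.
Proof. by move=> sf sg fg; rewrite -(cl_small sf) fg cl_small. Qed.

Lemma val_mul_divE a b :
  exists e : {poly R}, (a : {poly R}) * (b : {poly R}) = polyn (a * b) + e * q.
Proof.
have [e Ee] := cl_divE ((a : {poly R}) * (b : {poly R})).
by exists e; rewrite {1}Ee in_qpolyM !cl_id.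
Qed.

Definition mulmat (a : {poly %/ q}) : 'M[R]_((size q).-1) :=
  \matrix_i poly_rV (a * cl 'X^i : {poly %/ q}).

Definition qrow (a : {poly %/ q}) : 'rV[R]_((size q).-1) := poly_rV a.

Lemma qrowK (a : {poly %/ q}) : rVpoly (qrow a) = a.
Proof. by rewrite poly_rV_K // -ltnS prednK ?size_qpoly_lt // ltnW. Qed.

Lemma qrow_inj : injective qrow.
Proof. by move=> a b ab; apply: val_inj; rewrite /= -!qrowK ab. Qed.

Lemma qrow_cl_rVpoly v : qrow (cl (rVpoly v)) = v.
Proof.
rewrite /qrow cl_small ?rVpolyK // (leq_ltn_trans (size_poly _ _)) //.
by rewrite ltn_predL ltnW.
Qed.

Fact qrow_is_linear : linear qrow.
Proof. by move=> c a b; apply/rowP => j; rewrite !mxE /= coefD coefZ. Qed.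
HB.instance Definition _ :=
  GRing.isLinear.Build R {poly %/ q} 'rV[R]_((size q).-1) _ qrow qrow_is_linear.

Lemma qrow_clXn (i : 'I_((size q).-1)) : qrow (cl 'X^i) = delta_mx 0 i.
Proof.
apply/rowP => j; rewrite !mxE cl_small ?coefXn ?eqxx //.
by rewrite size_polyXn (leq_ltn_trans (ltn_ord i)) // ltn_predL ltnW.
Qed.

Lemma qpoly_sumE a : a = \sum_(i < (size q).-1) (a : {poly R})`_i *: cl 'X^i.
Proof.
apply: qrow_inj; rewrite linear_sum [LHS]row_sum_delta; apply: eq_bigr => i _.
by rewrite linearZ /= qrow_clXn mxE.
Qed.

Lemma mul_qrow_mulmat a b : qrow b *m mulmat a = qrow (b * a).
Proof.
rewrite [b in RHS]qpoly_sumE mulr_suml linear_sum mulmx_sum_row.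
apply: eq_bigr => i _; rewrite -scalerAl linearZ rowK mxE.
by rewrite [a * _]mulrC.
Qed.

Lemma mulmatM a b : mulmat (a * b) = mulmat a *m mulmat b.
Proof.
apply/row_matrixP => i; rewrite row_mul !rowK.
by have := mul_qrow_mulmat b (a * cl 'X^i); rewrite /qrow mulrAC => ->.
Qed.

Lemma mulmat_scale (c : R) : mulmat (c *: 1) = c%:M.
Proof.
apply/row_matrixP => i; rewrite rowK -scalerAl mul1r -/(qrow _) linearZ /=.
by rewrite qrow_clXn -scalemx1 linearZ /= row1.
Qed.

(** The norm of a free [R]-algebra. For a curve, [R] is k[x], and the norm turns questions about
    points of the curve into questions about roots on the x-line. *)
Definition qnorm a : R := \det (mulmat a).

Lemma qnormM a b : qnorm (a * b) = qnorm a * qnorm b.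
Proof. by rewrite /qnorm mulmatM det_mulmx. Qed.

Lemma qnorm_scale c : qnorm (c *: 1) = c ^+ (size q).-1.
Proof. by rewrite /qnorm mulmat_scale det_scalar. Qed.

Lemma qnorm1 : qnorm 1 = 1.
Proof. by rewrite -[1]scale1r qnorm_scale expr1n. Qed.

Lemma qnormX a n : qnorm (a ^+ n) = qnorm a ^+ n.
Proof. by elim: n => [|n IH]; rewrite ?qnorm1 // !exprS qnormM IH. Qed.

(** Cramer's rule: the adjugate of the multiplication matrix, applied to the coordinates of 1, gives
    the cofactor. *)
Lemma qnorm_mul a : exists b, b * a = qnorm a *: 1.
Proof.
exists (cl (rVpoly (qrow 1 *m \adj (mulmat a)))); apply: qrow_inj.
rewrite -mul_qrow_mulmat qrow_cl_rVpoly -mulmxA mul_adj_mx.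
by rewrite mul_mx_scalar /qrow -linearZ.
Qed.

End QuotientByMonic.

Lemma qnorm_eq0 (R : idomainType) (q : {poly R}) (a : {poly %/ q}) :
    q \is monic -> (1 < size q)%N ->
  qnorm a = 0 -> exists2 b : {poly %/ q}, b != 0 & b * a = 0.
Proof.
move=> qm q1 /eqP/det0P[v v0 va]; exists (in_qpoly q (rVpoly v)).
  apply: contraNneq v0 => v0; rewrite -(qrow_cl_rVpoly qm q1 v) v0.
  by rewrite /qrow linear0.
apply: (qrow_inj qm q1); rewrite -mul_qrow_mulmat // qrow_cl_rVpoly // va.
by rewrite /qrow linear0.
Qed.

Section QuotientMap.

Variables (R R' : comNzRingType) (phi : {rmorphism R -> R'}) (q : {poly R}).
Hypotheses (q_monic : q \is monic) (q_gt1 : (1 < size q)%N).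
Let q' := map_poly phi q.

Lemma map_monic_id : q' \is monic. Proof. exact: monic_map. Qed.

Lemma size_map_monic : size q' = size q.
Proof. by rewrite size_map_poly_id0 // (monicP q_monic) rmorph1 oner_neq0. Qed.

Let q'_gt1 : (1 < size q')%N. Proof. by rewrite size_map_monic. Qed.

Definition qmap (a : {poly %/ q}) : {poly %/ q'} := in_qpoly q' (map_poly phi a).

Lemma qmap_cl f : qmap (in_qpoly q f) = in_qpoly q' (map_poly phi f).
Proof.
apply/(cl_eq map_monic_id) => //; have [e fe] := cl_divE q_monic q_gt1 f.
exists (- map_poly phi e); rewrite mulNr; apply/eqP; rewrite -subr_eq opprK.
by rewrite -rmorphM -rmorphD -fe.
Qed.

Lemma val_qmap a : qmap a = map_poly phi a :> {poly R'}.
Proof.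
rewrite /qmap cl_small // ?map_monic_id // (leq_ltn_trans (size_poly _ _)) //.
by rewrite size_map_monic size_qpoly_lt.
Qed.

Lemma qmapM a b : qmap (a * b) = qmap a * qmap b.
Proof.
by rewrite -(cl_id a) -(cl_id b) -rmorphM !qmap_cl !rmorphM.
Qed.

Lemma qmapD a b : qmap (a + b) = qmap a + qmap b.
Proof. by rewrite -(cl_id a) -(cl_id b) -rmorphD !qmap_cl !rmorphD. Qed.

End QuotientMap.

(** Polynomials in two variables are nested with y outside and x inside, so that being monic in y
    concerns the outer polynomial and the affine ring is a free k[x]-module. *)
Definition ev2 (R : comNzRingType) (x y : R) (f : {poly {poly R}}) : R :=
  f.[y%:P].[x].

Lemma ev2E (R : comNzRingType) (x y : R) f :
  ev2 x y f = (map_poly (horner_eval x) f).[y].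
Proof. by rewrite -{2}(hornerC y x) (horner_map (horner_eval x)). Qed.

Section Ev2.
Variables (R : comNzRingType) (x y : R).
Implicit Types f g : {poly {poly R}}.
Lemma ev2_is_zmod_morphism : zmod_morphism (@ev2 R x y).
Proof. by move=> f g; rewrite /ev2 !hornerE. Qed.
Lemma ev2_is_monoid_morphism : monoid_morphism (@ev2 R x y).
Proof. by split=> [|f g]; rewrite /ev2 !hornerE. Qed.
HB.instance Definition _ :=
  GRing.isZmodMorphism.Build {poly {poly R}} R (@ev2 R x y) ev2_is_zmod_morphism.
HB.instance Definition _ :=
  GRing.isMonoidMorphism.Build {poly {poly R}} R (@ev2 R x y)
    ev2_is_monoid_morphism.
Lemma ev2C (c : {poly R}) : ev2 x y c%:P = c.[x].
Proof. by rewrite /ev2 hornerC. Qed.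
Lemma ev2X : ev2 x y 'X = y. Proof. by rewrite /ev2 hornerX hornerC. Qed.
Lemma ev2_XsubC w : ev2 x y ('X - w%:P%:P) = y - w.
Proof. by rewrite /ev2 !hornerE. Qed.
Lemma ev2_CXsubC w : ev2 x y ('X - w%:P)%:P = x - w.
Proof. by rewrite /ev2 !hornerE. Qed.
End Ev2.

(** * Points of an affine curve over an algebraically closed field *)

Section AffineCurve.

Variables (k : closedFieldType) (q : {poly {poly k}}).
Hypotheses (q_monic : q \is monic) (q_gt1 : (1 < size q)%N).

Local Notation A := {poly %/ q}.
Local Notation cl := (in_qpoly q).
Implicit Types (a b s r u : A) (f g : {poly {poly k}}).

Definition evq (x y : k) (a : A) : k := ev2 x y a.

Lemma evq_cl x y f : ev2 x y q = 0 -> evq x y (cl f) = ev2 x y f.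
Proof.
move=> q0; have [e {2}->] := cl_divE q_monic q_gt1 f.
by rewrite rmorphD rmorphM /= q0 mulr0 addr0.
Qed.

Lemma evqM x y a b : ev2 x y q = 0 -> evq x y (a * b) = evq x y a * evq x y b.
Proof.
by move=> q0; rewrite -(cl_id a) -(cl_id b) -rmorphM !evq_cl // rmorphM.
Qed.

Lemma evqD x y a b : evq x y (a + b) = evq x y a + evq x y b.
Proof. by rewrite /evq poly_of_qpolyD rmorphD. Qed.

Lemma evq0 x y : evq x y 0 = 0.
Proof. by rewrite /evq rmorph0. Qed.

Lemma evqN x y a : evq x y (- a) = - evq x y a.
Proof. by apply/eqP; rewrite -addr_eq0 -evqD addNr evq0. Qed.

Lemma evq1 x y : ev2 x y q = 0 -> evq x y 1 = 1.
Proof. by move=> q0; rewrite -(rmorph1 cl) evq_cl // rmorph1. Qed.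

Lemma evqX x y a n : ev2 x y q = 0 -> evq x y (a ^+ n) = evq x y a ^+ n.
Proof.
by move=> q0; elim: n => [|n IH]; rewrite ?evq1 // !exprS evqM // IH.
Qed.

Lemma evqZ x y c : ev2 x y q = 0 -> evq x y (c *: 1) = c.[x].
Proof. by move=> q0; rewrite /evq poly_of_qpolyZ -mul_polyC rmorphM /= ev2C -/(evq _ _ 1) evq1 // mulr1. Qed.

Let fib (x : k) f := map_poly (horner_eval x) f.

Lemma size_fib x : size (fib x q) = size q.
Proof. exact: size_map_monic. Qed.

(** A kernel vector of the specialized multiplication matrix is a polynomial of degree below that of
    q whose product with [a] is a multiple of the fiber of q. The fibers of q and [a] have no common
    root, so the polynomial itself is such a multiple, hence zero. *)
Lemma qnorm_fibre a x :
    (forall y, ev2 x y q = 0 -> evq x y a != 0) ->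
  (qnorm a).[x] != 0.
Proof.
move=> aP; apply/negP => /eqP.
rewrite -[_.[x]]/(horner_eval x _) /qnorm -det_map_mx => /eqP/det0P[v v0 va].
pose w := map_mx polyC v; pose b := cl (rVpoly w).
have wv : map_mx (horner_eval x) w = v.
  by apply/matrixP=> i j; rewrite !mxE /horner_eval hornerC.
have /(congr1 (map_mx (horner_eval x))) := mul_qrow_mulmat q_monic q_gt1 a b.
rewrite {1}/b qrow_cl_rVpoly // map_mxM wv va => /esym ba0.
have fba : fib x (b * a : A) = 0.
  apply/polyP=> j; rewrite coef_map coef0.
  case: (ltnP j (size q).-1) => [lt_j|le_j]; last first.
    rewrite (_ : (b * a : A)`_j = 0) ?raddf0 // nth_default //.
    by apply: leq_trans le_j; rewrite -ltnS prednK ?size_qpoly_lt // ltnW.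
  by have /rowP/(_ (Ordinal lt_j)) := ba0; rewrite !mxE.
have [e eba] := val_mul_divE q_monic q_gt1 b a.
have dvd_ba : fib x q %| fib x b * fib x a.
  by rewrite /fib -rmorphM eba rmorphD rmorphM /= -/(fib x (b * a : A)) fba add0r dvdp_mull.
have cop : coprimep (fib x q) (fib x a).
  apply/Pdiv.ClosedField.coprimepP => y /rootP qy.
  by rewrite -ev2E; apply: aP; rewrite ev2E.
move: dvd_ba; rewrite Gauss_dvdpl // => dvd_b.
case/negP: v0; apply/eqP; rewrite -wv.
have b0 : fib x b = 0.
  apply/eqP; apply: contraTT dvd_b => bn0; apply: contraL (leqnn (size q)) => dq.
  have := dvdp_leq bn0 dq; rewrite size_fib => le_qb.
  have := leq_trans le_qb (size_poly _ _).
  by rewrite leqNgt size_qpoly_lt.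
have bw : qrow b = w by rewrite /b qrow_cl_rVpoly.
apply/rowP => j; have /(congr1 (fun p : {poly k} => p`_j)) := b0.
by rewrite coef_map coef0 -bw !mxE.
Qed.

Lemma qnorm_root a x y : ev2 x y q = 0 -> evq x y a = 0 -> (qnorm a).[x] = 0.
Proof.
move=> q0 a0; have [b /(congr1 (evq x y))] := qnorm_mul q_monic q_gt1 a.
by rewrite evqM // a0 mulr0 evqZ.
Qed.

(* An ideal of A that is not contained in any maximal ideal contains 1; the
   norm reduces this to the principal ideal domain k[x]. *)
Lemma local_unit_ideal (I : A -> Prop) :
    I 0 -> (forall a b, I a -> I b -> I (a + b)) -> (forall a b, I b -> I (a * b)) ->
    (forall x y, ev2 x y q = 0 -> exists2 s, I s & evq x y s != 0) ->
  I 1.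
Proof.
move=> I0 ID IM IP.
have fibre x : exists2 s, I s & forall y, ev2 x y q = 0 -> evq x y s != 0.
  have [rs qrs] := closed_field_poly_normal (fib x q).
  have {}qrs y : ev2 x y q = 0 -> y \in rs.
    rewrite ev2E -/(fib x q) => /rootP; rewrite qrs rootZ ?root_prod_XsubC //.
    by rewrite lead_coef_eq0 -size_poly_eq0 size_fib -lt0n ltnW.
  suff [s Is sP] : exists2 s, I s &
      forall y, y \in rs -> ev2 x y q = 0 -> evq x y s != 0.
    by exists s => // y q0; apply: sP => //; apply: qrs.
  elim: rs {qrs} => [|z rs [s Is sP]]; first by exists 0.
  have [z_rs|z_rs] := boolP (z \in rs).
    by exists s => // y; rewrite inE => /predU1P[->|]; apply: sP.
  have [qz|qz] := eqVneq (ev2 x z q) 0; last first.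
    exists s => // y; rewrite inE => /predU1P[->|]; last exact: sP.
    by move=> qz0; rewrite qz0 eqxx in qz.
  have [s' Is' s'z] := IP x z qz.
  pose d := \prod_(y <- rs) ('X - y%:P%:P) : {poly {poly k}}.
  have dE y : ev2 x y d = \prod_(w <- rs) (y - w).
    rewrite rmorph_prod /=; apply: eq_bigr => w _.
    exact: ev2_XsubC.
  (* The first term vanishes at z and the second at every point of [rs], so at each point of the
     enlarged list exactly one term survives. *)
  exists (cl ('X - z%:P%:P) * s + cl d * s'); first by apply: ID; apply: IM.
  move=> y; rewrite inE => yzrs q0; rewrite evqD !evqM // !evq_cl //.
  rewrite ev2_XsubC dE.
  have [yz|yz] := eqVneq y z.
    rewrite yz subrr mul0r add0r mulf_neq0 //.
    by rewrite prodf_seq_neq0; apply/allP => w w_rs /=; rewrite subr_eq0; apply: contraNneq z_rs => ->.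
  have y_rs : y \in rs by move: yzrs; rewrite (negbTE yz).
  by rewrite (big_rem y) //= subrr mul0r mul0r addr0 mulf_neq0 ?subr_eq0 ?sP.
(* The contraction of [I] to k[x] has no common root, by taking norms. The induction on the degree
   replaces c by its gcd with an element of [J] that does not vanish at a root of c. *)
pose J (c : {poly k}) := I (c *: 1).
have JM (c d : {poly k}) : J d -> J (c * d).
  by move=> Jd; rewrite /J -scalerA -[d *: 1]mul1r scalerAl; apply: IM.
have JD c d : J c -> J d -> J (c + d) by move=> Jc Jd; rewrite /J scalerDl; apply: ID.
have Jx x : exists2 c, J c & c.[x] != 0.
  have [s Is sP] := fibre x; have [b bs] := qnorm_mul q_monic q_gt1 s.
  by exists (qnorm s); [rewrite /J -bs; apply: IM|apply: qnorm_fibre].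
suff [c Jc c1] : exists2 c, J c & size c = 1%N.
  have [u u0 cu] := size_poly1P c (introT eqP c1).
  have := JM (u^-1)%:P _ Jc.
  by rewrite /J cu -polyCM mulVf // scale1r.
have [c Jc c0] := Jx 0.
have {c0} : c != 0 by apply: contraNneq c0 => ->; rewrite horner0.
elim: {c}(size c) {-2}c (leqnn (size c)) Jc => [|n IH] c le_c Jc cn0.
  by move: le_c; rewrite leqn0 size_poly_eq0 (negbTE cn0).
have [c1|/closed_rootP[x rx]] := eqVneq (size c) 1%N; first by exists c.
have [d Jd dx] := Jx x; pose g := gcdp c d.
have [u ug] := Bezoutp c d.
have Jg : J g.
  have /eqpP[[w1 w2] /andP[/= w10 w20]] := ug.
  move/(congr1 (fun p => w2^-1 *: p)); rewrite !scalerA mulVf // scale1r => Eg.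
  rewrite /g -Eg -mul_polyC; apply: (JM).
  by apply: JD; apply: (JM).
have gn0 : g != 0 by rewrite gcdp_eq0 negb_and cn0.
apply: (IH g) => //; rewrite -ltnS; apply: leq_trans le_c.
rewrite ltn_neqAle dvdp_leq ?dvdp_gcdl // andbT dvdp_size_eqp ?dvdp_gcdl //.
apply: contra dx => gc; rewrite -rootE -dvdp_XsubCl.
by rewrite -dvdp_XsubCl in rx; rewrite (dvdp_trans rx) // -(eqp_dvdl _ gc) dvdp_gcdr.
Qed.

(** The denominators s for which s a is a multiple of b form an ideal that lies in no maximal
    ideal. *)
Lemma local_dvd a b :
    (forall x y, ev2 x y q = 0 -> exists s r, evq x y s != 0 /\ s * a = r * b) ->
  exists c, a = c * b.
Proof.
move=> loc.
have [||||c] := @local_unit_ideal (fun s => exists r, s * a = r * b).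
- by exists 0; rewrite !mul0r.
- by move=> s s' [r rE] [r' r'E]; exists (r + r'); rewrite !mulrDl rE r'E.
- by move=> t s [r rE]; exists (t * r); rewrite -!mulrA rE.
- by move=> x y /loc[s [r [s0 sE]]]; exists s => //; exists r.
by rewrite mul1r; exists c.
Qed.

End AffineCurve.

Definition dX (R : comNzRingType) (f : {poly {poly R}}) : {poly {poly R}} :=
  map_poly (@deriv R) f.

Lemma coef_dX (R : comNzRingType) (f : {poly {poly R}}) i : (dX f)`_i = (f`_i)^`().
Proof. by rewrite coef_map_id0 // linear0. Qed.

Lemma map_polyC_XsubC (R : comNzRingType) (y : R) :
  map_poly polyC ('X - y%:P) = 'X - y%:P%:P.
Proof. by rewrite rmorphB /= map_polyX map_polyC. Qed.

Section LocalExpansion.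

Variable k : fieldType.

Lemma horner_expand (c : {poly k}) x :
  exists2 d : {poly k}, c = (c.[x])%:P + ('X - x%:P) * d & d.[x] = c^`().[x].
Proof.
have /factor_theorem[d dE] : root (c - (c.[x])%:P) x.
  by rewrite /root !hornerE subrr.
have {dE}cE : c = (c.[x])%:P + ('X - x%:P) * d.
  by rewrite mulrC -dE addrC subrK.
exists d => //; rewrite cE.
by rewrite derivD derivC derivM derivXsubC !hornerE subrr mul0r addr0.
Qed.

(** Taylor expansion to first order around a vertical line: the cofactor restricts on that line to
    the partial derivative in x. *)
Lemma ev2_expand_x (f : {poly {poly k}}) x :
  exists2 b : {poly {poly k}},
    f = map_poly polyC (map_poly (horner_eval x) f) + ('X - x%:P)%:P * b
    & forall y, ev2 x y b = ev2 x y (dX f).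
Proof.
elim/poly_ind: f => [|f c [b fE bE]].
  by exists 0 => [|y]; rewrite ?map_poly0 ?mulr0 ?addr0 // /dX map_poly0.
have [d cE dE] := horner_expand c x; exists (b * 'X + d%:P) => [|y].
  rewrite {1}fE {1}cE !rmorphD !rmorphM /= !map_polyX !map_polyC /=.
  by rewrite /horner_eval; ring.
have -> : dX (f * 'X + c%:P) = dX f * 'X + c^`()%:P.
  apply/polyP => i; rewrite coef_dX !coefD !coefMX !coefC coef_dX derivD.
  by case: i => [|i]; rewrite /= ?linear0 ?add0r // linear0 addr0.
by rewrite !rmorphD !rmorphM /= !ev2X !ev2C bE dE.
Qed.

End LocalExpansion.

(** * Uniformizers and orders at smooth points *)

Section LocalRing.

Variables (k : closedFieldType) (q : {poly {poly k}}).
Hypotheses (q_monic : q \is monic) (q_gt1 : (1 < size q)%N).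

Local Notation A := {poly %/ q}.
Local Notation cl := (in_qpoly q).
Implicit Types (a b s r u t h p : A).

Definition px (x : k) : A := cl ('X - x%:P)%:P.
Definition py (y : k) : A := cl ('X - y%:P%:P).

(** The local ring is encoded by denominators in [A] that do not vanish at the point. The second
    clause says that p generates the maximal ideal, with one denominator for all a. The third says
    that x - x0 is a power of p up to units, and this is what makes orders finite. *)
Definition uniformizer (x y : k) p :=
  [/\ evq x y p = 0,
      exists2 s, evq x y s != 0 &
        forall a, evq x y a = 0 -> exists b, s * a = p * b
    & exists e t h, [/\ evq x y t != 0, evq x y h != 0 & px x * t = p ^+ e * h]].

Section AtPoint.

Variables x y : k.
Hypothesis q0 : ev2 x y q = 0.

Lemma evq_px : evq x y (px x) = 0.
Proof. by rewrite evq_cl // ev2_CXsubC subrr. Qed.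

Lemma evq_py : evq x y (py y) = 0.
Proof. by rewrite evq_cl // ev2_XsubC subrr. Qed.

Lemma vanish_expand a : evq x y a = 0 -> exists c d, a = px x * c + py y * d.
Proof.
move=> a0; have [b aE _] := ev2_expand_x a x.
have /factor_theorem[c cE] : root (map_poly (horner_eval x) a) y.
  by rewrite /root -ev2E; apply/eqP.
exists (cl b), (cl (map_poly polyC c)).
rewrite -[a]cl_id {1}aE cE rmorphM /= map_polyC_XsubC in_qpolyD !in_qpolyM.
by rewrite addrC [_ * cl ('X - _)]mulrC.
Qed.

(** The equation of the curve at the point, split as (x - x0) B + (y - y0) g = 0. Where B or g is a
    unit, one of x - x0 and y - y0 is a multiple of the other, which is then a uniformizer. *)
Lemma curve_expand :
  exists B g, [/\ px x * B = - (py y * cl (map_poly polyC g)),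
     evq x y B = ev2 x y (dX q),
     map_poly (horner_eval x) q = g * ('X - y%:P)
     & g.[y] = ev2 x y q^`()].
Proof.
have [b qE bE] := ev2_expand_x q x.
have /factor_theorem[g gE] : root (map_poly (horner_eval x) q) y.
  by rewrite /root -ev2E; apply/eqP.
exists (cl b), g; split => //.
- have /(congr1 cl) := qE; rewrite cl_q // gE rmorphM /= map_polyC_XsubC.
  move=> /esym; rewrite in_qpolyD !in_qpolyM => /eqP; rewrite addrC addr_eq0 => /eqP ->.
  by rewrite [_ * cl ('X - _)]mulrC.
- by rewrite evq_cl // bE.
- by rewrite ev2E -deriv_map gE derivM derivXsubC !hornerE subrr mulr0 add0r.
Qed.

Lemma evq_map_polyC (g : {poly k}) : evq x y (cl (map_poly polyC g)) = g.[y].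
Proof.
rewrite evq_cl // ev2E -map_poly_comp; congr (_.[_]).
by rewrite map_poly_id // => c _ /=; rewrite /horner_eval hornerC.
Qed.

Lemma uniformizer_px : ev2 x y q^`() != 0 -> uniformizer x y (px x).
Proof.
move=> qy; have [B [g [BG _ _ gy]]] := curve_expand.
split; first exact: evq_px.
  exists (cl (map_poly polyC g)); first by rewrite evq_map_polyC gy.
  move=> a /vanish_expand[c [d ->]].
  exists (cl (map_poly polyC g) * c - B * d).
  have -> : cl (map_poly polyC g) * (px x * c + py y * d) =
     px x * (cl (map_poly polyC g) * c) + (py y * cl (map_poly polyC g)) * d by ring.
  by rewrite -[py y * _]opprK -BG; ring.
by exists 1%N, 1, 1; rewrite evq1 // oner_neq0 expr1.
Qed.

Lemma uniformizer_py : ev2 x y (dX q) != 0 -> uniformizer x y (py y).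
Proof.
move=> qx; have [B [g [BG By q0E _]]] := curve_expand.
have B0 : evq x y B != 0 by rewrite By.
split; first exact: evq_py.
  exists B => // a /vanish_expand[c [d ->]].
  exists (- cl (map_poly polyC g) * c + B * d).
  have -> : B * (px x * c + py y * d) = (px x * B) * c + py y * (B * d) by ring.
  by rewrite BG; ring.
have [m [h hy gE]] := multiplicity_XsubC g y.
have gn0 : g != 0.
  apply/negP => /eqP g0; have := size_fib q_monic x.
  by rewrite q0E g0 mul0r size_poly0 => s0; move: q_gt1; rewrite -s0.
rewrite gn0 /= in hy.
(* The fiber polynomial is h times the power m + 1 of Y - y0, so x - x0 is (y - y0)^(m + 1) up to
   units. *)
exists m.+1, B, (- cl (map_poly polyC h)); split=> //.
  by rewrite evqN oppr_eq0 evq_map_polyC.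
rewrite BG gE rmorphM rmorphXn /= mulrN rmorphM rmorphXn /=.
have -> : cl (map_poly polyC ('X - y%:P)) = py y.
  by rewrite map_polyC_XsubC.
by rewrite exprS; congr (- _); ring.
Qed.

Lemma uniformizer_exists :
    (ev2 x y (dX q) != 0 \/ ev2 x y q^`() != 0) ->
  exists p, uniformizer x y p.
Proof.
by case=> [/uniformizer_py|/uniformizer_px]; [exists (py y)|exists (px x)].
Qed.

End AtPoint.

Definition smooth :=
  forall x y, ev2 x y q = 0 -> ev2 x y (dX q) != 0 \/ ev2 x y q^`() != 0.

Definition qdomain := forall a b, a * b = 0 -> a = 0 \/ b = 0.

(** The equation a = unit * p^m of the local ring, cleared of denominators. It is a relation, so
    existence and uniqueness of the order are separate lemmas. *)
Definition ordat (x y : k) p a (m : nat) :=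
  exists s u, [/\ evq x y s != 0, evq x y u != 0 & s * a = u * p ^+ m].

Hypothesis A_dom : qdomain.

Lemma qdom_mulf_neq0 a b : a != 0 -> b != 0 -> a * b != 0.
Proof. by move=> a0 b0; apply/negP => /eqP/A_dom[] ab; rewrite ab eqxx in a0 b0. Qed.

Lemma qdom_expf_neq0 a n : a != 0 -> a ^+ n != 0.
Proof.
move=> a0; elim: n => [|n IH]; first by rewrite expr0 oner_neq0.
by rewrite exprS qdom_mulf_neq0.
Qed.

Lemma qdom_mulfI c a b : c != 0 -> c * a = c * b -> a = b.
Proof.
move=> c0 /eqP; rewrite -subr_eq0 -mulrBr => /eqP/A_dom[c0'|/eqP].
  by rewrite c0' eqxx in c0.
by rewrite subr_eq0 => /eqP.
Qed.

Lemma qdom_qnorm_neq0 a : a != 0 -> qnorm a != 0.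
Proof.
move=> a0; apply/negP => /eqP/(qnorm_eq0 q_monic q_gt1)[b b0 /A_dom[] ab];
  by rewrite ab eqxx in a0 b0.
Qed.

Lemma evq_neq0 x y a : evq x y a != 0 -> a != 0.
Proof. by apply: contraNneq => ->; rewrite evq0. Qed.

Lemma clC (c : {poly k}) : (cl c%:P : {poly {poly k}}) = c%:P.
Proof. exact: cl_small (leq_ltn_trans (size_polyC_leq1 c) q_gt1). Qed.

Lemma clC_scale (c : {poly k}) : cl c%:P = c *: 1.
Proof. by rewrite -(rmorph1 cl) -linearZ -mul_polyC mulr1. Qed.

Lemma px_neq0 x : px x != 0.
Proof.
apply/negP => /eqP E; have := clC ('X - x%:P); rewrite -/(px x) E.
by move/esym/eqP; rewrite polyC_eq0 polyXsubC_eq0.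
Qed.

Section OrdAt.

Variables (x y : k) (p : A).
Hypothesis (q0 : ev2 x y q = 0) (p_unif : uniformizer x y p).

Lemma unif_neq0 : p != 0.
Proof.
have [p0 _ [[|e] [t [h [t0 h0]]]]] := p_unif.
  rewrite expr0 mul1r => /(congr1 (evq x y)); rewrite evqM // evq_px // mul0r.
  by move=> h0'; rewrite -h0' eqxx in h0.
move=> pxE; apply: contraNneq (px_neq0 x) => p0'.
by move: pxE; rewrite p0' expr0n /= mul0r => /A_dom[->|t0'] //; rewrite t0' evq0 eqxx in t0.
Qed.

(** Some multiple of a is its norm, which is (x - x0)^m times a unit at the point, and x - x0 is p^e
    up to units. Hence p can be divided out of a at most e m times. *)
Lemma ord_exists a : a != 0 -> exists m, ordat x y p a m.
Proof.
move=> a0; have [p0 [s s0 sP] [e [t [h [t0 h0 pxE]]]]] := p_unif.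
have [b bE] := qnorm_mul q_monic q_gt1 a.
have [m [n nx nE]] := multiplicity_XsubC (qnorm a) x.
rewrite qdom_qnorm_neq0 //= in nx.
have bE' : b * a = cl n%:P * px x ^+ m.
  by rewrite bE nE -clC_scale polyCM in_qpolyM polyC_exp rmorphXn.
have chain j : (exists i, ordat x y p a i) \/ exists c, s ^+ j * a = p ^+ j * c.
  elim: j => [|j [|[c cE]]]; [by right; exists a; rewrite !expr0|by left|].
  have [c0|c0] := eqVneq (evq x y c) 0; last first.
    by left; exists j, (s ^+ j), c; rewrite evqX // expf_neq0 // cE mulrC.
  by have [d dE] := sP c c0; right; exists d; rewrite !exprSr -!mulrA -dE mulrCA cE; ring.
have [//|[c cE]] := chain (e * m).+1.
have nP : evq x y (cl n%:P) != 0 by rewrite evq_cl // ev2C.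
have := congr1 (fun z => b * z * t ^+ m) cE.
have -> : b * (s ^+ (e * m).+1 * a) * t ^+ m =
    p ^+ (e * m) * (s ^+ (e * m).+1 * cl n%:P * h ^+ m).
  have -> : b * (s ^+ (e * m).+1 * a) * t ^+ m = s ^+ (e * m).+1 * (b * a) * t ^+ m.
    by rewrite mulrCA.
  rewrite bE' mulrA -[_ * px x ^+ m * _]mulrA -exprMn pxE exprMn -exprM.
  by rewrite mulrCA.
have -> : b * (p ^+ (e * m).+1 * c) * t ^+ m = p ^+ (e * m) * (p * (b * c * t ^+ m)).
  by rewrite exprS; ring.
move/(qdom_mulfI (qdom_expf_neq0 _ unif_neq0))/(congr1 (evq x y)).
rewrite !evqM // !evqX // p0 mul0r => /eqP.
by rewrite !mulf_eq0 !expf_eq0 /= (negbTE s0) (negbTE nP) (negbTE h0) andbF.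
Qed.

Lemma ord_uniq a m n : ordat x y p a m -> ordat x y p a n -> m = n.
Proof.
have [p0 _ _] := p_unif.
wlog lt_mn : m n / (m < n)%N => [th|] am an.
  by have [/th->|/th->|] := ltngtP m n.
have [s [u [s0 u0 aE]]] := am; have [s' [u' [s'0 u'0 a'E]]] := an.
have : p ^+ m * (s' * u) = p ^+ m * (p * (p ^+ (n - m).-1 * (s * u'))).
  have -> : p ^+ m * (s' * u) = s' * (u * p ^+ m) by ring.
  rewrite -aE mulrCA a'E [RHS]mulrA [RHS]mulrA -exprSr -exprD.
  have -> : (m.+1 + (n - m).-1 = n)%N by move: lt_mn; lia.
  by ring.
move/(qdom_mulfI (qdom_expf_neq0 _ unif_neq0))/(congr1 (evq x y))/eqP.
by rewrite !evqM // p0 mul0r mulf_eq0 (negbTE s'0) (negbTE u0).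
Qed.

Lemma ordM a b m n :
  ordat x y p a m -> ordat x y p b n -> ordat x y p (a * b) (m + n).
Proof.
move=> [s [u [s0 u0 aE]]] [s' [u' [s'0 u'0 bE]]].
exists (s * s'), (u * u'); rewrite !evqM // !mulf_neq0 //; split=> //.
have -> : s * s' * (a * b) = (s * a) * (s' * b) by ring.
by rewrite aE bE exprD; ring.
Qed.

Lemma ord_unit a : evq x y a != 0 -> ordat x y p a 0.
Proof.
by move=> a0; exists 1, a; rewrite evq1 // oner_neq0; split=> //; rewrite expr0 mul1r mulr1.
Qed.

Lemma ordX a m n : ordat x y p a m -> ordat x y p (a ^+ n) (n * m).
Proof.
move=> am; elim: n => [|n IH]; last by rewrite exprS mulSn; apply: ordM.
by rewrite expr0 mul0n; apply: ord_unit; rewrite evq1 // oner_neq0.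
Qed.

Lemma ord0_unit a : ordat x y p a 0 -> evq x y a != 0.
Proof.
move=> [s [u [s0 u0]]]; rewrite expr0 mulr1 => /(congr1 (evq x y)) aE.
by apply: contraNneq u0 => a0; rewrite -aE evqM // a0 mulr0.
Qed.

Lemma ord_neq0 a m : ordat x y p a m -> a != 0.
Proof.
move=> [s [u [s0 u0 aE]]]; apply: contraNneq (qdom_mulf_neq0 (evq_neq0 u0) (qdom_expf_neq0 m unif_neq0)).
by move=> a0; rewrite -aE a0 mulr0.
Qed.

Lemma ord_local_dvd a b m n : ordat x y p a m -> ordat x y p b n -> (n <= m)%N ->
  exists s r, evq x y s != 0 /\ s * a = r * b.
Proof.
move=> [s [u [s0 u0 aE]]] [s' [u' [s'0 u'0 bE]]] le_nm.
exists (u' * s), (u * p ^+ (m - n) * s'); split; first by rewrite evqM // mulf_neq0.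
have -> : u * p ^+ (m - n) * s' * b = u * p ^+ (m - n) * (s' * b) by ring.
rewrite bE -mulrA aE; have -> : p ^+ m = p ^+ (m - n) * p ^+ n by rewrite -exprD subnK.
by ring.
Qed.

Lemma local_dvd_ord a b s r m n : s * a = r * b -> evq x y s != 0 ->
  ordat x y p a m -> ordat x y p b n -> (n <= m)%N.
Proof.
move=> sa s0 am bn.
have r0 : r != 0.
  apply: contraNneq (qdom_mulf_neq0 (evq_neq0 s0) (ord_neq0 am)).
  by rewrite sa => ->; rewrite mul0r.
have [j rj] := ord_exists r0.
have := ordM (ord_unit s0) am; rewrite add0n sa => sm.
by rewrite (ord_uniq sm (ordM rj bn)) leq_addl.
Qed.

End OrdAt.

Hypothesis q_smooth : smooth.

(** The local rings of a smooth curve are discrete valuation rings, and divisibility is a local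
    property. *)
Lemma dvd_by_ord a b : a != 0 -> b != 0 ->
    (forall x y p m n, ev2 x y q = 0 -> uniformizer x y p ->
       ordat x y p a m -> ordat x y p b n -> (n <= m)%N) ->
  exists c, a = c * b.
Proof.
move=> a0 b0 le_ord; apply: (local_dvd q_monic q_gt1) => x y q0.
have [p pu] := uniformizer_exists q0 (q_smooth q0).
have [m am] := ord_exists q0 pu a0; have [n bn] := ord_exists q0 pu b0.
exact: ord_local_dvd am bn (le_ord _ _ _ _ _ q0 pu am bn).
Qed.

End LocalRing.

(** * Total degree and the two charts *)

Section TotalDegree.

Variable R : nzRingType.
Implicit Types f g : {poly {poly R}}.

(** Truncated subtraction forces the coefficients of y^j with j > d to be zero. *)
Definition tdeg_le (d : nat) f := forall j, (size (f`_j)%R <= d.+1 - j)%N.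

Lemma tdeg_leP d f :
  reflect (tdeg_le d f) (all (fun j => size (f`_j)%R <= d.+1 - j)%N (iota 0 (size f))).
Proof.
apply: (iffP allP) => [fd j|fd j _]; last exact: fd.
have [lt_j|le_j] := ltnP j (size f); first by apply: fd; rewrite mem_iota.
by rewrite nth_default // size_poly0.
Qed.

Lemma tdeg_le0 d : tdeg_le d 0.
Proof. by move=> j; rewrite coef0 size_poly0. Qed.

Lemma tdeg_leW d e f : (d <= e)%N -> tdeg_le d f -> tdeg_le e f.
Proof. by move=> le_de fd j; apply: leq_trans (fd j) _; apply: leq_sub2r. Qed.

Lemma tdeg_leD d f g : tdeg_le d f -> tdeg_le d g -> tdeg_le d (f + g).
Proof.
move=> fd gd j; rewrite coefD; apply: leq_trans (size_polyD _ _) _.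
by rewrite geq_max fd gd.
Qed.

Lemma tdeg_leN d f : tdeg_le d f -> tdeg_le d (- f).
Proof. by move=> fd j; rewrite coefN size_polyN. Qed.

Lemma tdeg_leB d f g : tdeg_le d f -> tdeg_le d g -> tdeg_le d (f - g).
Proof. by move=> fd gd; apply: tdeg_leD => //; apply: tdeg_leN. Qed.

Lemma tdeg_le_sum (I : Type) (r : seq I) (P : pred I) (F : I -> {poly {poly R}}) d :
  (forall i, P i -> tdeg_le d (F i)) -> tdeg_le d (\sum_(i <- r | P i) F i).
Proof.
move=> Fd; elim/big_ind: _ => // [|f g]; [exact: tdeg_le0|exact: tdeg_leD].
Qed.

Lemma tdeg_leM d e f g : tdeg_le d f -> tdeg_le e g -> tdeg_le (d + e) (f * g).
Proof.
move=> fd ge j; rewrite coefM; elim/big_ind: _ => [|p r pd rd|i _].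
- by rewrite size_poly0.
- by apply: leq_trans (size_polyD _ _) _; rewrite geq_max pd rd.
have := fd i; have := ge (j - i)%N; have lt_i := ltn_ord i.
have [->|f0] := eqVneq f`_i 0; first by rewrite mul0r size_poly0.
have [->|g0] := eqVneq g`_(j - i) 0; first by rewrite mulr0 size_poly0.
rewrite -size_poly_gt0 in f0; rewrite -size_poly_gt0 in g0.
by move=> gs fs; apply: leq_trans (size_polyMleq _ _) _; move: gs fs; lia.
Qed.

Lemma tdeg_le1 : tdeg_le 0 1.
Proof. by case=> [|j]; rewrite coefC /= ?size_poly0 // size_poly1. Qed.

Lemma tdeg_leX d f n : tdeg_le d f -> tdeg_le (n * d) (f ^+ n).
Proof.
move=> fd; elim: n => [|n IH]; first exact: tdeg_le1.
by rewrite exprS mulSn; apply: tdeg_leM.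
Qed.

Lemma tdeg_leC (c : {poly R}) d : (size c <= d.+1)%N -> tdeg_le d c%:P.
Proof. by move=> cd [|j]; rewrite coefC /= ?size_poly0 // subn0. Qed.

Lemma tdeg_leXy : tdeg_le 1 'X.
Proof. by case=> [|[|j]]; rewrite coefX /= ?size_poly0 ?size_poly1. Qed.

Lemma tdeg_leXx : tdeg_le 1 'X%:P.
Proof. by apply: tdeg_leC; rewrite size_polyX. Qed.

Lemma tdeg_le_exists f : exists d, tdeg_le d f.
Proof.
exists (size f + \max_(j < size f) size (f`_j)%R)%N => j.
have [lt_j|le_j] := ltnP j (size f); last by rewrite nth_default // size_poly0.
have le_jM : (size (f`_j)%R <= \max_(i < size f) size (f`_i)%R)%N.
  exact: (@leq_bigmax _ (fun i : 'I_(size f) => size (f`_i)%R) (Ordinal lt_j)).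
by apply: leq_trans le_jM _; move: lt_j; lia.
Qed.

Lemma tdeg_le_coef d f i j : tdeg_le d f -> (d < i + j)%N -> f`_j`_i = 0.
Proof. by move=> fd lt_d; rewrite nth_default // (leq_trans (fd j)) //; lia. Qed.

Lemma tdeg_leE d f : (forall i j, (d < i + j)%N -> f`_j`_i = 0) -> tdeg_le d f.
Proof. by move=> fd j; apply/leq_sizeP => i le_i; apply: fd; lia. Qed.

Lemma tdeg_le_size d f : tdeg_le d f -> (size f <= d.+1)%N.
Proof.
move=> fd; apply/leq_sizeP => j lt_j; apply/eqP; rewrite -size_poly_leq0.
by rewrite (leq_trans (fd j)) //; lia.
Qed.

End TotalDegree.

Lemma tdeg_le_map (R R' : nzRingType) (phi : {rmorphism R -> R'}) d
    (f : {poly {poly R}}) :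
  tdeg_le d f -> tdeg_le d (map_poly (map_poly phi) f).
Proof. by move=> fd j; rewrite coef_map; apply: leq_trans (size_poly _ _) (fd j). Qed.

Section TotalDegreeDivision.

Variables (R : comNzRingType) (q : {poly {poly R}}) (N : nat).
Hypotheses (q_monic : q \is monic) (q_size : size q = N.+1) (N_gt0 : (0 < N)%N).
Hypothesis q_tdeg : tdeg_le N q.

(** The leading term of q in y already has the full total degree N, so each step of the division
    subtracts a multiple of q whose total degree does not exceed d. *)
Lemma tdeg_le_divE d f : tdeg_le d f ->
  exists e r, [/\ f = r + e * q, (size r < size q)%N, tdeg_le d r,
                  tdeg_le (d - N) e & (d < N)%N -> e = 0].
Proof.
elim: {f}(size f) {-2}f (leqnn (size f)) => [|n IH] f le_f fd.
  move: le_f; rewrite leqn0 size_poly_eq0 => /eqP->.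
  by exists 0, 0; rewrite mul0r addr0 size_poly0 q_size; split=> //; apply: tdeg_le0.
have [lt_f|le_qf] := ltnP (size f) (size q).
  by exists 0, f; rewrite mul0r addr0; split=> //; apply: tdeg_le0.
pose c := lead_coef f; pose m := (size f).-1.
have sf : size f = m.+1 by rewrite /m prednK // (leq_trans _ le_qf) // q_size.
have le_Nm : (N <= m)%N by move: le_qf; rewrite sf q_size.
pose t := c%:P * 'X^(m - N).
have f0 : f != 0 by rewrite -size_poly_gt0 sf.
have c0 : (0 < size c)%N by rewrite size_poly_gt0 lead_coef_eq0.
have sc : (size c <= d.+1 - m)%N by have := fd m; rewrite /c /lead_coef sf.
have td : tdeg_le (d - N) t.
  move=> j; rewrite coefCM coefXn; case: eqVneq => [->|_]; last by rewrite mulr0 size_poly0.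
  by rewrite mulr1; move: sc le_Nm c0; lia.
have le_Nd : (N <= d)%N by move: sc c0 le_Nm; lia.
have [||e [r [fE sr rd ed _]]] := IH (f - t * q).
- apply/leq_sizeP => j le_j; rewrite coefB.
  have [lt_mj|le_jm] := ltnP m j.
    rewrite nth_default ?sf // sub0r; apply/eqP; rewrite oppr_eq0; apply/eqP.
    have st : (size t <= (m - N).+1)%N.
      by rewrite /t mul_polyC (leq_trans (size_scale_leq _ _)) // size_polyXn.
    rewrite nth_default //; apply: leq_trans (size_polyMleq _ _) _; rewrite q_size.
    by move: st lt_mj le_Nm; move: (size t) => z; lia.
  have -> : j = m by apply/eqP; rewrite eqn_leq le_jm; move: le_f le_j; rewrite sf; lia.
  rewrite /t -mulrA coefCM ['X^_ * q]mulrC coefMXn ltnNge leq_subr /= subKn //.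
  have -> : q`_N = 1 by rewrite -(monicP q_monic) /lead_coef q_size.
  by rewrite mulr1 /c /lead_coef sf subrr.
- apply: tdeg_leB => //; rewrite -(subnK le_Nd); exact: tdeg_leM.
exists (e + t), r; split=> //.
- by rewrite mulrDl addrA -fE subrK.
- exact: tdeg_leD.
by rewrite ltnNge le_Nd.
Qed.

Let q_gt1 : (1 < size q)%N. Proof. by rewrite q_size. Qed.

Lemma tdeg_le_cl d f : tdeg_le d f -> tdeg_le d (in_qpoly q f).
Proof.
move=> /tdeg_le_divE[e [r [-> sr rd _ _]]].
by rewrite in_qpolyD in_qpolyM cl_q // mulr0 addr0 cl_small.
Qed.

End TotalDegreeDivision.

Section Flip.

Variable R : comNzRingType.
Implicit Types f g : {poly {poly R}}.

(** Change of chart: if f is F(x, y, 1) for a form F of degree d, the result is F(1, y, w), with w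
    as inner variable. *)
Definition flip (d : nat) f : {poly {poly R}} :=
  \poly_(j < d.+1) \poly_(i < d.+1 - j) f`_j`_(d - j - i).

Lemma coef_flip d f i j :
  (flip d f)`_j`_i = if (i + j <= d)%N then f`_j`_(d - j - i) else 0.
Proof.
rewrite coef_poly; case: ifP => lt_j.
  rewrite coef_poly; case: ifP; case: ifP => //; lia.
by rewrite coef0; case: ifP => //; lia.
Qed.

Lemma poly2P f g : (forall i j, f`_j`_i = g`_j`_i) -> f = g.
Proof. by move=> fg; apply/polyP => j; apply/polyP => i. Qed.

Lemma tdeg_le_flip d f : tdeg_le d (flip d f).
Proof. by apply: tdeg_leE => i j lt_d; rewrite coef_flip leqNgt lt_d. Qed.

Lemma flipK d f : tdeg_le d f -> flip d (flip d f) = f.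
Proof.
move=> fd; apply: poly2P => i j; rewrite !coef_flip; case: (leqP (i + j)) => [le_d|lt_d].
  by rewrite ifT; [congr (f`_j`_(_)); lia|lia].
by rewrite (tdeg_le_coef fd).
Qed.

Lemma flipD d f g : flip d (f + g) = flip d f + flip d g.
Proof.
apply: poly2P => i j; rewrite !coefD !coef_flip !coefD.
by case: ifP; rewrite ?addr0.
Qed.

Lemma flipN d f : flip d (- f) = - flip d f.
Proof.
by apply: poly2P => i j; rewrite !coefN !coef_flip !coefN; case: ifP; rewrite ?oppr0.
Qed.

Lemma flipB d f g : flip d (f - g) = flip d f - flip d g.
Proof. by rewrite flipD flipN. Qed.

Lemma flip0 d : flip d 0 = 0.
Proof. by apply: poly2P => i j; rewrite coef_flip !coef0 if_same. Qed.

Lemma flip_shift d m f : tdeg_le d f -> flip (d + m) f = 'X^m%:P * flip d f.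
Proof.
move=> fd; apply: poly2P => i j; rewrite coefCM coefXnM !coef_flip.
case: (ltnP i m) => [lt_im|le_mi].
  by case: ifP => // le_d; rewrite (tdeg_le_coef fd) //; lia.
rewrite (_ : (i - m + j <= d)%N = (i + j <= d + m)%N); last by lia.
by case: ifP => // le_d; congr (f`_j`_(_)); lia.
Qed.

Lemma flip1 d : flip d 1 = 'X^d%:P.
Proof. by rewrite -[d]add0n flip_shift; [rewrite (_ : flip 0 1 = 1) ?mulr1 //; apply: poly2P => i [|j]; rewrite coef_flip ?addn0 ?addnS /= !coefC /= ?coef0 // ?if_same // leqn0; case: i => [|i] //=; rewrite coefC|exact: tdeg_le1]. Qed.

Lemma flip_mono d (c : R) i0 j0 : (i0 + j0 <= d)%N ->
  flip d ((c *: 'X^i0)%:P * 'X^j0) = (c *: 'X^(d - i0 - j0))%:P * 'X^j0.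
Proof.
move=> le_d; apply: poly2P => i j; rewrite coef_flip !coefCM !coefXn.
case: (eqVneq j j0) => [->|_]; last by rewrite !mulr0 !coef0 if_same.
rewrite !mulr1 !coefZ !coefXn; case: ifP => [le_i|nle_i].
  by congr (_ * (nat_of_bool _)%:R); lia.
by rewrite (_ : (i == _) = false) ?mulr0 //; lia.
Qed.

Lemma tdeg_mono_sum d f : tdeg_le d f ->
  f = \sum_(j < d.+1) \sum_(i < d.+1 | (i + j <= d)%N) (f`_j`_i *: 'X^i)%:P * 'X^j.
Proof.
move=> fd; apply: poly2P => i j; rewrite !coef_sum.
have [le_d|lt_d] := leqP (i + j) d; last first.
  rewrite (tdeg_le_coef fd) // big1 // => j' _; rewrite coef_sum coef_sum big1 // => i' le'.
  rewrite coefCM coefXn; case: eqVneq => [jj|_]; last by rewrite mulr0 coef0.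
  rewrite mulr1 coefZ coefXn; case: eqVneq => [ii|_]; last by rewrite mulr0.
  by move: lt_d; rewrite ii jj ltnNge le'.
have lt_j : (j < d.+1)%N by lia.
have lt_i : (i < d.+1)%N by lia.
rewrite (bigD1 (Ordinal lt_j)) //= [X in _ = _ + X]big1 ?addr0; last first.
  move=> j' jj'; rewrite !coef_sum big1 // => i' _.
  by rewrite coefCM coefXn -[j == j']/(j == val j') eq_sym (inj_eq val_inj j' (Ordinal lt_j)) (negbTE jj') mulr0 coef0.
rewrite !coef_sum (bigD1 (Ordinal lt_i)) //= big1 ?addr0 => [|i' /andP[_ ii']].
  by rewrite coefCM coefXn eqxx mulr1 coefZ coefXn eqxx mulr1.
rewrite coefCM coefXn eqxx mulr1 coefZ coefXn.
by rewrite -[i == i']/(val (Ordinal lt_i) == val i') (inj_eq val_inj) eq_sym (negbTE ii') mulr0.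
Qed.

Lemma flip_sum (I : Type) (r : seq I) (P : pred I) (F : I -> {poly {poly R}}) d :
  flip d (\sum_(i <- r | P i) F i) = \sum_(i <- r | P i) flip d (F i).
Proof. by apply: (big_morph (flip d) (flipD d)); exact: flip0. Qed.

Lemma flipM d e f g : tdeg_le d f -> tdeg_le e g ->
  flip (d + e) (f * g) = flip d f * flip e g.
Proof.
move=> fd ge; rewrite {1}(tdeg_mono_sum fd) {1}(tdeg_mono_sum ge).
rewrite [in RHS](tdeg_mono_sum fd) [in RHS](tdeg_mono_sum ge).
rewrite !flip_sum !mulr_suml flip_sum; apply: eq_bigr => j _.
rewrite !flip_sum !mulr_suml flip_sum; apply: eq_bigr => i le_ij.
rewrite !mulr_sumr flip_sum; apply: eq_bigr => j' _.
rewrite !flip_sum !mulr_sumr flip_sum; apply: eq_bigr => i' le_ij'.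
have mono (a b : R) i1 j1 i2 j2 :
    (a *: 'X^i1)%:P * 'X^j1 * ((b *: 'X^i2)%:P * 'X^j2) =
    ((a * b) *: 'X^(i1 + i2))%:P * 'X^(j1 + j2) :> {poly {poly R}}.
  by rewrite -!mul_polyC !polyCM !polyC_exp !exprD; ring.
rewrite mono flip_mono; last by lia.
rewrite !flip_mono // mono; congr ((_ *: 'X^_)%:P * _); lia.
Qed.

Lemma flipX d f n : tdeg_le d f -> flip (n * d) (f ^+ n) = flip d f ^+ n.
Proof.
move=> fd; elim: n => [|n IH]; first by rewrite mul0n !expr0 flip1.
by rewrite !exprS mulSn flipM ?IH //; apply: tdeg_leX.
Qed.

Lemma flip_deriv d f : flip d f^`() = (flip d.+1 f)^`().
Proof.
apply: poly2P => i j; rewrite coef_deriv coefMn !coef_flip coef_deriv coefMn.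
rewrite addnS ltnS; case: ifP => _; last by rewrite mul0rn.
by congr (f`_ _`_(_) *+ _); lia.
Qed.

(* Euler's relation: w d/dw of the other dehomogenization. *)
Lemma flip_euler d f : tdeg_le d f ->
  'X%:P * dX (flip d f) = flip d (f *+ d - 'X%:P * dX f - 'X * f^`()).
Proof.
move=> fd; apply: poly2P => i j.
rewrite coefCM coefXM coef_dX coef_deriv !coef_flip !coefB !coefMn coefCM coefXM.
rewrite coef_dX coef_deriv coefXM coef_deriv.
case: i => [|i] /=.
  rewrite add0n subn0; case: ifP => // le_j.
  case: j le_j => [|j] le_j /=.
    rewrite subn0 coef0 subr0; case: d fd le_j => [|d] fd le_j /=; first by rewrite mulr0n subrr.
    by rewrite subrr.
  rewrite coefMn; case E: (d - j.+1)%N => [|l] /=.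
    by rewrite subr0 (_ : d = j.+1); [rewrite subrr|lia].
  rewrite (_ : d = (l.+1 + j.+1)%N); last by lia.
  by rewrite mulrnDr [X in X - _ - _]addrC addrK subrr.
rewrite addSn; case: ifP => [le_d|]; last by rewrite mul0rn.
have -> : (d - j - i.+1 = d - j - i - 1)%N by lia.
case: j le_d => [|j] le_d /=.
  rewrite coef0 subr0 subn0; case E: (d - i - 1)%N => [|l] /=.
    by rewrite subr0; congr (_ *+ _); lia.
  rewrite (_ : d = (i.+1 + l.+1)%N) ?mulrnDr ?addrK //; lia.
rewrite coefMn; case E: (d - j.+1 - i - 1)%N => [|l] /=.
  by rewrite subr0 (_ : d = (i.+1 + j.+1)%N) ?mulrnDr ?addrK //; lia.
rewrite (_ : d = (i.+1 + l.+1 + j.+1)%N) ?mulrnDr; last by lia.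
by rewrite (addrAC (_ *+ i.+1)) !addrK.
Qed.

Lemma flip_divX d f : tdeg_le d.+1 f -> 
  (exists g, flip d.+1 f = 'X%:P * g) -> tdeg_le d f.
Proof.
move=> fd [g gE]; apply: tdeg_leE => i j; rewrite leq_eqVlt => /predU1P[dE|]; last first.
  by move=> lt_d; apply: (tdeg_le_coef fd).
have /(congr1 (fun p : {poly {poly R}} => p`_j`_0)) := gE.
rewrite coefCM coefXM /= coef_flip ifT; last by lia.
by rewrite (_ : (d.+1 - j - 0)%N = i) //; lia.
Qed.

End Flip.

Lemma in_qpolyB (R : comNzRingType) (q f g : {poly R}) :
  in_qpoly q (f - g) = in_qpoly q f - in_qpoly q g.
Proof. exact: rmorphB. Qed.

Lemma in_qpoly_sub_eq0 (R : comNzRingType) (q f g : {poly R}) :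
  in_qpoly q (f - g) = 0 <-> in_qpoly q f = in_qpoly q g.
Proof.
rewrite in_qpolyB; split=> [/eqP|->]; last by rewrite subrr.
by rewrite subr_eq0 => /eqP.
Qed.

Section TwoCharts.

Variables (k : closedFieldType) (q : {poly {poly k}}) (N : nat).
Hypotheses (N_gt0 : (0 < N)%N).
Implicit Types (f g h r : {poly {poly k}}).

Definition chart (c : bool) (d : nat) (f : {poly {poly k}}) :=
  if c then flip d f else f.

Lemma chartM c d e f g : tdeg_le d f -> tdeg_le e g ->
  chart c (d + e) (f * g) = chart c d f * chart c e g.
Proof. by case: c => // fd ge; apply: flipM. Qed.

Lemma chartD c d f g : chart c d (f + g) = chart c d f + chart c d g.
Proof. by case: c => //=; rewrite flipD. Qed.

Lemma chart_tdeg c d f : tdeg_le d f -> tdeg_le d (chart c d f).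
Proof. by case: c => // _; apply: tdeg_le_flip. Qed.

(** The coefficient of y^N is 1, so (0 : 1 : 0) is not on the curve and the charts z = 1 and x = 1
    cover it. *)
Record plane_curve : Prop := PlaneCurve {
  curve_monic : q \is monic;
  curve_size : size q = N.+1;
  curve_tdeg : tdeg_le N q }.

Hypothesis qC : plane_curve.
Notation qc c := (chart c N q).

Lemma chart_lead c : (qc c)`_N = 1.
Proof.
have qN : q`_N = 1 by rewrite -(monicP (curve_monic qC)) /lead_coef (curve_size qC).
case: c => //=; apply/polyP => i; rewrite coef_flip subnn sub0n qN !coefC.
case: i => [|i]; first by rewrite add0n leqnn.
by rewrite (_ : (i.+1 + N <= N)%N = false) //; lia.
Qed.

Lemma chart_size c : size (qc c) = N.+1.
Proof.
apply/eqP; rewrite eqn_leq tdeg_le_size /=; last exact: chart_tdeg (curve_tdeg qC).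
rewrite ltnNge; apply/negP => /leq_sizeP/(_ N (leqnn _)) qN.
by have := chart_lead c; rewrite qN => /esym/eqP; rewrite oner_eq0.
Qed.

Lemma chart_monic c : qc c \is monic.
Proof. by apply/monicP; rewrite /lead_coef chart_size chart_lead. Qed.

Lemma chart_gt1 c : (1 < size (qc c))%N. Proof. by rewrite chart_size ltnS. Qed.

Lemma chart_qtdeg c : tdeg_le N (qc c).
Proof. exact: chart_tdeg (curve_tdeg qC). Qed.

(** The difference is e q with e of degree at most d - N, and this bound is what allows the change
    of chart to be applied to the product. *)
Lemma chart_cl_eq c d f g : tdeg_le d f -> tdeg_le d g ->
  in_qpoly q f = in_qpoly q g ->
  in_qpoly (qc c) (chart c d f) = in_qpoly (qc c) (chart c d g).
Proof.
case: c => //= fd gd /in_qpoly_sub_eq0 fg0.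
have [e [r [fgE sr rd ed e0]]] :=
  tdeg_le_divE (curve_monic qC) (curve_size qC) N_gt0 (curve_tdeg qC) (tdeg_leB fd gd).
have r0 : r = 0.
  have q1 : (1 < size q)%N by rewrite (curve_size qC).
  apply: (cl_inj (curve_monic qC) q1) => //; first by rewrite size_poly0 ltnW.
  rewrite in_qpoly0 -fg0 fgE in_qpolyD in_qpolyM (cl_q (curve_monic qC) q1).
  by rewrite mulr0 addr0.
apply/in_qpoly_sub_eq0; rewrite -flipB fgE r0 add0r.
have [lt_dN|le_Nd] := ltnP d N; first by rewrite e0 // mul0r flip0 in_qpoly0.
rewrite -(subnK le_Nd) flipM //; last exact: curve_tdeg qC.
by rewrite in_qpolyM (cl_q (chart_monic true) (chart_gt1 true)) mulr0.
Qed.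

Lemma chart_cl_eqV d f g : tdeg_le d f -> tdeg_le d g ->
  in_qpoly (qc true) (flip d f) = in_qpoly (qc true) (flip d g) ->
  in_qpoly q f = in_qpoly q g.
Proof.
move=> fd gd /in_qpoly_sub_eq0; rewrite -flipB => fg0.
have fgd := tdeg_leB fd gd.
have [e [r [fgE sr rd ed e0]]] :=
  tdeg_le_divE (chart_monic true) (chart_size true) N_gt0 (chart_qtdeg true) (tdeg_le_flip d (f - g)).
have r0 : r = 0.
  apply: (cl_inj (chart_monic true) (chart_gt1 true)) => //; first by rewrite size_poly0 ltnW // chart_gt1.
  rewrite in_qpoly0 -fg0 fgE in_qpolyD in_qpolyM (cl_q (chart_monic true) (chart_gt1 true)).
  by rewrite mulr0 addr0.
apply/in_qpoly_sub_eq0; rewrite -(flipK fgd) fgE r0 add0r.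
have [lt_dN|le_Nd] := ltnP d N; first by rewrite e0 // mul0r flip0 in_qpoly0.
rewrite -(subnK le_Nd) flipM //; last exact: chart_qtdeg true.
rewrite (flipK (curve_tdeg qC)) in_qpolyM (cl_q (curve_monic qC)) ?mulr0 //.
by rewrite (curve_size qC) ltnS.
Qed.

(** The equation says that w^(m - d) divides the flip in degree m, which is the vanishing of all
    terms of f of degree above d. *)
Lemma flip_coef_bound d m f h : tdeg_le m f -> (d <= m)%N ->
  'X^d%:P * flip m f = 'X^m%:P * h -> tdeg_le d f.
Proof.
move=> fm le_dm E; apply: tdeg_leE => i j lt_d.
have [le_m|lt_m] := leqP (i + j) m; last exact: (tdeg_le_coef fm).
have /(congr1 (fun p : {poly {poly k}} => p`_j`_(m - j - i + d))) := E.
rewrite !coefCM !coefXnM ltnNge leq_addl /= addnK coef_flip ifT; last by lia.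
rewrite ifT; last by lia.
by move=> fE; rewrite (_ : i = m - j - (m - j - i))%N //; lia.
Qed.

Lemma polyCXn_mulI m (f g : {poly {poly k}}) : 'X^m%:P * f = 'X^m%:P * g -> f = g.
Proof.
move/eqP; rewrite -subr_eq0 -mulrBr mulf_eq0 polyC_eq0 expf_eq0 polyX_eq0 andbF /=.
by rewrite subr_eq0 => /eqP.
Qed.

Hypothesis dom1 : qdomain (qc true).

(** The quotients in the two charts agree where both are defined, so they form a section of O(a -
    b). Comparing canonical representatives after the change of chart shows that this section comes
    from a polynomial of degree at most a - b. *)
Lemma chart_dvd a b f g : tdeg_le a f -> tdeg_le b g -> (b <= a)%N ->
    in_qpoly q g <> 0 ->
    (forall c, exists h : {poly %/ qc c}, in_qpoly (qc c) (chart c a f) = h * in_qpoly (qc c) (chart c b g)) ->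
  exists h, [/\ tdeg_le (a - b) h, (size h < size q)%N & in_qpoly q f = in_qpoly q h * in_qpoly q g].
Proof.
move=> fa gb le_ba g0 dv; have q1 : (1 < size q)%N by rewrite (curve_size qC).
have [h0 /= h0E] := dv false; have [h1 /= h1E] := dv true.
have [m hm] := tdeg_le_exists (h0 : {poly {poly k}}).
pose M := (m + a)%N; have hM : tdeg_le M h0 by apply: tdeg_leW hm; rewrite leq_addr.
have h0s : (size (h0 : {poly {poly k}}) < size q)%N by apply: size_qpoly_lt; rewrite ?(curve_monic qC).
exists h0; split; [|exact: h0s|by rewrite cl_id].
apply: (@flip_coef_bound (a - b) M h0 h1) => //; first by rewrite /M; lia.
apply: (cl_inj (chart_monic true) (chart_gt1 true)).
- rewrite chart_size ltnS; apply/leq_sizeP => j le_j; apply/polyP => i.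
  rewrite coefCM coefXnM coef0 coef_flip; case: ifP => // _; case: ifP => // _.
  have h0j : (h0 : {poly {poly k}})`_j = 0.
    by rewrite nth_default //; apply: leq_trans le_j; rewrite -ltnS -(curve_size qC).
  by rewrite h0j coef0.
- rewrite mul_polyC (leq_ltn_trans (size_scale_leq _ _)) //.
  exact: size_qpoly_lt (chart_monic true) (chart_gt1 true) h1.
apply/eqP; rewrite -subr_eq0; apply/eqP.
have gE0 : in_qpoly (qc true) (flip b g) * (in_qpoly (qc true) ('X^(a - b)%:P * flip M h0) -
    in_qpoly (qc true) ('X^M%:P * h1)) = 0.
  have hgE : in_qpoly (qc true) (flip (M + b) ((h0 : {poly {poly k}}) * g)) =
      in_qpoly (qc true) (flip (M + b) f).
    apply: (@chart_cl_eq true) => //; first exact: tdeg_leM.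
      by apply: tdeg_leW fa; rewrite /M; lia.
    by rewrite in_qpolyM h0E cl_id.
  rewrite mulrBr -[X in X - _]in_qpolyM mulrCA [flip b g * _]mulrC -flipM // in_qpolyM hgE.
  rewrite (_ : (M + b = a + (M - (a - b)))%N); last by rewrite /M; lia.
  rewrite flip_shift // in_qpolyM mulrA -[X in X * _]in_qpolyM -polyCM -exprD.
  rewrite (_ : (a - b + (M - (a - b)) = M)%N); last by rewrite /M; lia.
  rewrite h1E [in_qpoly _ ('X^M%:P * _)]in_qpolyM cl_id [h1 * _]mulrC.
  by rewrite [X in _ - X]mulrCA subrr.
have [gb0|//] := dom1 gE0; case: g0; rewrite -(in_qpoly0 q).
by apply: (chart_cl_eqV gb) => //; [exact: tdeg_le0|rewrite gb0 flip0 in_qpoly0].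
Qed.

End TwoCharts.

(** * Irreducibility of smooth plane curves *)

Section Irreducibility.

Variable k : closedFieldType.
Implicit Types (f g h : {poly {poly k}}) (c d : {poly k}).

Lemma fibre_zero f x : map_poly (horner_eval x) f = 0 ->
  exists b, f = ('X - x%:P)%:P * b.
Proof.
move=> f0; have [b fE _] := ev2_expand_x f x; exists b.
by rewrite {1}fE f0 map_poly0 add0r.
Qed.

(** Gauss's lemma: over a root of c the fiber of f or of g vanishes, so the corresponding linear
    factor can be cancelled. When c is constant only the leading coefficients have to be
    rescaled. *)
Lemma gauss_factor q : q \is monic -> forall c f g, c != 0 -> c%:P * q = f * g ->
  exists f' g', [/\ f' \is monic, g' \is monic, q = f' * g', size f' = size f & size g' = size g].
Proof.
move=> qm c; elim: {c}(size c) {-2}c (leqnn (size c)) => [|n IH] c le_c f g c0 cE.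
  by move: le_c; rewrite leqn0 size_poly_eq0 (negbTE c0).
have [c1|/closed_rootP[x /factor_theorem[d dE]]] := eqVneq (size c) 1%N.
  have [u u0 cu] := size_poly1P c (introT eqP c1).
  pose l := lead_coef f; pose l' := lead_coef g.
  have ll : l * l' = u%:P.
    by rewrite -lead_coefM -cE lead_coefM lead_coefC (monicP qm) mulr1.
  have l0 : l != 0 by apply: contraTneq u0 => l0; move: ll; rewrite l0 mul0r => /esym/eqP; rewrite polyC_eq0 negbK.
  have l'0 : l' != 0 by apply: contraTneq u0 => l0'; move: ll; rewrite l0' mulr0 => /esym/eqP; rewrite polyC_eq0 negbK.
  have uV : (u^-1)%:P * (l * l') = 1 by rewrite ll -polyCM mulVf.
  have uV0 : (u^-1)%:P != 0 :> {poly k} by rewrite polyC_eq0 invr_eq0.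
  exists (((u^-1)%:P * l')%:P * f), (((u^-1)%:P * l)%:P * g); split.
  - by apply/monicP; rewrite lead_coefM lead_coefC -mulrA [l' * _]mulrC uV.
  - by apply/monicP; rewrite lead_coefM lead_coefC -mulrA uV.
  - have -> : ((u^-1)%:P * l')%:P * f * (((u^-1)%:P * l)%:P * g) =
       ((u^-1)%:P * (l * l'))%:P * (((u^-1)%:P)%:P * (f * g)) by rewrite !polyCM; ring.
    by rewrite uV mul1r -cE cu mulrA -!polyCM mulVf // mul1r.
  - by rewrite size_Cmul // mulf_neq0.
  - by rewrite size_Cmul // mulf_neq0.
have d0 : d != 0 by apply: contraNneq c0 => d0; rewrite dE d0 mul0r.
have sd : (size d <= n)%N by move: le_c; rewrite dE size_Mmonic ?monicXsubC // size_XsubC addn2 ltnS.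
have XC0 : ('X - x%:P)%:P != 0 :> {poly {poly k}} by rewrite polyC_eq0 polyXsubC_eq0.
have : map_poly (horner_eval x) f * map_poly (horner_eval x) g = 0.
  rewrite -rmorphM -cE rmorphM /= map_polyC /= dE /horner_eval hornerM.
  by rewrite hornerXsubC subrr mulr0 mul0r.
move/eqP; rewrite mulf_eq0 => /orP[]/eqP/fibre_zero[b bE].
  have /(IH d sd)[] // : d%:P * q = b * g.
    by apply: (mulfI XC0); rewrite mulrA -polyCM [('X - _) * _]mulrC -dE cE bE mulrA.
  move=> f' [g' [? ? ? sf sg]]; exists f', g'; split=> //.
  by rewrite bE size_Cmul ?polyXsubC_eq0.
have /(IH d sd)[] // : d%:P * q = f * b.
  by apply: (mulfI XC0); rewrite mulrA -polyCM [('X - _) * _]mulrC -dE cE bE mulrCA.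
move=> f' [g' [? ? ? sf sg]]; exists f', g'; split=> //.
by rewrite bE size_Cmul ?polyXsubC_eq0.
Qed.

Lemma min_tdeg f : f != 0 ->
  exists2 m, tdeg_le m f & forall g, flip m f <> 'X%:P * g.
Proof.
move=> f0.
have exm : exists m, all (fun j => size (f`_j)%R <= m.+1 - j)%N (iota 0 (size f)).
  by have [d /tdeg_leP fd] := tdeg_le_exists f; exists d.
have [m /tdeg_leP fm m_min] := ex_minnP exm; exists m => // g gE.
case: m fm m_min gE => [|m] fm m_min gE.
  have /(congr1 (fun p : {poly {poly k}} => p`_0`_0)) := gE.
  rewrite coef_flip coefCM coefXM /= => f00.
  case/negP: f0; apply/eqP/poly2P => i j; rewrite !coef0.
  case E: (i + j)%N => [|n]; last by apply: (tdeg_le_coef fm); rewrite E.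
  by have [-> ->] : i = 0%N /\ j = 0%N by lia.
have /tdeg_leP/m_min : tdeg_le m f by apply: flip_divX => //; exists g.
by rewrite ltnn.
Qed.

(** The norm of f from k[x, y] / (g) to k[x] has no root, so it is a nonzero constant. *)
Lemma comaximal f g : g \is monic -> (1 < size g)%N ->
    (forall x y, ev2 x y f = 0 -> ev2 x y g <> 0) ->
  exists a b, 1 = a * f + b * g.
Proof.
move=> gm g1 fg; pose s : {poly %/ g} := in_qpoly g f.
have [c cs] := qnorm_mul gm g1 s.
have [n1|/closed_rootP[x /rootP nx]] := eqVneq (size (qnorm s)) 1%N; last first.
  suff : (qnorm s).[x] != 0 by rewrite nx eqxx.
  apply: qnorm_fibre => // y g0; rewrite evq_cl //; apply/negP => /eqP f0.
  exact: fg f0 g0.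
have [u u0 nu] := size_poly1P _ (introT eqP n1).
have [e eE] := val_mul_divE gm g1 c s; have [e' e'E] := cl_divE gm g1 f.
have one : polyn (c * s) = u%:P%:P.
  by rewrite cs nu poly_of_qpolyZ -[X in _ *: X = _]/(polyn 1) -(rmorph1 (in_qpoly g)) cl_small // ?size_poly1 // alg_polyC.
exists ((u^-1)%:P%:P * (c : {poly {poly k}})), ((u^-1)%:P%:P * - (e + (c : {poly {poly k}}) * e')).
have cf : (c : {poly {poly k}}) * f = u%:P%:P + (e + (c : {poly {poly k}}) * e') * g.
  by rewrite e'E mulrDr -/s eE one mulrDl; ring.
have uu : u^-1%:P%:P * u%:P%:P = 1 :> {poly {poly k}} by rewrite -!polyCM mulVf.
by rewrite -[X in X + _]mulrA cf mulrDr uu; ring.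
Qed.

End Irreducibility.

Section Domain.

Variables (k : closedFieldType) (q : {poly {poly k}}) (N : nat).
Hypotheses (N_gt0 : (0 < N)%N) (qC : plane_curve q N).
Hypothesis q_smooth : forall c, smooth (chart c N q).
Implicit Types (f g h : {poly {poly k}}).

Lemma smooth_factor c f g x y : chart c N q = f * g -> ev2 x y f = 0 -> ev2 x y g <> 0.
Proof.
move=> E f0 g0; have [||] := q_smooth (c := c) (x := x) (y := y).
- by rewrite E rmorphM /= f0 mul0r.
- have -> : dX (chart c N q) = dX f * g + f * dX g.
    rewrite E; apply/polyP => j; rewrite coef_dX coefM (raddf_sum (@deriv k)) coefD !coefM -big_split.
    by apply: eq_bigr => i _; rewrite /= derivM !coef_dX.
  by rewrite rmorphD !rmorphM /= f0 g0 mulr0 mul0r addr0 eqxx.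
by rewrite E derivM rmorphD !rmorphM /= f0 g0 mulr0 mul0r addr0 eqxx.
Qed.

(** If q = f g, smoothness keeps the curves f = 0 and g = 0 apart, so there is a regular function
    that is 0 on the first and 1 on the second. It extends over both charts, and a function regular
    everywhere has degree 0, hence is constant: a contradiction. *)
Lemma curve_irreducible f g : f \is monic -> g \is monic ->
  (1 < size f)%N -> (1 < size g)%N -> q <> f * g.
Proof.
move=> fm gm f1 g1 qE.
have f0 : f != 0 by apply: monic_neq0. have g0 : g != 0 by apply: monic_neq0.
have [m fdm fmin] := min_tdeg f0; have [n gdn gmin] := min_tdeg g0.
have sfg : (size f + size g = N.+2)%N.
  by have := size_Mmonic f0 gm; rewrite -qE (curve_size qC); move: f1 g1; lia.
have sm := tdeg_le_size fdm; have sn := tdeg_le_size gdn.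
have le_Nmn : (N <= m + n)%N.
  by move: sfg sm sn; move: (size f) (size g) => zf zg; lia.
have flipE : flip (m + n) q = flip m f * flip n g by rewrite qE flipM.
(* The minimal degrees m and n make neither flip divisible by w, whereas w would divide their
   product if m + n exceeded N. *)
have mnN : (m + n = N)%N.
  apply/eqP; rewrite eqn_leq le_Nmn andbT leqNgt; apply/negP => lt_N.
  have /(congr1 (map_poly (horner_eval 0))) := flipE.
  rewrite -(subnKC le_Nmn) flip_shift; last exact: curve_tdeg qC.
  rewrite !rmorphM /= map_polyC /= /horner_eval hornerXn expr0n.
  rewrite (_ : (m + n - N == 0)%N = false) ?polyC0 ?mul0r; last by lia.
  move/esym/eqP; rewrite mulf_eq0 => /orP[]/eqP/fibre_zero[b].
    by rewrite polyC0 subr0 => /fmin.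
  by rewrite polyC0 subr0 => /gmin.
have [fs gs] : size f = m.+1 /\ size g = n.+1.
  by move: sfg sm sn mnN; move: (size f) (size g) => zf zg; lia.
have fC : plane_curve f m by []. have gC : plane_curve g n by [].
have [m0 n0] : (0 < m)%N /\ (0 < n)%N by move: f1 g1; rewrite fs gs !ltnS.
pose f' := flip m f; pose g' := flip n g.
have q'E : chart true N q = f' * g' by rewrite -flipE mnN.
have [a [b ab]] := comaximal gm g1 (fun x y => @smooth_factor false f g x y qE).
have g'm : g' \is monic := chart_monic n0 gC true.
have g'1 : (1 < size g')%N := chart_gt1 n0 gC true.
have [a' [b' ab']] := comaximal g'm g'1 (fun x y => @smooth_factor true f' g' x y q'E).
have qm := curve_monic qC; have q1 : (1 < size q)%N by rewrite (curve_size qC).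
have q'm := chart_monic N_gt0 qC true; have q'1 := chart_gt1 N_gt0 qC true.
have [t e0E] := cl_divE qm q1 (a * f); set e0 := polyn (in_qpoly q (a * f)) in e0E.
have [t' e1E] := cl_divE q'm q'1 (a' * f'); set e1 := polyn (in_qpoly _ (a' * f')) in e1E.
pose A := a - t * g; pose B := - (b + t * f).
have eA : e0 = f * A by rewrite /A mulrBr [f * a]mulrC e0E qE; ring.
have eB : e0 = 1 + g * B by rewrite [X in X + _]ab /B e0E qE; ring.
have [dA Ad] := tdeg_le_exists A; have [dB Bd] := tdeg_le_exists B.
pose M := (m + n + dA + dB)%N.
have MA : flip M e0 = f' * flip (n + dA + dB) A.
  rewrite eA -flipM //; first by congr flip; rewrite /M; lia.
  by apply: tdeg_leW Ad; lia.
have MB : flip M e0 = 'X^M%:P + g' * flip (m + dA + dB) B.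
  rewrite eB flipD flip1 -flipM //; last by apply: tdeg_leW Bd; lia.
  by congr (_ + flip _ _); rewrite /M; lia.
have e0d : tdeg_le M e0.
  rewrite eA (_ : M = (m + (n + dA + dB))%N); last by rewrite /M; lia.
  by apply: tdeg_leM => //; apply: tdeg_leW Ad; lia.
have s0 : (size e0 < size q)%N by exact: size_qpoly_lt qm q1 _.
have s1 : (size e1 < size (chart true N q))%N by exact: size_qpoly_lt q'm q'1 _.
(* In their charts [e0] and [e1] are both 0 on the first factor and 1 on the second. The difference
   is therefore divisible by f' and by g', hence by their product because these are comaximal. *)
have ME : flip M e0 = 'X^M%:P * e1.
  apply: (cl_inj q'm q'1).
  - rewrite chart_size // ltnS; apply/leq_sizeP => j le_j; apply/polyP => i.
    rewrite coef0 coef_flip; case: ifP => // _.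
    have -> : e0`_j = 0.
      by rewrite nth_default //; apply: leq_trans le_j; rewrite -ltnS -(curve_size qC).
    by rewrite coef0.
  - by rewrite mul_polyC (leq_ltn_trans (size_scale_leq _ _)).
  apply/in_qpoly_sub_eq0/(cl_eq0 q'm q'1).
  pose U := flip (n + dA + dB) A - 'X^M%:P * (a' - t' * g').
  pose V := flip (m + dA + dB) B + 'X^M%:P * (b' + t' * f').
  have ZU : flip M e0 - 'X^M%:P * e1 = f' * U.
    have -> : e1 = a' * f' - t' * (f' * g') by rewrite {1}e1E q'E addrK.
    by rewrite MA /U; ring.
  have ZV : flip M e0 - 'X^M%:P * e1 = g' * V.
    have -> : e1 = a' * f' - t' * (f' * g') by rewrite {1}e1E q'E addrK.
    have -> : a' * f' = 1 - b' * g' by rewrite [X in X - _]ab' addrK.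
    by rewrite MB /V; ring.
  exists (a' * V + b' * U).
  have {1}-> : flip M e0 - 'X^M%:P * e1 = (a' * f' + b' * g') * (flip M e0 - 'X^M%:P * e1).
    by rewrite -ab' mul1r.
  by rewrite mulrDl {1}ZV ZU q'E; ring.
have e00 : tdeg_le 0 e0.
  apply: (@flip_coef_bound k N N_gt0 0 M e0 e1 e0d (leq0n _)).
  by rewrite -[RHS]ME -[RHS]mul1r; congr (_ * _).
have e0s : (size e0 <= 1)%N := tdeg_le_size e00.
have mono_small (u v : {poly {poly k}}) : u \is monic -> (1 < size u)%N -> (size (u * v)%R <= 1)%N -> v = 0.
  move=> um u1 suv; apply/eqP; apply/negPn/negP => v0; move: suv.
  by rewrite size_monicM // leqNgt; move: u1; rewrite -size_poly_gt0 in v0; lia.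
have A0 : A = 0 by apply: (mono_small f) => //; rewrite -eA.
have gB : g * B = - 1 by apply/eqP; rewrite -addr_eq0 addrC -eB eA A0 mulr0.
have B0 : B = 0 by apply: (mono_small g) => //; rewrite gB size_polyN size_poly1.
by move/eqP: gB; rewrite B0 mulr0 eq_sym oppr_eq0 oner_eq0.
Qed.

(** A zero divisor has a nontrivial gcd with q over k(x), which Gauss's lemma turns into a monic
    factorization of q. *)
Lemma curve_domain : qdomain q.
Proof.
have qm := curve_monic qC; have q1 : (1 < size q)%N by rewrite (curve_size qC).
move=> a b ab0; have [->|a0] := eqVneq a 0; first by left.
right; apply/eqP; apply/negPn/negP => b0.
have val_neq0 (s : {poly %/ q}) : s != 0 -> (s : {poly {poly k}}) != 0.
  by apply: contraNneq => s0; apply/eqP/val_inj.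
have [e eE] := val_mul_divE qm q1 a b.
have q_ab : q %| (a : {poly {poly k}}) * (b : {poly {poly k}}).
  by rewrite eE ab0 add0r dvdp_mull.
pose G := gcdp q a.
have G1 : size G != 1%N.
  apply/negP => cop; move: q_ab; rewrite Gauss_dvdpr; last by rewrite /coprimep.
  move/(dvdp_leq (val_neq0 _ b0)); rewrite leqNgt.
  by rewrite (size_qpoly_lt qm q1).
have G0 : G != 0 by rewrite gcdp_eq0 negb_and monic_neq0.
have Gs : (size G < size q)%N.
  apply: leq_ltn_trans (size_qpoly_lt qm q1 a).
  exact: dvdp_leq (val_neq0 _ a0) (dvdp_gcdr _ _).
have Gq : G %| q by rewrite dvdp_gcdl.
clearbody G; have /Pdiv.Idomain.dvdpP[[c h] c0' cE'] := Gq.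
have {c0'}c0 : c != 0 by [].
have {cE'}cE : c%:P * q = h * G by rewrite mul_polyC.
have h0 : h != 0.
  apply/negP => /eqP h0; move/eqP: cE.
  by rewrite h0 mul0r mulf_eq0 polyC_eq0 (negbTE c0) (negbTE (monic_neq0 qm)).
have [f [g [fm gm qE sf sg]]] := gauss_factor qm c0 cE.
have sh : (size q = (size h + size G).-1)%N by rewrite -size_mul // -cE size_Cmul.
have G1' : (1 < size G)%N by rewrite ltn_neqAle eq_sym G1 size_poly_gt0.
apply: (curve_irreducible fm gm) qE; rewrite ?sf ?sg //.
by move: Gs G1'; rewrite sh; move: (size G) (size h) => u v; lia.
Qed.

End Domain.

Section DomainCharts.

Variables (k : closedFieldType) (q : {poly {poly k}}) (N : nat).
Hypotheses (N_gt0 : (0 < N)%N) (qC : plane_curve q N).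
Hypothesis q_smooth : forall c, smooth (chart c N q).

Lemma chart_curve c : plane_curve (chart c N q) N.
Proof. by split; [exact: chart_monic|exact: chart_size|exact: chart_qtdeg]. Qed.

Lemma chart_domain c : qdomain (chart c N q).
Proof.
apply: (curve_domain N_gt0 (chart_curve c)) => c'.
case: c => /=; last exact: (@q_smooth c').
case: c' => /=; last exact: (@q_smooth true).
by rewrite flipK; [exact: (@q_smooth false)|exact: curve_tdeg qC].
Qed.

End DomainCharts.

(** * Derivations and the Cartier operator in characteristic 3 *)

Lemma clC_alg (R : comNzRingType) (q : {poly R}) (c : R) : in_qpoly q c%:P = c *: 1.
Proof. by rewrite -(rmorph1 (in_qpoly q)) -linearZ -mul_polyC mulr1. Qed.

(** The norm of b turns divisibility by b into divisibility of coordinates by a polynomial over the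
    small field, and that does not depend on the field. *)
Lemma qdescend (F K : fieldType) (phi : {rmorphism F -> K}) (q : {poly {poly F}})
    (a b : {poly %/ q}) (h : {poly %/ (map_poly (map_poly phi) q)}) :
    q \is monic -> (1 < size q)%N -> qnorm b != 0 ->
  qmap (map_poly phi) a = h * qmap (map_poly phi) b ->
  exists h0, h = qmap (map_poly phi) h0.
Proof.
move=> qm q1 nb0 aE; set q' := map_poly _ q in h aE *.
have [c cE] := qnorm_mul qm q1 b; set n : {poly F} := qnorm b in nb0 cE *.
have q'm : q' \is monic by exact: map_monic_id.
have q'1 : (1 < size q')%N by rewrite size_map_monic.
have caE : qmap (map_poly phi) (c * a) = (map_poly phi n) *: h.
  rewrite qmapM // aE mulrCA -qmapM // cE.
  rewrite -clC_alg qmap_cl // map_polyC clC_alg.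
  by rewrite -scalerAr mulr1.
have coefE j : map_poly phi ((c * a : {poly %/ q}) : {poly {poly F}})`_j = map_poly phi n * (h : {poly {poly K}})`_j.
  have /(congr1 (fun p : {poly %/ q'} => (polyn p)`_j)) := caE.
  by rewrite val_qmap // coef_map poly_of_qpolyZ coefZ.
exists (in_qpoly q (\poly_(j < (size q).-1) (((c * a : {poly %/ q}) : {poly {poly F}})`_j %/ n))).
set h0 := in_qpoly _ _; suff : polyn h = qmap (map_poly phi) h0 by apply: val_inj.
rewrite (val_qmap _ qm q1) cl_small //; last first.
  by rewrite (leq_ltn_trans (size_poly _ _)) // ltn_predL ltnW.
apply/polyP => j; rewrite coef_map coef_poly; case: ltnP => [lt_j|le_j]; last first.
  rewrite /= raddf0 nth_default //; apply: leq_trans le_j.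
  by rewrite -ltnS prednK ?(ltnW q1) // -(size_map_monic (map_poly phi) qm) size_qpoly_lt.
have n0' : map_poly phi n != 0 by rewrite map_poly_eq0.
have dn : n %| ((c * a : {poly %/ q}) : {poly {poly F}})`_j.
  by rewrite -(dvdp_map phi) coefE dvdp_mulIl.
by apply: (mulfI n0'); rewrite -coefE -{1}(divpK dn) rmorphM mulrC.
Qed.

Lemma qmap_inj (F K : fieldType) (phi : {rmorphism F -> K}) (q : {poly {poly F}}) :
  q \is monic -> (1 < size q)%N -> injective (@qmap _ _ (map_poly phi) q).
Proof.
move=> qm q1 a b /(congr1 (fun p : {poly %/ _} => polyn p)); rewrite !val_qmap // => ab.
apply/val_inj; apply: (map_inj_poly _ _ ab); [exact: map_poly_inj|exact: rmorph0].
Qed.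

Section PartialDerivatives.

Variable R : comNzRingType.
Implicit Types f g : {poly {poly R}}.

Lemma dXD f g : dX (f + g) = dX f + dX g.
Proof. by apply: poly2P => i j; rewrite !(coef_dX, coefD) derivD coefD. Qed.

Lemma dXN f : dX (- f) = - dX f.
Proof. by apply: poly2P => i j; rewrite !(coef_dX, coefN) derivN coefN. Qed.

Lemma dXC (c : {poly R}) : dX c%:P = c^`()%:P.
Proof. by apply: poly2P => i j; rewrite coef_dX !coefC; case: eqP; rewrite ?linear0. Qed.

Lemma dXM f g : dX (f * g) = dX f * g + f * dX g.
Proof.
apply/polyP => j; rewrite coef_dX coefM (raddf_sum (@deriv R)) coefD !coefM -big_split.
by apply: eq_bigr => i _; rewrite /= derivM !coef_dX.
Qed.

Lemma dX_deriv f : dX f^`() = (dX f)^`().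
Proof. by apply/polyP => j; rewrite !(coef_dX, coef_deriv) derivMn. Qed.

Lemma dX0 : dX 0 = 0 :> {poly {poly R}}.
Proof. by rewrite /dX map_poly0. Qed.

Lemma tdeg_le_dX d f : tdeg_le d f -> tdeg_le d.-1 (dX f).
Proof.
move=> fd; apply: tdeg_leE => i j lt_d.
by rewrite coef_dX coef_deriv (tdeg_le_coef fd) ?mul0rn //; lia.
Qed.

Lemma tdeg_le_deriv d f : tdeg_le d f -> tdeg_le d.-1 f^`().
Proof.
move=> fd; apply: tdeg_leE => i j lt_d.
by rewrite coef_deriv coefMn (tdeg_le_coef fd) ?mul0rn //; lia.
Qed.

(** In characteristic 3 this keeps the monomials with both exponents equal to 2 modulo 3, divided by
    x^2 y^2, and kills the others. *)
Definition nabla f : {poly {poly R}} := dX (dX f^`()^`()).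

Variable q : {poly {poly R}}.

(* The derivation q_y d/dx - q_x d/dy, which preserves the ideal (q). *)
Definition tau f : {poly {poly R}} := q^`() * dX f - dX q * f^`().

Lemma tauD f g : tau (f + g) = tau f + tau g.
Proof. by rewrite /tau dXD derivD; ring. Qed.

Lemma tauM f g : tau (f * g) = tau f * g + f * tau g.
Proof. by rewrite /tau dXM derivM; ring. Qed.

Lemma tau_q : tau q = 0.
Proof. by rewrite /tau mulrC subrr. Qed.

Lemma tdeg_le_tau N d f : tdeg_le N.+1 q -> tdeg_le d.+1 f -> tdeg_le (d + N) (tau f).
Proof.
move=> qN fd; rewrite addnC; apply: tdeg_leB; apply: tdeg_leM.
- exact: tdeg_le_deriv qN.
- exact: tdeg_le_dX fd.
- exact: tdeg_le_dX qN.
- exact: tdeg_le_deriv fd.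
Qed.

Hypothesis char3 : 3%:R = 0 :> R.

Lemma char3_poly : 3%:R = 0 :> {poly R}.
Proof. by rewrite -polyC_natr char3. Qed.

Lemma char3_poly2 : 3%:R = 0 :> {poly {poly R}}.
Proof. by rewrite -polyC_natr char3_poly. Qed.

Lemma deriv3_char3 (S : comNzRingType) (p : {poly S}) : 3%:R = 0 :> S -> p^`()^`()^`() = 0.
Proof.
move=> S3; apply/polyP => i; rewrite !coef_deriv coef0 -!mulrnA.
have /dvdnP[m ->] : (3 %| i.+3 * (i.+2 * i.+1))%N.
  have [m [iE|[iE|iE]]] : exists m, i = (m * 3)%N \/ i = (m * 3 + 1)%N \/ i = (m * 3 + 2)%N.
    by exists (i %/ 3)%N; lia.
  - by apply: dvdn_mulr; apply/dvdnP; exists m.+1; lia.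
  - by apply: dvdn_mull; apply: dvdn_mulr; apply/dvdnP; exists m.+1; lia.
  - by apply: dvdn_mull; apply: dvdn_mull; apply/dvdnP; exists m.+1; lia.
by rewrite mulrnA -[_ *+ 3]mulr_natr S3 mulr0.
Qed.

(* With D = d/dx on the function field, this says e^3 nabla(q^2 f) = - e^3 D^2(f e^2),
   the Cartier operator in the form of Stoehr and Voloch. *)
Lemma nabla_identity f :
  exists w, q^`() ^+ 3 * nabla (q * q * f) +
    (q^`() * tau (tau (f * q^`() ^+ 2)) - tau q^`() * tau (f * q^`() ^+ 2)) = w * q.
Proof.
have qyyy : q^`()^`()^`() = 0 by apply: deriv3_char3 char3_poly.
have qxxx : dX (dX (dX q)) = 0.
  by apply/polyP => j; rewrite !coef_dX deriv3_char3 // coef0.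
(* Once the pure third derivatives of q have been removed, the left side is an explicit multiple of
   3 plus an explicit multiple of q; [ring] checks the two cofactors supplied below. *)
have fE : forall E L W : {poly {poly R}}, L = 3%:R * E + W * q -> exists w, L = w * q.
  by move=> E L W ->; exists W; rewrite char3_poly2 mul0r add0r.
rewrite /nabla /tau !(derivM, dXM, derivD, dXD, derivN, dXN, dX_deriv, exprS, expr0, mulr1).
rewrite ?qyyy ?qxxx ?dX0 ?deriv0.
set qy := q^`(); set qx := dX q; set qxx := dX qx; set qxy := qx^`(); set qyy := qy^`().
set qxxy := qxx^`(); set qxyy := qxy^`(); set qxxyy := qxxy^`().
set fx := dX f; set fy := f^`(); set fxx := dX fx; set fxy := fx^`(); set fyy := fy^`().
set fxxy := fxx^`(); set fxyy := fxy^`(); set fxxyy := fxxy^`().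
rewrite /= ?(qyyy, qxxx).
apply: (fE (fyy * qy * qy * qy * qx * qx + 2%:R * fxy * qy * qy * qy * qy * qx + 2%:R * fy * qy * qy * qy * qx * qxy + fy * qy * qy * qy * qy * qxx + fxx * qy * qy * qy * qy * qy + 4%:R * fx * qy * qy * qy * qy * qxy + 2%:R * f * qy * qy * qy * qxy * qxy + 2%:R * f * qy * qy * qy * qy * qxxy + fy * qy * qy * qyy * qx * qx) _ (fxxyy * q * qy * qy * qy + 4%:R * fxyy * qy * qy * qy * qx + 2%:R * fyy * qy * qy * qy * qxx + 4%:R * fxxy * qy * qy * qy * qy + 8%:R * fxy * qy * qy * qy * qxy + 4%:R * fy * qy * qy * qy * qxxy + 2%:R * fxx * qy * qy * qy * qyy + 4%:R * fx * qy * qy * qy * qxyy + 2%:R * f * qy * qy * qy * qxxyy)).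
ring.
Qed.

End PartialDerivatives.

Section CharThree.

Variable R : comNzRingType.
Hypothesis char3 : 3%:R = 0 :> R.

Lemma cubeD (a b : R) : (a + b) ^+ 3 = a ^+ 3 + b ^+ 3.
Proof.
have -> : (a + b) ^+ 3 = a ^+ 3 + b ^+ 3 + 3%:R * (a ^+ 2 * b + a * b ^+ 2) by ring.
by rewrite char3 mul0r addr0.
Qed.

Lemma cubeB (a b : R) : (a - b) ^+ 3 = a ^+ 3 - b ^+ 3.
Proof. by rewrite cubeD; congr (_ + _); ring. Qed.

Lemma mulrn_div3 (a : R) n : (3 %| n)%N -> a *+ n = 0.
Proof. by move=> /dvdnP[m ->]; rewrite mulrnA -[_ *+ 3]mulr_natr char3 mulr0. Qed.

Lemma coef_cube (f : {poly R}) i :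
  (f ^+ 3)`_i = if (3 %| i)%N then f`_(i %/ 3) ^+ 3 else 0.
Proof.
elim/poly_ind: f i => [|f c IH] i; first by rewrite exprS mul0r !coef0 expr0n if_same.
have -> : (f * 'X + c%:P) ^+ 3 = f ^+ 3 * 'X^3 + (c ^+ 3)%:P.
  have -> : (f * 'X + c%:P) ^+ 3 = f ^+ 3 * 'X^3 + (c ^+ 3)%:P +
     3%:R * (f ^+ 2 * 'X^2 * c%:P + f * 'X * c%:P ^+ 2) by rewrite polyC_exp; ring.
  by rewrite char3_poly // mul0r addr0.
rewrite coefD coefMXn coefC coefD coefMX coefC.
case: i => [|i]; first by rewrite dvdn0 div0n eqxx !add0r.
rewrite addr0; case: ltnP => [lt_i|le_i].
  by rewrite (_ : (3 %| i.+1)%N = false) //; lia.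
have -> : i.+1 = (i - 2 + 3)%N by lia.
rewrite addnK IH dvdn_addl // divnDr // addn1 /= addr0; case: ifP => // _.
Qed.

End CharThree.

(** The Cartier operator without the cube roots of coefficients, which are trivial over F_3. *)
Definition cartier (R : nzRingType) (f : {poly {poly R}}) : {poly {poly R}} :=
  \poly_(b < size f) \poly_(a < size (f`_(3 * b + 2)%N)%R) f`_(3 * b + 2)%N`_(3 * a + 2)%N.

Lemma coef_cartier (R : nzRingType) (f : {poly {poly R}}) i j :
  (cartier f)`_j`_i = f`_(3 * j + 2)%N`_(3 * i + 2)%N.
Proof.
rewrite coef_poly; case: ltnP => [_|le_j]; last first.
  have -> : f`_(3 * j + 2)%N = 0 by rewrite nth_default //; apply: (leq_trans le_j); lia.
  by rewrite !coef0.
rewrite coef_poly; case: ltnP => // le_i; rewrite [RHS]nth_default //.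
by apply: (leq_trans le_i); lia.
Qed.

Lemma cubeF3 (c : 'F_3) : c ^+ 3 = c.
Proof. by apply/eqP; case: c => [[|[|[|m]]]] // p; rewrite -val_eqE. Qed.

Lemma char3F : 3%:R = 0 :> 'F_3. Proof. exact/eqP. Qed.

Lemma nabla_cartier (f : {poly {poly 'F_3}}) : nabla f = cartier f ^+ 3.
Proof.
apply: poly2P => i j; rewrite /nabla !(coef_dX, coef_deriv).
rewrite coef_cube ?char3_poly ?char3F //.
have dvd3 (a : 'F_3) n : a *+ n.+2 *+ n.+1 = if (3 %| n)%N then a *+ 2 else 0.
  have [m [->|[->|->]]] : exists m, n = (m * 3)%N \/ n = (m * 3 + 1)%N \/ n = (m * 3 + 2)%N.
    by exists (n %/ 3)%N; lia.
  - have E b l : b *+ (m * 3 + l) = b *+ l :> 'F_3.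
      by rewrite mulrnDr mulrn_div3 ?char3F ?add0r ?dvdn_mull.
    by rewrite dvdn_mull // -[(m * 3).+2]addn2 -[(m * 3).+1]addn1 !E.
  - rewrite -mulrnA mulrn_div3 ?char3F ?dvdn_mulr //; last by apply/dvdnP; exists m.+1; lia.
    by rewrite ifF //; lia.
  - rewrite -mulrnA mulrn_div3 ?char3F ?dvdn_mull //; last by apply/dvdnP; exists m.+1; lia.
    by rewrite ifF //; lia.
rewrite !coefMn !dvd3; have [j3|j3] := boolP (3 %| j)%N; last by rewrite mul0rn if_same coef0.
rewrite coef_cube ?char3F //; case: ifP => // i3.
rewrite coef_cartier cubeF3 -mulrnA (mulrnDr _ 3 1) (mulrn_div3 char3F) // add0r.
by rewrite mulr1n; move: i3 j3 => /dvdnP[i' ->] /dvdnP[j' ->]; rewrite !mulnK // ![(3 * _)%N]mulnC !addn2.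
Qed.

Definition qtau (R : comNzRingType) (q : {poly {poly R}}) (a : {poly %/ q}) :
  {poly %/ q} := in_qpoly q (tau q a).

Section QuotientDerivation.

Variables (R : comNzRingType) (q : {poly {poly R}}).
Hypotheses (q_monic : q \is monic) (q_gt1 : (1 < size q)%N).
Notation cl := (in_qpoly q).
Notation T := (@qtau R q).
Implicit Types a b : {poly %/ q}.

Lemma qtau_cl f : T (cl f) = cl (tau q f).
Proof.
have [e {2}->] := cl_divE q_monic q_gt1 f.
by rewrite tauD tauM tau_q mulr0 addr0 in_qpolyD in_qpolyM cl_q // mulr0 addr0.
Qed.

Lemma qtauD a b : T (a + b) = T a + T b.
Proof. by rewrite /qtau poly_of_qpolyD tauD in_qpolyD. Qed.

Lemma qtauM a b : T (a * b) = T a * b + a * T b.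
Proof.
rewrite -[in LHS](cl_id a) -[in LHS](cl_id b) -in_qpolyM qtau_cl tauM in_qpolyD.
by rewrite !in_qpolyM !cl_id.
Qed.

Lemma qderivation_ext (d : {poly %/ q} -> {poly %/ q}) :
    (forall a b, d (a + b) = d a + d b) -> (forall a b, d (a * b) = d a * b + a * d b) ->
    (forall c : R, d (cl c%:P%:P) = 0) ->
  forall f, d (cl f) = cl (dX f) * d (cl 'X%:P) + cl f^`() * d (cl 'X).
Proof.
move=> dD dM dC.
have dCC c : d (cl c%:P) = cl c^`()%:P * d (cl 'X%:P).
  elim/poly_ind: c => [|c a IH]; first by rewrite deriv0 dC in_qpoly0 mul0r.
  rewrite polyCD polyCM in_qpolyD in_qpolyM dD dM dC IH derivMXaddC polyCD polyCM.
  by rewrite in_qpolyD in_qpolyM; ring.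
elim/poly_ind => [|f c IH].
  by have := dC 0; rewrite !polyC0 dX0 deriv0 in_qpoly0 !mul0r addr0.
rewrite in_qpolyD in_qpolyM dD dM IH dCC dXD dXM dXC derivMXaddC.
have -> : dX 'X = 0 :> {poly {poly R}}.
  by apply: poly2P => i j; rewrite coef_dX coefX coef_deriv coefMn !coef0; case: eqP; rewrite ?coefC ?mul0rn.
rewrite mulr0 addr0 !in_qpolyD !in_qpolyM; ring.
Qed.

Hypothesis char3 : 3%:R = 0 :> R.

Lemma char3_qpoly : 3%:R = 0 :> {poly %/ q}.
Proof. by rewrite -(rmorph_nat (in_qpoly q)) char3_poly2 // rmorph0. Qed.

Lemma qtau_cube a : T (a ^+ 3) = 0.
Proof.
have -> : T (a ^+ 3) = 3%:R * (a ^+ 2 * T a) by rewrite !exprS expr0 mulr1 !qtauM; ring.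
by rewrite char3_qpoly mul0r.
Qed.

End QuotientDerivation.

Section TauDivides.

Variables (k : closedFieldType) (q : {poly {poly k}}).
Hypotheses (q_monic : q \is monic) (q_gt1 : (1 < size q)%N).
Hypotheses (A_dom : qdomain q) (q_smooth : smooth q) (char3 : 3%:R = 0 :> k).

(** Near each point X is a unit times a cube, and a derivation kills cubes in characteristic 3. The
    logarithmic derivative of X is therefore that of a unit and has no pole. *)
Lemma qtau_dvd (X : {poly %/ q}) : X != 0 ->
    (forall x y p m, ev2 x y q = 0 -> uniformizer x y p -> ordat x y p X m -> (3 %| m)%N) ->
  exists h, qtau X = h * X.
Proof.
move=> X0 ord3; apply: (local_dvd q_monic q_gt1) => x y q0.
have [p pu] := uniformizer_exists q_monic q_gt1 q0 (q_smooth q0).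
have [m Xm] := ord_exists q_monic q_gt1 A_dom q0 pu X0.
have /dvdnP[m' mE] := ord3 _ _ _ _ q0 pu Xm.
have [s [u [s0 u0 sE]]] := Xm.
exists (u * s), (qtau u * s - u * qtau s); split; first by rewrite evqM // mulf_neq0.
have := congr1 (@qtau _ q) sE; rewrite mE exprM (qtauM q_monic q_gt1 s) (qtauM q_monic q_gt1 u) qtau_cube // mulr0 addr0.
rewrite -exprM -mE => E.
have -> : u * s * qtau X = u * (qtau s * X + s * qtau X) - u * qtau s * X by ring.
have -> : u * (qtau s * X + s * qtau X) = qtau u * (u * p ^+ m) by rewrite E; ring.
by rewrite -sE; ring.
Qed.

End TauDivides.

Lemma flip1_Xx (R : comNzRingType) : flip 1 'X%:P = 1 :> {poly {poly R}}.
Proof.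
apply: poly2P => i j; rewrite coef_flip !coefC.
case: i j => [|[|i]] [|[|j]] //=; rewrite ?coefC ?coefX ?coef0 //=.
Qed.

(** Both 12 and d + 1 are multiples of 3, so the terms with the degree in Euler's relation vanish.
    The factor w on the left is what lowers the degree of the logarithmic derivative from 10 to 9 in
    [tau_quotient]. *)
Lemma flip_tau (R : comNzRingType) (q f : {poly {poly R}}) d :
    3%:R = 0 :> R -> tdeg_le 12 q -> tdeg_le d.+1 f -> (3 %| d.+1)%N ->
  'X%:P * tau (flip 12 q) (flip d.+1 f) = - flip (d + 11) (tau q f).
Proof.
move=> char3 q12 fd d3.
have euler e (g : {poly {poly R}}) : tdeg_le e g -> (3 %| e)%N ->
    'X%:P * dX (flip e g) = flip e (- ('X%:P * dX g + 'X * g^`())).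
  by move=> ge e3; rewrite flip_euler // mulrn_div3 ?char3_poly2 // sub0r opprD.
have td e (g : {poly {poly R}}) : tdeg_le e.+1 g -> tdeg_le e.+1 (- ('X%:P * dX g + 'X * g^`())).
  move=> ge; apply: tdeg_leN; apply: tdeg_leD; rewrite -add1n; apply: tdeg_leM.
  - exact: tdeg_leXx.
  - exact: tdeg_le_dX ge.
  - exact: tdeg_leXy.
  - exact: tdeg_le_deriv ge.
rewrite /tau -!flip_deriv mulrBr mulrCA euler // mulrA euler //.
rewrite -!flipM //; [|exact: td|exact: (tdeg_le_deriv fd)|exact: (tdeg_le_deriv q12)|exact: td].
have -> : (11 + d.+1 = 12 + d)%N by lia.
rewrite -flipB (_ : (12 + d = 1 + (d + 11))%N); last by lia.
rewrite -flipN -[RHS]mul1r -{1}(@flip1_Xx R) -flipM; first by congr flip; ring.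
  exact: tdeg_leXx.
by apply: tdeg_leN; apply: tdeg_le_tau fd.
Qed.

Lemma tdeg_le_map_inv (F K : fieldType) (phi : {rmorphism F -> K}) d (f : {poly {poly F}}) :
  tdeg_le d (map_poly (map_poly phi) f) -> tdeg_le d f.
Proof. by move=> fd j; have := fd j; rewrite coef_map size_map_poly. Qed.

Lemma dX_map (R S : comNzRingType) (phi : {rmorphism R -> S}) (f : {poly {poly R}}) :
  dX (map_poly (map_poly phi) f) = map_poly (map_poly phi) (dX f).
Proof. by apply/polyP => j; rewrite !(coef_dX, coef_map) /= deriv_map. Qed.

Lemma tau_map (R S : comNzRingType) (phi : {rmorphism R -> S}) (q f : {poly {poly R}}) :
  tau (map_poly (map_poly phi) q) (map_poly (map_poly phi) f) =
  map_poly (map_poly phi) (tau q f).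
Proof. by rewrite /tau !dX_map !deriv_map rmorphB !rmorphM. Qed.

Lemma qtau0 (R : comNzRingType) (q : {poly {poly R}}) : qtau (0 : {poly %/ q}) = 0.
Proof. by rewrite /qtau raddf0 /tau dX0 deriv0 !mulr0 subr0 in_qpoly0. Qed.

Lemma in_qpolyX (R : comNzRingType) (q f : {poly R}) n :
  in_qpoly q (f ^+ n) = in_qpoly q f ^+ n.
Proof. exact: (rmorphXn (in_qpoly q)). Qed.

(** * Cube roots of sections whose orders are multiples of 3 *)

Section CubeRoot.

Variables (k : closedFieldType) (phi : {rmorphism 'F_3 -> k}) (q : {poly {poly 'F_3}}).
Notation ph := (map_poly (map_poly phi)).
Notation qk := (ph q).
Hypotheses (q_monic : q \is monic) (q_size : size q = 13) (q_tdeg : tdeg_le 12 q).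
Hypothesis q_smooth : forall c, smooth (chart c 12 qk).
Hypothesis qy_neq0 : q^`() != 0.
Hypothesis hasse_witt : forall H, tdeg_le 9 H -> cartier (q * q * H) = H -> H = 0.

Notation A := {poly %/ q}.
Notation cl := (in_qpoly q).
Notation clk c := (in_qpoly (chart c 12 qk)).
Notation em := (@qmap _ _ (map_poly phi) q).
Notation T := (@qtau _ q).

Lemma plane_curve_map : plane_curve qk 12.
Proof.
split; [exact: map_monic_id|by rewrite size_map_monic|exact: tdeg_le_map].
Qed.
Let qC := plane_curve_map.
Let q_gt1 : (1 < size q)%N. Proof. by rewrite q_size. Qed.
Let qk_monic : qk \is monic := curve_monic qC.
Let qk_gt1 : (1 < size qk)%N. Proof. by rewrite (curve_size qC). Qed.

Lemma char3k : 3%:R = 0 :> k.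
Proof. by rewrite -(rmorph_nat phi) char3F rmorph0. Qed.

Let dom c : qdomain (chart c 12 qk) := chart_domain (ltn0Sn 11) qC q_smooth (c := c).

Lemma em0 : em 0 = 0.
Proof. by rewrite -(in_qpoly0 q) qmap_cl // rmorph0 in_qpoly0. Qed.

Lemma dom3 (a b : A) : a * b = 0 -> a = 0 \/ b = 0.
Proof.
move=> ab; have := em0; rewrite -{1}ab qmapM // => /(@dom false)[] E; [left|right];
  by apply: (qmap_inj (phi := phi) q_monic q_gt1); rewrite em0.
Qed.

Lemma mul_neq0 (a b : A) : a != 0 -> b != 0 -> a * b != 0.
Proof. by move=> a0 b0; apply/negP => /eqP/dom3[] E; rewrite E eqxx in a0 b0. Qed.

Lemma mul_cancel (c a b : A) : c != 0 -> c * a = c * b -> a = b.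
Proof.
move=> c0 /eqP; rewrite -subr_eq0 -mulrBr => /eqP/dom3[E|/eqP].
  by rewrite E eqxx in c0.
by rewrite subr_eq0 => /eqP.
Qed.

Lemma exp_neq0 (a : A) n : a != 0 -> a ^+ n != 0.
Proof.
move=> a0; elim: n => [|n IH]; first by rewrite expr0 oner_neq0.
by rewrite exprS mul_neq0.
Qed.

Lemma qnorm_neq0 (a : A) : a != 0 -> qnorm a != 0.
Proof.
move=> a0; apply/negP => /eqP/(qnorm_eq0 q_monic q_gt1)[b b0 /dom3[] E];
  by rewrite E eqxx in a0 b0.
Qed.

Lemma cube_inj (a b : A) : a ^+ 3 = b ^+ 3 -> a = b.
Proof.
move=> /eqP; rewrite -subr_eq0 -cubeB ?char3_qpoly ?char3F // => /eqP ab.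
apply/eqP; rewrite -subr_eq0; apply: contraTT (oner_neq0 A) => /(exp_neq0 3).
by rewrite ab eqxx.
Qed.

Lemma qdvd_descend (a b : A) h : b != 0 -> em a = h * em b ->
  exists2 h0, h = em h0 & a = h0 * b.
Proof.
move=> b0 E; have [h0 h0E] := qdescend q_monic q_gt1 (qnorm_neq0 b0) E.
exists h0 => //; apply: (qmap_inj (phi := phi) q_monic q_gt1).
by rewrite qmapM // E h0E.
Qed.

Lemma em_cl f : em (cl f) = in_qpoly qk (ph f).
Proof. exact: qmap_cl. Qed.

Lemma em_neq0 a : a != 0 -> em a != 0.
Proof.
apply: contraNneq => E; apply/eqP/(qmap_inj (phi := phi) q_monic q_gt1).
by rewrite E em0.
Qed.

Definition orders_dvd (r d : nat) (X : {poly {poly k}}) :=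
  forall c x y p m, ev2 x y (chart c 12 qk) = 0 -> uniformizer x y p ->
    ordat x y p (clk c (chart c d X)) m -> (r %| m)%N.

Let e : A := cl q^`().

Lemma e_neq0 : e != 0.
Proof.
apply: contraNneq qy_neq0 => e0.
have := cl_small q_monic q_gt1 (f := q^`()); rewrite -/e e0 => <- //.
exact: lt_size_deriv (monic_neq0 q_monic).
Qed.

Lemma clk_chart_neq0 d (X : {poly {poly k}}) c : tdeg_le d X ->
  in_qpoly qk X <> 0 -> clk c (chart c d X) != 0.
Proof.
move=> Xd X0; case: c => /=; last exact/eqP.
apply/eqP => E; apply: X0; rewrite -(in_qpoly0 qk).
apply: (chart_cl_eqV (ltn0Sn 11) qC Xd) => //; first exact: tdeg_le0.
by rewrite E flip0 in_qpoly0.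
Qed.

Section Root.

Variables (d : nat) (X : A).
Hypotheses (d_gt0 : (0 < d)%N) (X0 : X != 0) (Xd : tdeg_le (3 * d) (X : {poly {poly 'F_3}})).
Hypothesis X3 : orders_dvd 3 (3 * d) (ph (X : {poly {poly 'F_3}})).

Let Xk := ph (X : {poly {poly 'F_3}}).
Let Xkd : tdeg_le (3 * d) Xk. Proof. exact: tdeg_le_map. Qed.
Let clXk : in_qpoly qk Xk = em X. Proof. by []. Qed.
Let clXk0 : in_qpoly qk Xk <> 0. Proof. by apply/eqP; exact: em_neq0. Qed.

(** The differential dX / X is regular everywhere, and the regular differentials on a smooth plane
    curve of degree 12 are H dx / q_y with H of degree at most 9. *)
Lemma tau_quotient : exists2 H : A, tdeg_le 9 (H : {poly {poly 'F_3}}) & T X = H * X.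
Proof.
have dE : exists d', (3 * d = d'.+1)%N by exists (3 * d).-1; lia.
have [d' d'E] := dE.
have [h0 h0E] : exists h, qtau (in_qpoly qk Xk) = h * in_qpoly qk Xk.
  apply: qtau_dvd => //; [exact: (@dom false)|exact: (@q_smooth false)|exact: char3k|exact/eqP|].
  by move=> x y p m; apply: (@X3 false).
have [h1 h1E] : exists h, qtau (clk true (flip (3 * d) Xk)) = h * clk true (flip (3 * d) Xk).
  apply: (qtau_dvd (chart_monic (ltn0Sn 11) qC true) (chart_gt1 (ltn0Sn 11) qC true)
    (@dom true) (@q_smooth true) char3k (clk_chart_neq0 true Xkd clXk0)).
  by move=> x y p m; apply: (@X3 true).
rewrite qtau_cl // in h0E.
rewrite (qtau_cl (chart_monic (ltn0Sn 11) qC true) (chart_gt1 (ltn0Sn 11) qC true)) in h1E.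
have tXd : tdeg_le (3 * d + 10) (tau qk Xk).
  rewrite d'E addSnnS; apply: tdeg_le_tau; last by rewrite -d'E.
  exact: curve_tdeg qC.
have flipE : flip (3 * d + 10) (tau qk Xk) = - ('X%:P * tau (flip 12 qk) (flip (3 * d) Xk)).
  rewrite d'E flip_tau ?opprK; [by congr flip; lia|exact: char3k|exact: curve_tdeg qC|by rewrite -d'E|].
  by rewrite -d'E dvdn_mulr.
have flipcl : clk true (flip (3 * d + 10) (tau qk Xk)) =
    - (clk true 'X%:P * h1) * clk true (flip (3 * d) Xk).
  rewrite flipE -sub0r in_qpolyB in_qpoly0 sub0r in_qpolyM.
  by rewrite (h1E : clk true (tau (flip 12 qk) (flip (3 * d) Xk)) = _); ring.
have [|h [hd hs hE]] := chart_dvd (ltn0Sn 11) qC (@dom true) tXd Xkd (leq_addr _ _) clXk0.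
  case=> /=; last by exists h0.
  by exists (- (clk true 'X%:P * h1)).
rewrite addKn in hd.
have h10E : flip 10 h = 'X%:P * - (h1 : {poly {poly k}}).
  apply: (cl_inj (chart_monic (ltn0Sn 11) qC true) (chart_gt1 (ltn0Sn 11) qC true)).
  - rewrite chart_size //; apply: leq_ltn_trans (_ : 11 < 13)%N => //.
    by apply: tdeg_le_size; apply: tdeg_le_flip.
  - rewrite mul_polyC (leq_ltn_trans (size_scale_leq _ _)) // size_polyN.
    exact: (size_qpoly_lt (chart_monic (ltn0Sn 11) qC true) (chart_gt1 (ltn0Sn 11) qC true) h1).
  have X1 := clk_chart_neq0 true Xkd clXk0.
  apply: (qdom_mulfI (@dom true) X1); rewrite -in_qpolyM -flipM //.
  transitivity (clk true (flip (3 * d + 10) (tau qk Xk))).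
    apply: (@chart_cl_eq _ _ _ (ltn0Sn 11) qC true); [exact: tdeg_leM|by []|].
    by rewrite in_qpolyM hE mulrC.
  by rewrite flipcl mulrN -[- ('X%:P * _)]sub0r in_qpolyB in_qpoly0 in_qpolyM cl_id; ring.
have h9 : tdeg_le 9 h by apply: flip_divX => //; exists (- (h1 : {poly {poly k}})).
have E : em (T X) = in_qpoly qk h * em X.
  rewrite em_cl -tau_map -clXk -hE; congr (in_qpoly qk _); exact: tau_map.
have [H HE TX] := qdvd_descend X0 E.
exists H => //; apply: (tdeg_le_map_inv (phi := phi)).
by rewrite -(val_qmap _ q_monic q_gt1) -HE cl_small.
Qed.

(** With T = e D, this is D^3 = 0 for D = d/dx in characteristic 3, cleared of denominators. The
    difference of the two sides is a derivation that kills x, and it kills y because it kills q. *)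
Lemma e3_tau3 (a : A) : e * T (T (T a)) = T (T e) * T a.
Proof.
have z3 := char3_qpoly q char3F.
pose D (a : A) : A := e * T (T (T a)) - T (T e) * T a.
suff -> : e * T (T (T a)) = D a + T (T e) * T a.
  suff -> : D a = 0 by rewrite add0r.
  have DD u v : D (u + v) = D u + D v by rewrite /D !qtauD; ring.
  have DM u v : D (u * v) = D u * v + u * D v.
    rewrite /D !(qtauM q_monic q_gt1, qtauD).
    rewrite -[LHS]addr0 -[X in _ + X](mul0r (- e * (T (T u) * T v + T u * T (T v)))) -z3; ring.
  have DC c : D (cl c%:P%:P) = 0.
    have TC : T (cl c%:P%:P) = 0.
      by rewrite qtau_cl // /tau dXC !derivC polyC0 !mulr0 subr0 in_qpoly0.
    by rewrite /D TC !qtau0 !mulr0 subr0.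
  have ext := qderivation_ext DD DM DC.
  have Tx : T (cl 'X%:P) = e.
    by rewrite qtau_cl // /tau dXC derivX derivC mulr0 subr0 polyC1 mulr1.
  have Dx : D (cl 'X%:P) = 0 by rewrite /D Tx mulrC subrr.
  have D0 : D 0 = 0 by have := DC 0; rewrite !polyC0 in_qpoly0.
  have /esym := ext q; rewrite cl_q // D0 Dx mulr0 add0r => /dom3[E|Dy].
    by have := e_neq0; rewrite /e E eqxx.
  by rewrite -[a]cl_id ext Dx Dy !mulr0 addr0.
by rewrite /D subrK.
Qed.

Lemma nabla_qpoly (f : {poly {poly 'F_3}}) :
  e ^+ 3 * cl (cartier (q * q * f)) ^+ 3 =
  T e * T (cl f * e ^+ 2) - e * T (T (cl f * e ^+ 2)).
Proof.
have [w /(congr1 cl)] := nabla_identity q char3F f.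
rewrite nabla_cartier [cl (w * q)]in_qpolyM cl_q // mulr0 in_qpolyD in_qpolyB.
rewrite [cl (q^`() ^+ 3 * _)]in_qpolyM !in_qpolyX [cl (q^`() * tau _ _)]in_qpolyM.
rewrite [cl (tau q q^`() * _)]in_qpolyM -!(qtau_cl q_monic q_gt1) [cl (f * _)]in_qpolyM.
rewrite in_qpolyX -/e => /eqP.
by rewrite addr_eq0 opprB => /eqP.
Qed.

(** Let h = X' / X for the derivation d/dx. Then X''' = 0 gives h'' + h^3 = 0, which says that the
    Cartier operator fixes the differential h dx = H dx / q_y. The Hasse-Witt hypothesis allows only
    H = 0. *)
Lemma tau_eq0 : T X = 0.
Proof.
have [H Hd HE] := tau_quotient; suff H0 : H = 0 by rewrite HE H0 mul0r.
have z3 := char3_qpoly q char3F.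
have eH : e * (H ^+ 3 + T (T H)) = T (T e) * H.
  apply: (mul_cancel X0); apply/eqP; rewrite -subr_eq0; apply/eqP.
  have := e3_tau3 X; rewrite !HE !(qtauM q_monic q_gt1, qtauD, HE) => E.
  have {E}E : e * (T (T H) * X + T H * (H * X) + (T H * (H * X) + H * (T H * X + H * (H * X)))) - T (T e) * (H * X) = 0.
    by rewrite -E subrr.
  rewrite -[RHS]E -[LHS]addr0 -[X in _ + X](mul0r (e * T H * H * X)) -z3; ring.
have H3 : cl (cartier (q * q * (H : {poly {poly 'F_3}}))) ^+ 3 = H ^+ 3.
  apply: (mul_cancel (exp_neq0 3 e_neq0)); rewrite nabla_qpoly cl_id.
  have eTTH : e * T (T H) = T (T e) * H - e * H ^+ 3 by rewrite -eH; ring.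
  transitivity (e ^+ 2 * (T (T e) * H - e * T (T H)) + 3%:R * (- (e ^+ 2 * T e * T H) - e ^+ 2 * T (T e) * H)).
    rewrite !exprS expr0 !mulr1 !(qtauM q_monic q_gt1, qtauD); ring.
  by rewrite z3 mul0r addr0 eTTH; ring.
have /cube_inj cH := H3.
suff H0 : polyn H = 0 by apply: val_inj.
apply: (hasse_witt Hd).
apply: (cl_inj q_monic q_gt1); last by rewrite cl_id.
  rewrite q_size; apply: (@leq_ltn_trans 10) => //; apply: tdeg_le_size.
  apply: tdeg_leE => i j lt9; rewrite coef_cartier.
  have /tdeg_le_coef-> // : tdeg_le (12 + 12 + 9) (q * q * (H : {poly {poly 'F_3}})) by do !apply: tdeg_leM.
  by lia.
exact: size_qpoly_lt.
Qed.

(** Since dX = 0, X is a cube in the function field. Its root is regular because three times its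
    orders are those of X, and the same comparison in the other chart gives a third of the
    degree. *)
Lemma cube_root : exists2 V : A, tdeg_le d (V : {poly {poly 'F_3}}) & X = V ^+ 3.
Proof.
have z3 := char3_qpoly q char3F.
pose x := cl 'X%:P.
have Tx : T x = e.
  by rewrite qtau_cl // /tau dXC derivX derivC mulr0 subr0 polyC1 mulr1.
(* The Cartier operator takes x^2 X dx to the cube root of X times dx; [f] is the numerator of x^2 X
   dx over q_y. *)
pose f := 'X%:P ^+ 2 * (X : {poly {poly 'F_3}}) * q^`().
have clf : cl f = x ^+ 2 * X * e.
  by rewrite /f [cl (_ * q^`())]in_qpolyM [cl (_ * polyn X)]in_qpolyM in_qpolyX cl_id.
pose g := cl (cartier (q * q * f)).
have gE : g ^+ 3 = e ^+ 3 * X.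
  apply: (mul_cancel (exp_neq0 3 e_neq0)); rewrite /g nabla_qpoly clf.
  have tX := tau_eq0.
  transitivity (e ^+ 3 * (e ^+ 3 * X) - 3%:R * (X * (e ^+ 6 + x ^+ 2 * e ^+ 2 * T e ^+ 2 + x ^+ 2 * e ^+ 3 * T (T e) + 4%:R * x * e ^+ 4 * T e))).
    rewrite !exprS expr0 !mulr1 !(qtauM q_monic q_gt1, qtauD) tX Tx.
    rewrite qtau0.
    ring.
  by rewrite z3 mul0r subr0.
have g0 : g != 0.
  apply: contraTneq (mul_neq0 (exp_neq0 3 e_neq0) X0) => g0.
  by rewrite -gE g0 expr0n /= negbK.
have emX (a : A) n : em (a ^+ n) = em a ^+ n.
  by elim: n => [|n IH]; rewrite ?expr0 ?exprS ?qmapM ?IH // -(rmorph1 cl) em_cl !rmorph1.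
have [h hE] : exists h, em g = h * em e.
  apply: (dvd_by_ord qk_monic qk_gt1 (@dom false) (@q_smooth false)).
  - exact: em_neq0.
  - exact: em_neq0 e_neq0.
  move=> x0 y0 p m n q0 pu gm en.
  have := ordX qk_monic qk_gt1 q0 3 gm; rewrite -emX gE qmapM // emX => om.
  have [j Xj] := ord_exists qk_monic qk_gt1 (@dom false) q0 pu (em_neq0 X0).
  have := ordM qk_monic qk_gt1 q0 (ordX qk_monic qk_gt1 q0 3 en) Xj.
  by move/(ord_uniq qk_monic qk_gt1 (@dom false) q0 pu om); lia.
have [V VE gV] := qdvd_descend e_neq0 hE.
have XV : X = V ^+ 3.
  by apply: (mul_cancel (exp_neq0 3 e_neq0)); rewrite -gE gV; ring.
exists V => //; apply: (tdeg_le_map_inv (phi := phi)).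
pose W := ph (V : {poly {poly 'F_3}}).
have [m Wm] := tdeg_le_exists W; pose M := (m + d)%N.
have WM : tdeg_le M W by apply: tdeg_leW Wm; rewrite leq_addr.
have W0 : in_qpoly qk W <> 0.
  rewrite /W -(em_cl (V : {poly {poly 'F_3}})) cl_id; apply/eqP; apply: em_neq0.
  by apply: contraNneq X0 => V0; rewrite XV V0 expr0n.
pose w := clk true 'X^(M - d)%:P.
have w0 : w != 0.
  apply/negP => /eqP E; have := clC (chart_monic (ltn0Sn 11) qC true) (chart_gt1 (ltn0Sn 11) qC true) 'X^(M - d).
    by rewrite -/w E => /esym/eqP; rewrite polyC_eq0 expf_eq0 polyX_eq0 andbF.
(* The degree bound is read at infinity: the cube of w^(M - d) divides the cube of the flipped root,
   so by orders w^(M - d) divides the flipped root. *)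
have cubeE : clk true (flip M W) ^+ 3 = w ^+ 3 * clk true (flip (3 * d) Xk).
  rewrite -!in_qpolyX -in_qpolyM -flipX // -polyC_exp -exprM.
  rewrite (_ : ((M - d) * 3 = 3 * M - 3 * d)%N); last by lia.
  rewrite -flip_shift // (subnKC (_ : 3 * d <= 3 * M)%N); last by rewrite /M; lia.
  apply: (@chart_cl_eq _ _ _ (ltn0Sn 11) qC true).
  - exact: tdeg_leX.
  - by apply: tdeg_leW Xkd; rewrite /M; lia.
  - by rewrite clXk XV emX in_qpolyX.
have q1m := chart_monic (ltn0Sn 11) qC true; have q1g := chart_gt1 (ltn0Sn 11) qC true.
have [h1 h1E] : exists h, clk true (flip M W) = h * w.
  apply: (dvd_by_ord q1m q1g (@dom true) (@q_smooth true)) => //.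
    exact: (@clk_chart_neq0 _ _ true).
  move=> x0 y0 p i j q0 pu Wi wj.
  have := ordX q1m q1g q0 3 Wi; rewrite cubeE => oi.
  have X1 := clk_chart_neq0 true Xkd clXk0.
  have [l Xl] := ord_exists q1m q1g (@dom true) q0 pu X1.
  have := ordM q1m q1g q0 (ordX q1m q1g q0 3 wj) Xl.
  by move/(ord_uniq q1m q1g (@dom true) q0 pu oi); lia.
have fE : flip M W = 'X^(M - d)%:P * (h1 : {poly {poly k}}).
  apply: (cl_inj q1m q1g).
  - rewrite chart_size // ltnS; apply/leq_sizeP => j le_j; apply/polyP => l.
    rewrite coef0 coef_flip; case: ifP => // _.
    have -> : W`_j = 0; last by rewrite coef0.
    rewrite nth_default //; apply: leq_trans (size_poly _ _) (leq_trans _ le_j).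
    by have := size_qpoly_lt q_monic q_gt1 V; rewrite q_size.
  - rewrite mul_polyC (leq_ltn_trans (size_scale_leq _ _)) //.
    exact: size_qpoly_lt q1m q1g h1.
  - by rewrite h1E in_qpolyM cl_id mulrC.
apply: (@flip_coef_bound _ 12 _ d M W (h1 : {poly {poly k}})) => //; first by rewrite /M leq_addl.
by rewrite fE mulrA -polyCM -exprD subnKC // /M leq_addl.
Qed.

End Root.

End CubeRoot.

(** * Graded pieces and orders *)

From mathcomp Require Import fingroup perm.
Section Graded.

Variables (R : comNzRingType) (q : {poly {poly R}}) (N : nat).
Hypotheses (q_monic : q \is monic) (q_size : size q = N.+1) (N_gt0 : (0 < N)%N).
Hypothesis q_tdeg : tdeg_le N q.
Implicit Types a b : {poly %/ q}.

(** The sections of O(d), as classes whose representative of degree below that of q in y has total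
    degree at most d. *)
Definition gr (d : nat) (a : {poly %/ q}) := tdeg_le d (a : {poly {poly R}}).

Lemma gr_cl d f : tdeg_le d f -> gr d (in_qpoly q f).
Proof. exact: (tdeg_le_cl q_monic q_size N_gt0 q_tdeg). Qed.

Lemma grM d e a b : gr d a -> gr e b -> gr (d + e) (a * b).
Proof.
by move=> da eb; rewrite -[a]cl_id -[b]cl_id -in_qpolyM; apply: gr_cl; apply: tdeg_leM.
Qed.

Lemma gr1 : gr 0 1.
Proof. by rewrite -(rmorph1 (in_qpoly q)); apply: gr_cl; apply: tdeg_le1. Qed.

Lemma grX d a n : gr d a -> gr (n * d) (a ^+ n).
Proof.
move=> da; elim: n => [|n IH]; first exact: gr1.
by rewrite exprS mulSn; apply: grM.
Qed.

Lemma grD d a b : gr d a -> gr d b -> gr d (a + b).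
Proof. by rewrite /gr poly_of_qpolyD; apply: tdeg_leD. Qed.

Lemma grN d a : gr d a -> gr d (- a).
Proof.
move=> da; rewrite -[a]cl_id -sub0r -(in_qpoly0 q) -in_qpolyB sub0r.
by apply: gr_cl; apply: tdeg_leN.
Qed.

Lemma gr_natl d n a : gr d a -> gr d (n%:R * a).
Proof. by move=> da; elim: n => [|n IH]; [rewrite mul0r /gr raddf0; apply: tdeg_le0|rewrite -natr1 mulrDl mul1r; apply: grD]. Qed.

Lemma gr0_const a : gr 0 a -> exists c : R, a = in_qpoly q c%:P%:P.
Proof.
move=> a0; exists (a : {poly {poly R}})`_0`_0; rewrite -[LHS]cl_id; congr in_qpoly.
apply: poly2P => i [|j]; last by rewrite coefC /= coef0 (tdeg_le_coef a0) //; lia.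
by rewrite !coefC /=; case: i => [|i] //=; rewrite (tdeg_le_coef a0).
Qed.

End Graded.

Section GradedCharts.

Variables (k : closedFieldType) (q : {poly {poly k}}) (N : nat).
Hypotheses (N_gt0 : (0 < N)%N) (qC : plane_curve q N).
Hypothesis q_smooth : forall c, smooth (chart c N q).

Notation A := {poly %/ q}.
Notation clk c := (in_qpoly (chart c N q)).
Let qm c : chart c N q \is monic := chart_monic N_gt0 qC c.
Let qg c : (1 < size (chart c N q))%N := chart_gt1 N_gt0 qC c.
Let dom c : qdomain (chart c N q) := chart_domain N_gt0 qC q_smooth (c := c).
Implicit Types a b : A.

Definition cc c d a : {poly %/ chart c N q} := clk c (chart c d (a : {poly {poly k}})).

Lemma ccM c d e a b : gr d a -> gr e b -> cc c (d + e) (a * b) = cc c d a * cc c e b.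
Proof.
move=> da eb; rewrite /cc -in_qpolyM -chartM //; apply: (chart_cl_eq N_gt0 qC).
- by apply: (grM (curve_monic qC) (curve_size qC) N_gt0 (curve_tdeg qC)).
- exact: tdeg_leM.
- by rewrite in_qpolyM !cl_id.
Qed.

Lemma cc1 c : cc c 0 1 = 1.
Proof.
rewrite /cc; have -> : polyn (1 : A) = 1.
  rewrite -(rmorph1 (in_qpoly q)) (cl_small (curve_monic qC)) //;
    by rewrite ?size_poly1 (curve_size qC).
by case: c; rewrite /= ?flip1 ?expr0 ?polyC1 rmorph1.
Qed.

Lemma ccX c d a n : gr d a -> cc c (n * d) (a ^+ n) = cc c d a ^+ n.
Proof.
move=> da; elim: n => [|n IH]; first by rewrite mul0n !expr0 cc1.
rewrite !exprS mulSn ccM ?IH //.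
exact: (grX (curve_monic qC) (curve_size qC) N_gt0 (curve_tdeg qC)).
Qed.

Lemma cc_neq0 c d a : gr d a -> a != 0 -> cc c d a != 0.
Proof.
move=> da a0; case: c; rewrite /cc /=; last by rewrite cl_id.
apply/eqP => E; case/eqP: a0; rewrite -[LHS]cl_id -(in_qpoly0 q).
apply: (chart_cl_eqV N_gt0 qC da) => //; first exact: tdeg_le0.
by rewrite E flip0 in_qpoly0.
Qed.

Lemma gdvd d e a b : gr d a -> gr e b -> (e <= d)%N -> a != 0 -> b != 0 ->
    (forall c x y p m n, ev2 x y (chart c N q) = 0 -> uniformizer x y p ->
       ordat x y p (cc c d a) m -> ordat x y p (cc c e b) n -> (n <= m)%N) ->
  exists2 h, gr (d - e) h & a = h * b.
Proof.
move=> da eb le_ed a0 b0 ord.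
have [|c|h [hd hs hE]] := chart_dvd N_gt0 qC (@dom true) da eb le_ed.
- by rewrite cl_id; apply/eqP.
- apply: (dvd_by_ord (@qm c) (@qg c) (@dom c) (@q_smooth c)); [exact: cc_neq0|exact: cc_neq0|].
  by move=> x y p m n; apply: ord.
exists (in_qpoly q h); last by move: hE; rewrite !cl_id.
by rewrite /gr (cl_small (curve_monic qC)) // (curve_size qC).
Qed.

End GradedCharts.

(** * Norms and degrees of sections *)

Section NormDegree.

Variables (k : closedFieldType) (q : {poly {poly k}}) (N : nat).
Hypotheses (N_gt0 : (0 < N)%N) (qC : plane_curve q N).
Let qm := curve_monic qC.
Let qg : (1 < size q)%N. Proof. by rewrite (curve_size qC). Qed.
Let q1m := chart_monic N_gt0 qC true.
Let q1g := chart_gt1 N_gt0 qC true.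

Lemma size_flip (R : comNzRingType) d (f : {poly {poly R}}) : (size (flip d f) <= size f)%N.
Proof.
apply/leq_sizeP => j le_j; apply/polyP => i; rewrite coef0 coef_flip.
by case: ifP => // _; rewrite (nth_default _ le_j) coef0.
Qed.

Lemma flip_prod (R : comNzRingType) (I : finType) (e : I -> nat) (F : I -> {poly {poly R}}) :
    (forall i, tdeg_le (e i) (F i)) ->
  tdeg_le (\sum_i e i) (\prod_i F i) /\
  flip (\sum_i e i) (\prod_i F i) = \prod_i flip (e i) (F i).
Proof.
move=> Fe; pose P n (f g : {poly {poly R}}) := tdeg_le n f /\ flip n f = g.
suff : P (\sum_i e i)%N (\prod_i F i) (\prod_i flip (e i) (F i)) by [].
elim: (index_enum I) => [|i r [IH1 IH2]].
  by rewrite !big_nil; split; [exact: tdeg_le1|rewrite flip1].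
by rewrite !big_cons; split; [exact: tdeg_leM|rewrite flipM // IH2].
Qed.

Lemma qnormE (R : comNzRingType) (r : {poly R}) n (a : {poly %/ r}) : size r = n.+1 ->
  qnorm a = \det (\matrix_(i < n, j < n) (a * in_qpoly r 'X^i : {poly R})`_j).
Proof.
move=> rs; have E : (size r).-1 = n by rewrite rs.
by case: n / E {rs}; congr (\det _); apply/matrixP => i j; rewrite !mxE.
Qed.

(** In the basis of powers of y the entry (i, j) of the multiplication matrix has degree d + i - j,
    so every term of the determinant has degree N d. *)
Lemma qnorm_flip d (a : {poly %/ q}) : gr d a ->
  tdeg_le (N * d) (qnorm a)%:P /\
  flip (N * d) (qnorm a)%:P = (qnorm (cc N true d a))%:P.
Proof.
move=> da; rewrite (qnormE _ (curve_size qC)) (qnormE _ (chart_size N_gt0 qC true)).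
set m := \matrix_(i, j) _; set m1 := \matrix_(i, j) _.
have Xi i : gr i (in_qpoly q 'X^i).
  apply: (gr_cl qm (curve_size qC) N_gt0 (curve_tdeg qC)).
  by rewrite -{1}[i]muln1; apply: tdeg_leX; apply: tdeg_leXy.
have flipXi i : flip i ('X^i : {poly {poly k}}) = 'X^i.
  have := @flip_mono k i 1 0 i (leqnn i).
  by rewrite subn0 subnn !scale1r !expr0 polyC1 !mul1r.
have mE i : exists2 b : {poly {poly k}}, tdeg_le (d + i) b &
    forall (i' : 'I_N) j, i' = i :> nat -> m i' j = b`_j /\ m1 i' j = (flip (d + i) b)`_j.
  have gb := grM qm (curve_size qC) N_gt0 (curve_tdeg qC) da (Xi i).
  exists (a * in_qpoly q 'X^i : {poly %/ q}) => // i' j ii'; split; first by rewrite mxE ii'.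
  rewrite mxE ii'; have -> : in_qpoly (chart true N q) 'X^i = cc N true i (in_qpoly q 'X^i).
    rewrite /cc -{1}(flipXi i) -[flip i _]/(chart true i _).
    apply: (chart_cl_eq N_gt0 qC); [|exact: (Xi i)|by rewrite cl_id].
    by rewrite -{1}[i]muln1; apply: tdeg_leX; apply: tdeg_leXy.
  rewrite -(ccM N_gt0 qC) // /cc cl_small //; apply: leq_ltn_trans (size_flip _ _) _.
  by rewrite chart_size // -(curve_size qC) size_qpoly_lt.
(* The degree d + i - j may be negative. Adding N to it makes the natural subtraction exact, at the
   price of a factor w^N per row that is cancelled at the end. *)
have wt (i j : 'I_N) : tdeg_le (d + N + i - j) (m i j)%:P /\
    flip (d + N + i - j) (m i j)%:P = 'X^N%:P * (m1 i j)%:P.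
  have [b bd /(_ i j erefl)[-> ->]] := mE i; have lt_j := ltn_ord j.
  split; first by apply: tdeg_leC; apply: leq_trans (bd j) _; lia.
  apply: poly2P => l [|j']; last first.
    have z (c : {poly k}) : (c%:P)`_j'.+1 = 0 by rewrite coefC.
    by rewrite coef_flip -polyCM !z; case: ifP => // _; rewrite !coef0.
  rewrite -polyCM coef_flip !coefC /= addn0 subn0 coefXnM coef_flip.
  case: (ltnP l N) => [lt_l|le_l].
    by case: ifP => // _; rewrite (tdeg_le_coef bd) //; lia.
  rewrite (_ : (l - N + j <= d + i)%N = (l <= d + N + i - j)%N); last by lia.
  by case: ifP => // le_d; congr (b`_ _`_ _); lia.
have sumE (s : 'S_N) : (\sum_(i < N) (d + N + i - s i) = N * d + N * N)%N.
  apply/eqP; rewrite -(eqn_add2r (\sum_(i < N) s i)) -big_split /=.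
  rewrite (eq_bigr (fun i : 'I_N => d + N + i)%N); last first.
    by move=> i _; rewrite subnK //; have := ltn_ord (s i); lia.
  rewrite big_split /= sum_nat_const card_ord mulnDr.
  by rewrite eqn_add2l; apply/eqP; rewrite [RHS](reindex_inj (@perm_inj _ (s^-1)%g)) /=; apply: eq_bigr => i _; rewrite permKV.
have detE : tdeg_le (N * d + N * N) (\det m)%:P /\
    flip (N * d + N * N) (\det m)%:P = 'X^(N * N)%:P * (\det m1)%:P.
  rewrite /determinant !(raddf_sum polyC); split.
    apply: tdeg_le_sum => s _; rewrite /= polyCM (rmorph_prod polyC) -[(N * d + _)%N]add0n.
    apply: tdeg_leM; first by case: (odd_perm s); rewrite ?expr1 ?expr0 ?polyCN polyC1; [apply: tdeg_leN|]; apply: tdeg_le1.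
    by rewrite -(sumE s); have [] := flip_prod (fun i => (wt i (s i)).1).
  rewrite flip_sum mulr_sumr; apply: eq_bigr => s _; rewrite /= !polyCM !(rmorph_prod polyC).
  have [_ fE] := flip_prod (fun i => (wt i (s i)).1).
  have -> : flip (N * d + N * N) (((-1) ^+ s)%:P * \prod_i (m i (s i))%:P) =
      ((-1) ^+ s)%:P * flip (N * d + N * N) (\prod_i (m i (s i))%:P).
    by case: (odd_perm s); rewrite ?expr1 ?expr0 ?polyCN ?polyC1 ?mulN1r ?mul1r ?flipN.
  rewrite -(sumE s) fE mulrCA; congr (_ * _).
  rewrite (eq_bigr (fun i => 'X^N%:P * (m1 i (s i))%:P)); last by move=> i _; rewrite (wt i (s i)).2.
  by rewrite big_split /= prodr_const card_ord -polyC_exp -exprM.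
have [dd fd] := detE.
have td : tdeg_le (N * d) (\det m)%:P.
  apply: (@flip_coef_bound k N N_gt0 (N * d) _ _ (\det m1)%:P dd (leq_addr _ _)).
  by rewrite fd mulrA -polyCM -exprD.
split=> //; apply: (polyCXn_mulI (m := N * N)).
by rewrite -flip_shift.
Qed.

End NormDegree.

From mathcomp Require Import mxpoly.

(** Multiplication by the variable has the companion matrix of q. *)
Lemma qnorm_X (R : comNzRingType) (q : {poly R}) : q \is monic -> (1 < size q)%N ->
  q`_0 = (- 1) ^+ (size q).-1 * qnorm (in_qpoly q 'X).
Proof.
move=> qm q1; have /(congr1 (fun p : {poly R} => p`_0)) := companionmxK qm.
rewrite char_poly_det => <-; congr (_ * \det _).
apply/matrixP => i j; rewrite !mxE -in_qpolyM -exprS.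
have lt_i := ltn_ord i.
case: eqVneq => [iE|niE]; last first.
  rewrite cl_small // ?coefXn 1?eq_sym //.
  have aux z w : (w < z.-1)%N -> w != z.-2 -> (w.+2 < z)%N by lia.
  by rewrite size_polyXn; apply: aux.
have aux z w : (1 < z)%N -> w = z.-2 -> w.+1 = z.-1 by lia.
rewrite (aux _ _ q1 iE).
have E : in_qpoly q 'X^((size q).-1) = in_qpoly q ('X^((size q).-1) - q).
  by rewrite in_qpolyB cl_q // subr0.
rewrite E cl_small //; last first.
  have -> : (size q = (size q).-1.+1)%N by rewrite prednK // ltnW.
  rewrite ltnS; apply/leq_sizeP => l le_l; rewrite coefB coefXn.
  move: le_l; rewrite leq_eqVlt => /predU1P[<-|lt_l].
    by have := monicP qm; rewrite /lead_coef eqxx => ->; rewrite subrr.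
  by rewrite (gtn_eqF lt_l) sub0r nth_default ?oppr0 //; move: lt_l; rewrite prednK // ltnW.
rewrite coefB coefXn [_ == _]ltn_eqF ?sub0r //; exact: ltn_ord.
Qed.

(** * Forms meeting the curve at a single point *)

Section TotalContact.

Variables (k : closedFieldType) (q gam bet : {poly {poly k}}) (N : nat).
Hypotheses (N_gt0 : (0 < N)%N) (qC : plane_curve q N).
Hypothesis q_smooth : forall c, smooth (chart c N q).
Hypothesis qE : q = 'X * gam + 'X%:P * bet.
Hypothesis gam0 : ev2 0 0 gam != 0.
Hypothesis bet0 : forall y, ev2 0 y q = 0 -> ev2 0 y bet != 0.

Notation A := {poly %/ q}.
Notation cl := (in_qpoly q).
Let qm := curve_monic qC.
Let qg : (1 < size q)%N. Proof. by rewrite (curve_size qC). Qed.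
Let dom c : qdomain (chart c N q) := chart_domain N_gt0 qC q_smooth (c := c).
Let x := cl 'X%:P.
Let y := cl 'X.
Let g := cl gam.
Let b := cl bet.

Lemma q00 : ev2 0 0 q = 0.
Proof. by rewrite qE rmorphD !rmorphM /= ev2X ev2C hornerX !mul0r addr0. Qed.

Lemma px0E : px q 0 = x.
Proof. by rewrite /px polyC0 subr0. Qed.

Lemma xy_rel : y * g = - (x * b).
Proof.
apply/eqP; rewrite -addr_eq0 -!in_qpolyM -in_qpolyD -qE; apply/eqP; exact: cl_q.
Qed.

Lemma x_neq0 : x != 0.
Proof. by rewrite -px0E; exact: (px_neq0 qm qg). Qed.

(* f meets the curve in the single point (0 : 0 : 1). *)
Definition total_contact (n : nat) (f : A) :=
  [/\ gr n f,
      forall x0 y0, ev2 x0 y0 (flip N q) = 0 -> evq x0 y0 (cc N true n f) != 0,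
      forall x0 y0, ev2 x0 y0 q = 0 -> (x0 != 0) || (y0 != 0) -> evq x0 y0 f != 0
    & exists2 r : A, g ^+ (N * n) * f = x ^+ (N * n) * r & evq 0 0 r != 0].

(** With M = N n, norms show that x^M divides the norm of f. That norm has degree at most M because
    f is a section of O(n), so it is a constant times x^M and all zeros of f lie over x = 0. The
    same count leaves r no zero over x = 0, and y g = - x b then confines the zeros of f to y =
    0. *)
Lemma total_contactP n (f r : A) : f != 0 -> gr n f ->
  g ^+ (N * n) * f = x ^+ (N * n) * r -> total_contact n f.
Proof.
move=> f0 fn rE; set M := (N * n)%N in rE *.
have nX : qnorm x = 'X^N.
  have -> : x = 'X *: 1 by rewrite /x clC_alg.
  by rewrite (qnorm_scale qm qg) (curve_size qC).
pose w := bet`_0.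
have q0E : q`_0 = 'X * w by rewrite qE coefD coefXM coefCM add0r.
pose sg : {poly k} := (- 1) ^+ N.
have sg2 : sg * sg = 1 by rewrite /sg -expr2 -exprM mulnC exprM sqrrN expr1n expr1n.
have nY : qnorm y = sg * ('X * w).
  by rewrite -q0E (qnorm_X qm qg) (curve_size qC) -/sg mulrA sg2 mul1r.
have b_unit : (qnorm b).[0] != 0.
  by apply: qnorm_fibre => // y0 q0; rewrite evq_cl //; apply: bet0.
have w_unit : w.[0] != 0.
  by have := bet0 q00; rewrite /ev2 polyC0 (horner_coef0 bet).
have nf0 : qnorm f != 0 := qdom_qnorm_neq0 qm qg (@dom false) f0.
have sg0 : sg != 0 by apply: contraTneq (oner_neq0 {poly k}) => E; rewrite -sg2 E mul0r negbK eqxx.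
pose B := qnorm b; pose W := sg * (sg * w).
have nb : qnorm (- (x * b)) = sg * 'X^N * B.
  have -> : - (x * b) = ((-1) *: 1) * (x * b) by rewrite -scalerAl mul1r scaleN1r.
  by rewrite !(qnormM qm qg) (qnorm_scale qm qg) nX (curve_size qC) mulrA.
(* Norms of y^M g^M f = y^M x^M r, rewritten with y g = - x b; the common factors are cancelled. *)
have key : B ^+ M * qnorm f = w ^+ M * 'X^M * qnorm r.
  have X0 : 'X^(N * M) != 0 :> {poly k} by rewrite expf_eq0 polyX_eq0 andbF.
  apply: (mulfI X0); apply: (mulfI (expf_neq0 M sg0)).
  have := congr1 (@qnorm _ q) (congr1 (fun a => y ^+ M * a) rE).
  rewrite !mulrA -exprMn xy_rel !(qnormM qm qg) !(qnormX qm qg) nb nX nY => E.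
  transitivity ((sg * 'X^N * B) ^+ M * qnorm f); first by rewrite !exprMn -['X^N ^+ M]exprM.
  rewrite E !exprMn -['X^N ^+ M]exprM; move: (sg ^+ M) ('X^(N * M)) => u v; ring.
have [nfd nf1] := qnorm_flip N_gt0 qC fn; rewrite -/M in nfd nf1.
have sz : (size (qnorm f) <= M.+1)%N by have := nfd 0%N; rewrite coefC.
have [c cE] : exists c, qnorm f = c * 'X^M.
  have : 'X^M %| B ^+ M * qnorm f by rewrite key mulrAC dvdp_mull.
  rewrite Gauss_dvdpr; first by move/dvdpP.
  rewrite coprimep_expl // coprimep_expr // coprimep_sym -['X]subr0 -polyC0.
  by rewrite coprimep_XsubC /root b_unit.
have c0 : c != 0 by apply: contraNneq nf0 => c0; rewrite cE c0 mul0r.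
have c1 : size c = 1%N.
  apply/eqP; rewrite eqn_leq size_poly_gt0 c0 andbT.
  by move: sz; rewrite cE size_mulXn // addnC -[M.+1]add1n leq_add2r.
have [u u0 cu] := size_poly1P c (introT eqP c1).
have rN : B ^+ M * c = w ^+ M * qnorm r.
  have X0 : 'X^M != 0 :> {poly k} by rewrite expf_eq0 polyX_eq0 andbF.
  have E : 'X^M * (B ^+ M * c) = B ^+ M * qnorm f by rewrite cE mulrC mulrA.
  by apply: (mulfI X0); rewrite E key [w ^+ M * _]mulrC mulrA.
have r_unit y0 : ev2 0 y0 q = 0 -> evq 0 y0 r != 0.
  move=> q0; apply: contraTneq (mulf_neq0 (expf_neq0 M b_unit) u0) => r0.
  have /(congr1 (fun p : {poly k} => p.[0])) := rN.
  by rewrite !hornerM cu hornerC !horner_exp (qnorm_root qm qg q0 r0) mulr0 -/B => ->; rewrite negbK.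
split=> //.
- move=> x0 y0 q0; apply/negP => /eqP f10.
  have := qnorm_root (chart_monic N_gt0 qC true) (chart_gt1 N_gt0 qC true) q0 f10.
  have : qnorm (cc N true n f) = c.
    apply/polyC_inj; rewrite -nf1 cE mulrC polyCM.
    have := @flip_mono k M u M 0; rewrite expr0 mulr1 addn0 leqnn subnn subn0.
    by move=> /(_ isT); rewrite cu !mulr1 -!mul_polyC expr0 mulr1 -polyCM [u%:P * _]mulrC.
  by move=> ->; rewrite cu hornerC => /eqP; rewrite (negbTE u0).
- move=> x0 y0 q0 nz; apply/negP => /eqP f0'.
  have := qnorm_root qm qg q0 f0'; rewrite cE hornerM hornerXn cu hornerC => /eqP.
  rewrite mulf_eq0 (negbTE u0) expf_eq0 => /andP[M0 /eqP x00].
  move: nz; rewrite x00 eqxx /= => y00; rewrite x00 in q0 f0'.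
  have : (- b) ^+ M * f = y ^+ M * r.
    apply: (qdom_mulfI (@dom false) (qdom_expf_neq0 (@dom false) M x_neq0)).
    rewrite mulrA -exprMn mulrN -xy_rel exprMn -mulrA rE; ring.
  move/(congr1 (evq 0 y0)); rewrite !evqM // f0' mulr0 !evqX // evq_cl // ev2X => /esym/eqP.
  by rewrite mulf_eq0 expf_eq0 (negbTE y00) andbF (negbTE (r_unit _ q0)).
- by exists r => //; apply: r_unit; exact: q00.
Qed.

Section Orders.

Variables (n : nat) (f : A).
Hypothesis fT : total_contact n f.

Lemma total_contact_neq0 : f != 0.
Proof.
have [_ _ _ [r rE r0]] := fT; apply: contraNneq (qdom_mulf_neq0 (@dom false) (qdom_expf_neq0 (@dom false) (N * n) x_neq0) (evq_neq0 r0)).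
by move=> f0; rewrite -rE f0 mulr0.
Qed.

Let qcm c := chart_monic N_gt0 qC c.
Let qcg c := chart_gt1 N_gt0 qC c.

Lemma total_contact_unit c x0 y0 p : ev2 x0 y0 (chart c N q) = 0 -> uniformizer x0 y0 p ->
  ~~ [&& ~~ c, x0 == 0 & y0 == 0] -> ordat x0 y0 p (cc N c n f) 0.
Proof.
have [fn f1 fP _] := fT; case: c p => p q0 pu nP; apply: ord_unit => //.
  exact: f1.
by rewrite /cc cl_id; apply: fP => //; rewrite -negb_and.
Qed.

Lemma total_contact_ord c x0 y0 p m : ev2 x0 y0 (chart c N q) = 0 -> uniformizer x0 y0 p ->
  ordat x0 y0 p (cc N c n f) m -> (N * n %| m)%N.
Proof.
move=> q0 pu fm; have [/and3P[c0 /eqP x00 /eqP y00]|nP] := boolP [&& ~~ c, x0 == 0 & y0 == 0]; last first.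
  have := ord_uniq (@qcm c) (@qcg c) (@dom c) q0 pu fm (total_contact_unit q0 pu nP).
  by move=> ->; rewrite dvdn0.
case: c c0 p q0 pu fm => //= _ p q0 pu; rewrite /cc cl_id x00 y00 in q0 pu * => fm.
have [_ _ _ [r rE r0]] := fT.
have [j xj] := ord_exists qm qg (@dom false) q0 pu x_neq0.
have gP : evq 0 0 (g ^+ (N * n)) != 0 by rewrite evqX // expf_neq0 // evq_cl.
have := ordM qm qg q0 (ord_unit qm qg p q0 gP) fm; rewrite add0n rE => om.
have := ordM qm qg q0 (ordX qm qg q0 (N * n) xj) (ord_unit qm qg p q0 r0).
by move/(ord_uniq qm qg (@dom false) q0 pu om) => ->; rewrite addn0 dvdn_mulr.
Qed.

(** Away from the origin f is a unit and the comparison with h suffices. At the origin h is a unit,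
    and the relation with r shows that a vanishes there at least as much as f. *)
Lemma total_contact_dvd d e (a h r : A) : a != 0 -> h != 0 -> gr d a -> gr e h -> (n + e <= d)%N ->
    evq 0 0 h != 0 -> g ^+ (N * n) * a = x ^+ (N * n) * r ->
    (forall c x0 y0 p i j, ev2 x0 y0 (chart c N q) = 0 -> uniformizer x0 y0 p ->
       ordat x0 y0 p (cc N c d a) i -> ordat x0 y0 p (cc N c e h) j -> (j <= i)%N) ->
  exists2 s, gr (d - (n + e)) s & a = s * (f * h).
Proof.
move=> a0 h0 da eh le_d hP rE ord; have [fn _ _ [r' r'E r'0]] := fT.
have f0 := total_contact_neq0.
apply: (gdvd N_gt0 qC q_smooth da _ le_d a0).
- exact: (grM qm (curve_size qC) N_gt0 (curve_tdeg qC)).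
- exact (qdom_mulf_neq0 (@dom false) f0 h0).
move=> c x0 y0 p i j q0 pu ai; rewrite (ccM N_gt0 qC) // => fhj.
have [l hl] := ord_exists (@qcm c) (@qcg c) (@dom c) q0 pu (cc_neq0 N_gt0 qC c eh h0).
have [m fm] := ord_exists (@qcm c) (@qcg c) (@dom c) q0 pu (cc_neq0 N_gt0 qC c fn f0).
rewrite (ord_uniq (@qcm c) (@qcg c) (@dom c) q0 pu fhj (ordM (@qcm c) (@qcg c) q0 fm hl)).
have [/and3P[c0 /eqP x00 /eqP y00]|nP] := boolP [&& ~~ c, x0 == 0 & y0 == 0]; last first.
  rewrite (ord_uniq (@qcm c) (@qcg c) (@dom c) q0 pu fm (total_contact_unit q0 pu nP)) add0n.
  exact: ord q0 pu ai hl.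
case: c c0 p q0 pu ai hl fm {fhj} => //= _ p q0 pu; rewrite /cc !cl_id x00 y00 in q0 pu * => ai hl fm.
rewrite (ord_uniq qm qg (@dom false) q0 pu hl (ord_unit qm qg p q0 hP)) addn0.
apply: (local_dvd_ord qm qg (@dom false) q0 pu (s := r' * g ^+ (N * n)) (r := r * g ^+ (N * n))) ai fm.
  by rewrite -!mulrA rE r'E; ring.
by rewrite evqM // mulf_neq0 // evqX // expf_neq0 // evq_cl.
Qed.

End Orders.

(** The ring of a smooth affine curve is integrally closed. *)
Lemma qdom_root_dvd (u v w : A) e : (0 < e)%N -> u != 0 -> v != 0 ->
  u ^+ e = v ^+ e * w -> exists h, u = h * v.
Proof.
move=> e0 u0 v0 uE; apply: (dvd_by_ord qm qg (@dom false) (@q_smooth false) u0 v0).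
move=> x0 y0 p m n q0 pu um vn.
have w0 : w != 0.
  apply: contraNneq (qdom_expf_neq0 (@dom false) e u0) => w0.
  by rewrite uE w0 mulr0.
have [l wl] := ord_exists qm qg (@dom false) q0 pu w0.
have := ordX qm qg q0 e um; rewrite uE => om.
have := ord_uniq qm qg (@dom false) q0 pu om (ordM qm qg q0 (ordX qm qg q0 e vn) wl).
by move=> E; rewrite -(leq_pmul2l e0) E leq_addr.
Qed.

End TotalContact.

(** * Forms of total contact modulo 3 *)

Section PointOrders.

Variables (k : closedFieldType) (q : {poly {poly k}}) (N : nat).
Hypotheses (N_gt0 : (0 < N)%N) (qC : plane_curve q N).
Hypothesis q_smooth : forall c, smooth (chart c N q).
Variables (c : bool) (x y : k) (p : {poly %/ chart c N q}).
Hypotheses (q0 : ev2 x y (chart c N q) = 0) (pu : uniformizer x y p).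
Let qm := chart_monic N_gt0 qC c.
Let qg := chart_gt1 N_gt0 qC c.
Let dom : qdomain (chart c N q) := chart_domain N_gt0 qC q_smooth (c := c).
Implicit Types a b : {poly %/ q}.

Lemma pord_ex d a : gr d a -> a != 0 -> exists m, ordat x y p (cc N c d a) m.
Proof. by move=> da a0; apply: (ord_exists qm qg dom q0 pu); apply: cc_neq0. Qed.

Lemma pord_uniq d a m n : ordat x y p (cc N c d a) m -> ordat x y p (cc N c d a) n -> m = n.
Proof. exact: (ord_uniq qm qg dom q0 pu). Qed.

Lemma pordM d e a b m n : gr d a -> gr e b ->
  ordat x y p (cc N c d a) m -> ordat x y p (cc N c e b) n ->
  ordat x y p (cc N c (d + e) (a * b)) (m + n).
Proof. by move=> da eb am bn; rewrite (ccM N_gt0 qC) //; apply: ordM. Qed.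

Lemma pordX d a m n : gr d a -> ordat x y p (cc N c d a) m ->
  ordat x y p (cc N c (n * d) (a ^+ n)) (n * m).
Proof. by move=> da am; rewrite (ccX N_gt0 qC) //; apply: ordX. Qed.

End PointOrders.

Section ModThree.

Variables (k : closedFieldType) (phi : {rmorphism 'F_3 -> k}).
Variables (q gam bet : {poly {poly 'F_3}}).
Notation ph := (map_poly (map_poly phi)).
Notation qk := (ph q).
Hypotheses (q_monic : q \is monic) (q_size : size q = 13) (q_tdeg : tdeg_le 12 q).
Hypothesis q_smooth : forall c, smooth (chart c 12 qk).
Hypothesis qy_neq0 : q^`() != 0.
Hypothesis hasse_witt : forall H, tdeg_le 9 H -> cartier (q * q * H) = H -> H = 0.
Hypothesis qE : q = 'X * gam + 'X%:P * bet.
Hypothesis gam0 : ev2 0 0 (ph gam) != 0.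
Hypothesis bet0 : forall y, ev2 0 y qk = 0 -> ev2 0 y (ph bet) != 0.

Notation A := {poly %/ q}.
Notation cl := (in_qpoly q).
Notation em := (@qmap _ _ (map_poly phi) q).
Let x := cl 'X%:P.
Let g := cl gam.

Variables (f0 ka g0 : A).
Hypotheses (f0d : gr 14 f0) (kad : gr 16 ka) (g0d : gr 10 g0) (rel0 : f0 * ka = g0 ^+ 3).
Hypotheses (f00 : evq 0 0 (em f0) != 0) (ka_neq0 : ka != 0).
Hypothesis cop : forall c x0 y0, ev2 x0 y0 (chart c 12 qk) = 0 ->
  evq x0 y0 (cc 12 c 14 (em f0)) != 0 \/ evq x0 y0 (cc 12 c 16 (em ka)) != 0.

Let q_gt1 : (1 < size q)%N. Proof. by rewrite q_size. Qed.
Let N_gt0 := ltn0Sn 11.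
Let qC := plane_curve_map phi q_monic q_size q_tdeg.
Let qkm := curve_monic qC.
Let qkg : (1 < size qk)%N. Proof. by rewrite (curve_size qC). Qed.
Let emM : forall a b, em (a * b) = em a * em b. Proof. exact: qmapM. Qed.
Let em_nz a : a != 0 -> em a != 0. Proof. exact: em_neq0. Qed.
Let em_inj : injective em. Proof. exact: (qmap_inj q_monic q_gt1). Qed.
Let nzM (a b : A) : a != 0 -> b != 0 -> a * b != 0. Proof. exact: (mul_neq0 q_monic q_size q_tdeg q_smooth). Qed.
Let nzX (a : A) n : a != 0 -> a ^+ n != 0. Proof. by move=> a0; exact: (exp_neq0 q_monic q_size q_tdeg q_smooth n a0). Qed.
Let canc (c a b : A) : c != 0 -> c * a = c * b -> a = b. Proof. exact: (mul_cancel q_monic q_size q_tdeg q_smooth). Qed.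
Let g3M d e (a b : A) : gr d a -> gr e b -> gr (d + e) (a * b).
Proof. exact: (grM q_monic q_size N_gt0 q_tdeg). Qed.
Let g3X d (a : A) n : gr d a -> gr (n * d) (a ^+ n).
Proof. exact: (grX q_monic q_size N_gt0 q_tdeg). Qed.
Let qkE : qk = 'X * ph gam + 'X%:P * ph bet.
Proof. by rewrite {1}qE rmorphD !rmorphM /= map_polyX map_polyC /= map_polyX. Qed.
Let q0k : ev2 0 0 qk = 0 := q00 qkE.
Let gkM d e (a b : {poly %/ qk}) : gr d a -> gr e b -> gr (d + e) (a * b).
Proof. exact: (grM qkm (curve_size qC) N_gt0 (curve_tdeg qC)). Qed.
Let gkX d (a : {poly %/ qk}) n : gr d a -> gr (n * d) (a ^+ n).
Proof. exact: (grX qkm (curve_size qC) N_gt0 (curve_tdeg qC)). Qed.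

Lemma emX a n : em (a ^+ n) = em a ^+ n.
Proof. by elim: n => [|n IH]; rewrite ?expr0 ?exprS ?emM ?IH // -(rmorph1 cl) qmap_cl // !rmorph1. Qed.

Lemma em_gr d a : gr d a -> gr d (em a).
Proof. by move=> da; rewrite /gr val_qmap //; apply: tdeg_le_map. Qed.

Lemma em_gr_inv d a : gr d (em a) -> gr d a.
Proof. by rewrite /gr val_qmap //; apply: tdeg_le_map_inv. Qed.

Lemma f0_neq0 : f0 != 0.
Proof. by apply: contraNneq f00 => ->; rewrite (em0 phi q_monic q_size) evq0. Qed.

Lemma em_descend (a b : A) h d : b != 0 -> em a = h * em b -> gr d h ->
  exists2 h0 : A, gr d h0 & a = h0 * b.
Proof.
move=> b0 E hd; have [h0 h0E aE] := qdvd_descend q_monic q_size q_tdeg q_smooth b0 E.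
by exists h0 => //; apply: em_gr_inv; rewrite -h0E.
Qed.

Let em_gam : em g = in_qpoly qk (ph gam). Proof. exact: qmap_cl. Qed.
Let em_x : em x = in_qpoly qk 'X%:P.
Proof. by rewrite qmap_cl // map_polyC /= map_polyX. Qed.

Lemma coprime_ord c x0 y0 p : ev2 x0 y0 (chart c 12 qk) = 0 -> uniformizer x0 y0 p ->
  ordat x0 y0 p (cc 12 c 14 (em f0)) 0 \/ ordat x0 y0 p (cc 12 c 16 (em ka)) 0.
Proof.
move=> q0 pu; have qm := chart_monic N_gt0 qC c; have qg := chart_gt1 N_gt0 qC c.
by case: (cop q0) => /(ord_unit qm qg p q0); [left|right].
Qed.

Definition cubic d (a : A) := forall c x0 y0 p m, ev2 x0 y0 (chart c 12 qk) = 0 ->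
  uniformizer x0 y0 p -> ordat x0 y0 p (cc 12 c d (em a)) m -> (3 %| m)%N.

(** At each point one of the two orders is 0, and their sum is three times the order of g0. *)
Lemma cubic_f0_ka : cubic 14 f0 /\ cubic 16 ka.
Proof.
suff H c x0 y0 p : ev2 x0 y0 (chart c 12 qk) = 0 -> uniformizer x0 y0 p ->
    exists m n, [/\ ordat x0 y0 p (cc 12 c 14 (em f0)) m, ordat x0 y0 p (cc 12 c 16 (em ka)) n,
                 (3 %| m)%N & (3 %| n)%N].
  split=> c x0 y0 p l q0 pu ol; have [m [n [om on dm dn]]] := H c x0 y0 p q0 pu.
    by rewrite (pord_uniq N_gt0 qC q_smooth q0 pu ol om).
  by rewrite (pord_uniq N_gt0 qC q_smooth q0 pu ol on).
move=> q0 pu.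
have g00 : g0 != 0.
  apply: contraNneq (nzM f0_neq0 ka_neq0) => E.
  by rewrite rel0 E expr0n.
have [m om] := pord_ex N_gt0 qC q_smooth q0 pu (em_gr f0d) (em_nz f0_neq0).
have [n on] := pord_ex N_gt0 qC q_smooth q0 pu (em_gr kad) (em_nz ka_neq0).
have [l ol] := pord_ex N_gt0 qC q_smooth q0 pu (em_gr g0d) (em_nz g00).
have := pordM N_gt0 qC q0 (em_gr f0d) (em_gr kad) om on; rewrite -emM rel0 emX => o1.
have := pord_uniq N_gt0 qC q_smooth q0 pu o1 (pordX N_gt0 qC q0 3 (em_gr g0d) ol) => E.
exists m, n; split=> //.
  case: (coprime_ord q0 pu) => o0; first by rewrite (pord_uniq N_gt0 qC q_smooth q0 pu om o0).
  by move: E; rewrite (pord_uniq N_gt0 qC q_smooth q0 pu on o0) addn0 => ->; rewrite dvdn_mulr.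
case: (coprime_ord q0 pu) => o0; last by rewrite (pord_uniq N_gt0 qC q_smooth q0 pu on o0).
by move: E; rewrite (pord_uniq N_gt0 qC q_smooth q0 pu om o0) add0n => ->; rewrite dvdn_mulr.
Qed.

Lemma iter_cube_root j d (X : A) : (0 < d)%N -> X != 0 -> gr (3 ^ j * d) X ->
    (forall c x0 y0 p m, ev2 x0 y0 (chart c 12 qk) = 0 -> uniformizer x0 y0 p ->
       ordat x0 y0 p (cc 12 c (3 ^ j * d) (em X)) m -> (3 ^ j %| m)%N) ->
  exists2 V : A, gr d V & X = V ^+ (3 ^ j).
Proof.
move=> d0; elim: j X => [|j IH] X X0 Xd oX.
  by exists X; rewrite ?expr1 //; rewrite expn0 mul1n in Xd.
rewrite expnS -mulnA in Xd oX.
have [||V Vd VE] := cube_root q_monic q_size q_tdeg q_smooth qy_neq0 hasse_witt _ X0 Xd.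
- by rewrite muln_gt0 expn_gt0.
- move=> c x0 y0 p m q0 pu; rewrite -(val_qmap (map_poly phi) q_monic q_gt1) => om.
  by apply: dvdn_trans (oX c x0 y0 p m q0 pu om); rewrite dvdn_mulr.
have V0 : V != 0 by apply: contraNneq X0 => V0; rewrite VE V0 expr0n.
have [|W Wd WE] := IH V V0 Vd; last by exists W; rewrite // VE WE -exprM expnSr.
move=> c x0 y0 p m q0 pu om.
have := pordX N_gt0 qC q0 3 (em_gr Vd) om; rewrite -emX -VE => /(oX _ _ _ _ _ q0 pu).
by rewrite dvdn_pmul2l.
Qed.

Variables (j u Q n : nat) (f : A).
Hypotheses (QE : Q = (3 ^ j)%N) (nE : n = (Q * u)%N).
Hypotheses (u1 : (u %% 3 = 1)%N) (fT : total_contact (ph gam) 12 n (em f)).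

Let Q_gt0 : (0 < Q)%N. Proof. by rewrite QE expn_gt0. Qed.
Let fd : gr n f. Proof. by apply: em_gr_inv; case: fT. Qed.
Let fk0 : em f != 0. Proof. exact: (total_contact_neq0 N_gt0 qC q_smooth fT). Qed.
Let f_neq0 : f != 0. Proof. by apply: contraNneq fk0 => ->; rewrite (em0 phi q_monic q_size). Qed.

(** The orders of f are multiples of 12 n = 12 Q u and those of a^Q are multiples of 3 Q. Since u =
    1 and D = 2 modulo 3, the degree Q (u + D) is a multiple of 3 Q too. *)
Lemma twisted_root D (a : A) : gr D a -> a != 0 -> (D %% 3 = 2)%N -> cubic D a ->
  exists2 v : A, gr ((u + D) %/ 3) v & f * a ^+ Q = v ^+ (3 * Q).
Proof.
move=> aD a0 D2 aC; have dE : (3 * ((u + D) %/ 3) = u + D)%N by clear -u1 D2; lia.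
have Q3 : (3 ^ j.+1 * ((u + D) %/ 3) = n + Q * D)%N.
  by rewrite expnSr -mulnA dE mulnDr nE -QE.
have -> : (3 * Q = 3 ^ j.+1)%N by rewrite expnS QE.
apply: iter_cube_root.
- by clear -dE u1; lia.
- by rewrite nzM ?nzX.
- rewrite Q3; apply: g3M => //; exact: g3X.
move=> c x0 y0 p m q0 pu; rewrite Q3 emM emX => om.
have [l ol] := pord_ex N_gt0 qC q_smooth q0 pu (em_gr fd) fk0.
have [i oi] := pord_ex N_gt0 qC q_smooth q0 pu (em_gr aD) (em_nz a0).
have := pordM N_gt0 qC q0 (em_gr fd) (gkX Q (em_gr aD)) ol (pordX N_gt0 qC q0 Q (em_gr aD) oi).
move/(pord_uniq N_gt0 qC q_smooth q0 pu om) => ->; apply: dvdn_add.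
  apply: dvdn_trans (total_contact_ord N_gt0 qC q_smooth gam0 fT q0 pu ol).
  have -> : (12 * n = 3 ^ j.+1 * (4 * u))%N by rewrite nE expnS -QE; clear; lia.
  exact: dvdn_mulr.
by rewrite expnSr -QE dvdn_pmul2l // (aC c x0 y0 p).
Qed.

(** The contact relation of f has exponent 12 n = 4 u * 3 Q. Extracting the root of order 3 Q, which
    integral closedness permits, leaves the exponent 4 u. *)
Lemma root_contact d (v : A) : gr d v -> v != 0 -> f * f0 ^+ Q = v ^+ (3 * Q) ->
  exists a, g ^+ (4 * u) * v = x ^+ (4 * u) * a.
Proof.
move=> vd v0 vE; have [_ _ _ [r rE r0]] := fT.
have nE' : (12 * n = 4 * u * (3 * Q))%N by rewrite nE; clear; lia.
have gx0 : g != 0.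
  apply: contraNneq gam0 => E; rewrite -(evq_cl qkm qkg _ q0k) -em_gam E.
  by rewrite (em0 phi q_monic q_size) evq0.
have x0 : x != 0.
  have := x_neq0 N_gt0 qC; rewrite -em_x; apply: contraNneq => ->.
  by rewrite (em0 phi q_monic q_size).
have [||||h hE] := @qdom_root_dvd _ _ _ N_gt0 qC q_smooth (em (g ^+ (4 * u) * v)) (em (x ^+ (4 * u)))
    (r * em (f0 ^+ Q)) (3 * Q).
- by rewrite muln_gt0.
- by apply: em_nz; rewrite nzM ?nzX.
- by apply: em_nz; rewrite nzX.
- rewrite emM exprMn -!emX -!exprM -nE' -vE emM mulrA emX em_gam rE.
  by rewrite (emX x) em_x -mulrA.
have [b bE aE] := qdvd_descend q_monic q_size q_tdeg q_smooth (nzX (4 * u) x0) hE.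
by exists b; rewrite aE mulrC.
Qed.

(** As f0 and ka have no common zero, the last equation forces f0^Q to divide a, and the contact at
    the origin forces f to divide it as well. The degrees then agree, so the quotient is a
    constant. *)
Lemma vanishing_multiple (a y z : A) : gr (n + 14 * Q) a -> gr (n + 32 * Q) y ->
    g ^+ (12 * n) * a = x ^+ (12 * n) * z -> a * ka ^+ (2 * Q) = y * f0 ^+ Q ->
  exists c : 'F_3, a = cl c%:P%:P * (f * f0 ^+ Q) /\ y = cl c%:P%:P * (f * ka ^+ (2 * Q)).
Proof.
move=> ad yd zE E; have [a0|a0] := eqVneq a 0.
  exists 0; rewrite !polyC0 in_qpoly0 !mul0r; split=> //.
  move/eqP: E; rewrite a0 mul0r eq_sym => /eqP/(dom3 q_monic q_size q_tdeg q_smooth)[//|f00'].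
  by have := nzX Q f0_neq0; rewrite f00' eqxx.
have y0 : y != 0.
  apply: contraNneq (nzM a0 (nzX (2 * Q) ka_neq0)) => y0.
  by rewrite E y0 mul0r.
have f0Qd := em_gr (g3X Q f0d); have kaQd := em_gr (g3X (2 * Q) kad).
have [||||s sd sE] := total_contact_dvd N_gt0 qC q_smooth gam0 fT (em_nz a0)
   (em_nz (nzX Q f0_neq0)) (em_gr ad) f0Qd _ _ (r := em z).
- by rewrite mulnC.
- by rewrite emX evqX // expf_neq0.
- by rewrite -em_gam -em_x -!emX -!emM zE.
- move=> c x0 y0' p i l q0 pu oi ol.
  have [m om] := pord_ex N_gt0 qC q_smooth q0 pu (em_gr f0d) (em_nz f0_neq0).
  have [w ow] := pord_ex N_gt0 qC q_smooth q0 pu (em_gr kad) (em_nz ka_neq0).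
  have [t ot] := pord_ex N_gt0 qC q_smooth q0 pu (em_gr yd) (em_nz y0).
  have o1 := pordX N_gt0 qC q0 Q (em_gr f0d) om; rewrite -emX in o1.
  have o2 := pordX N_gt0 qC q0 (2 * Q) (em_gr kad) ow; rewrite -emX in o2.
  have := pordM N_gt0 qC q0 (em_gr yd) f0Qd ot o1; rewrite -emM -E emM => o3.
  have := pordM N_gt0 qC q0 (em_gr ad) kaQd oi o2.
  rewrite (_ : (n + 14 * Q + 2 * Q * 16 = n + 32 * Q + Q * 14)%N); last by clear; lia.
  move/(pord_uniq N_gt0 qC q_smooth q0 pu o3).
  rewrite (pord_uniq N_gt0 qC q_smooth q0 pu ol o1).
  case: (coprime_ord q0 pu) => o0.
    by rewrite (pord_uniq N_gt0 qC q_smooth q0 pu om o0) muln0.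
  by rewrite (pord_uniq N_gt0 qC q_smooth q0 pu ow o0) muln0 addn0 => <-; rewrite leq_addl.
rewrite (_ : (_ - _ = 0)%N) in sd; last by rewrite [(Q * 14)%N]mulnC subnn.
rewrite -emM in sE.
have [s0 s0d aE] := em_descend (nzM f_neq0 (nzX Q f0_neq0)) sE sd.
have [c cE] := gr0_const q_monic q_size N_gt0 s0d; exists c; rewrite -cE; split=> //.
apply: (canc (nzX Q f0_neq0)); rewrite mulrC -E aE; ring.
Qed.

(** The same comparison of orders, with one factor f0 and one factor ka fewer. The quotients s of a
    by f f0^(Q-1) and t of y by f ka^(2Q-1) now have degrees 14 and 16, and cancelling the common
    factors expresses r through them. *)
Lemma obstruction (a y z r : A) : gr (n + 14 * Q) a -> gr (n + 32 * Q) y -> gr 30 r ->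
    g ^+ (12 * n) * a = x ^+ (12 * n) * z ->
    a * ka ^+ (2 * Q) = y * f0 ^+ Q + f * ka ^+ (2 * Q).-1 * f0 ^+ Q.-1 * r ->
  exists s t, [/\ gr 14 s, gr 16 t & r = ka * s - f0 * t].
Proof.
move=> ad yd rd zE E.
have QP : Q = Q.-1.+1 by rewrite prednK.
have Q2E : (2 * Q)%N = (2 * Q).-1.+1 by rewrite prednK // muln_gt0.
have f0P : f0 ^+ Q = f0 ^+ Q.-1 * f0 by rewrite {1}QP exprSr.
have kaP : ka ^+ (2 * Q) = ka ^+ (2 * Q).-1 * ka by rewrite {1}Q2E exprSr.
have E' : a * ka ^+ (2 * Q) = (y * f0 + f * ka ^+ (2 * Q).-1 * r) * f0 ^+ Q.-1.
  by rewrite E f0P; ring.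
have f0Qd := em_gr (g3X Q.-1 f0d); have kaQd := em_gr (g3X (2 * Q) kad).
have wd : gr (n + 32 * Q + 14) (y * f0 + f * ka ^+ (2 * Q).-1 * r).
  apply: (grD _); first exact: g3M.
  rewrite (_ : (n + 32 * Q + 14 = n + (2 * Q).-1 * 16 + 30)%N); last by clear -Q2E; lia.
  by apply: g3M => //; apply: g3M => //; apply: g3X.
have [s sd aE] : exists2 s, gr 14 s & a = s * (f * f0 ^+ Q.-1).
  have [a0|a0] := eqVneq a 0.
    by exists 0; rewrite ?mul0r // /gr raddf0; apply: tdeg_le0.
  have w0 : y * f0 + f * ka ^+ (2 * Q).-1 * r != 0.
    apply: contraNneq (nzM a0 (nzX (2 * Q) ka_neq0)) => w0.
    by rewrite E' w0 mul0r.
  have [||||s sd sE] := total_contact_dvd N_gt0 qC q_smooth gam0 fT (em_nz a0)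
   (em_nz (nzX Q.-1 f0_neq0)) (em_gr ad) f0Qd _ _ (r := em z).
  - by rewrite leq_add2l mulnC leq_mul2l leq_pred orbT.
  - by rewrite emX evqX // expf_neq0.
  - by rewrite -em_gam -em_x -!emX -!emM zE.
  - move=> c x0 y0' p i l q0 pu oi ol.
    have [m om] := pord_ex N_gt0 qC q_smooth q0 pu (em_gr f0d) (em_nz f0_neq0).
    have [w ow] := pord_ex N_gt0 qC q_smooth q0 pu (em_gr kad) (em_nz ka_neq0).
    have [t ot] := pord_ex N_gt0 qC q_smooth q0 pu (em_gr wd) (em_nz w0).
    have o1 := pordX N_gt0 qC q0 Q.-1 (em_gr f0d) om; rewrite -emX in o1.
    have o2 := pordX N_gt0 qC q0 (2 * Q) (em_gr kad) ow; rewrite -emX in o2.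
    have := pordM N_gt0 qC q0 (em_gr wd) f0Qd ot o1; rewrite -emM -E' emM => o3.
    have := pordM N_gt0 qC q0 (em_gr ad) kaQd oi o2.
    rewrite (_ : (n + 14 * Q + 2 * Q * 16 = n + 32 * Q + 14 + Q.-1 * 14)%N); last by clear -QP; lia.
    move/(pord_uniq N_gt0 qC q_smooth q0 pu o3).
    rewrite (pord_uniq N_gt0 qC q_smooth q0 pu ol o1).
    case: (coprime_ord q0 pu) => o0.
      by rewrite (pord_uniq N_gt0 qC q_smooth q0 pu om o0) muln0.
    by rewrite (pord_uniq N_gt0 qC q_smooth q0 pu ow o0) muln0 addn0 => <-; rewrite leq_addl.
  rewrite (_ : (_ - _ = 14)%N) in sd; last by clear -QP; lia.
  rewrite -emM in sE.
  by have [s0 s0d s0E] := em_descend (nzM f_neq0 (nzX Q.-1 f0_neq0)) sE sd; exists s0.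
have yE : y * f0 = f * ka ^+ (2 * Q).-1 * (ka * s - r).
  apply: (canc (nzX Q.-1 f0_neq0)).
  have -> : f0 ^+ Q.-1 * (y * f0) = a * ka ^+ (2 * Q) - f * ka ^+ (2 * Q).-1 * f0 ^+ Q.-1 * r.
    by rewrite E f0P; ring.
  by rewrite aE kaP; ring.
have fkd := g3M fd (g3X (2 * Q).-1 kad).
have ksd : gr 30 (ka * s - r).
  by apply: (grD _); [exact: (g3M kad sd)|exact: (grN q_monic q_size N_gt0 q_tdeg rd)].
have [t td tE] : exists2 t, gr 16 t & y = t * (f * ka ^+ (2 * Q).-1).
  have [y0|y0] := eqVneq y 0; first by exists 0; rewrite ?mul0r // /gr raddf0; apply: tdeg_le0.
  have ks0 : ka * s - r != 0.
    by apply: contraNneq (nzM y0 f0_neq0) => E0; rewrite yE E0 mulr0.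
  have fk0' := em_nz (nzM f_neq0 (nzX (2 * Q).-1 ka_neq0)).
  have [|c x0 y0' p i l q0 pu oi ol|t td tE] := gdvd N_gt0 qC q_smooth (em_gr yd) (em_gr fkd) _ (em_nz y0) fk0'.
  - by clear -Q2E; lia.
  - have [m om] := pord_ex N_gt0 qC q_smooth q0 pu (em_gr f0d) (em_nz f0_neq0).
    have [w ow] := pord_ex N_gt0 qC q_smooth q0 pu (em_gr kad) (em_nz ka_neq0).
    have [v ov] := pord_ex N_gt0 qC q_smooth q0 pu (em_gr ksd) (em_nz ks0).
    have [b ob] := pord_ex N_gt0 qC q_smooth q0 pu (em_gr fd) fk0.
    have := pordM N_gt0 qC q0 (em_gr yd) (em_gr f0d) oi om; rewrite -emM yE emM => o1.
    have := pordM N_gt0 qC q0 (em_gr fkd) (em_gr ksd) ol ov.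
    rewrite (_ : (n + (2 * Q).-1 * 16 + 30 = n + 32 * Q + 14)%N); last by clear -Q2E; lia.
    move/(pord_uniq N_gt0 qC q_smooth q0 pu o1).
    (* At the origin f may vanish but f0 does not; elsewhere f is a unit and so is one of f0 and
       ka. *)
    have [P3|nP] := boolP [&& ~~ c, x0 == 0 & y0' == 0].
      have o0 : ordat x0 y0' p (cc 12 c 14 (em f0)) 0.
        case/and3P: P3 => c0 /eqP x00 /eqP y00.
        apply: (ord_unit (chart_monic N_gt0 qC c) (chart_gt1 N_gt0 qC c)) => //.
        by clear -c0 x00 y00 f00; case: c c0 => // _; rewrite /cc cl_id x00 y00.
      rewrite (pord_uniq N_gt0 qC q_smooth q0 pu om o0) addn0 => ->.
      by rewrite leq_addr.
    case: (coprime_ord q0 pu) => o0.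
      rewrite (pord_uniq N_gt0 qC q_smooth q0 pu om o0) addn0 => ->.
      by rewrite leq_addr.
    have := pordM N_gt0 qC q0 (em_gr fd) (gkX (2 * Q).-1 (em_gr kad)) ob (pordX N_gt0 qC q0 (2 * Q).-1 (em_gr kad) ow).
    rewrite -emX -emM => /(pord_uniq N_gt0 qC q_smooth q0 pu ol) ->.
    rewrite (pord_uniq N_gt0 qC q_smooth q0 pu ow o0) muln0 addn0.
    by rewrite (pord_uniq N_gt0 qC q_smooth q0 pu ob (total_contact_unit N_gt0 qC fT q0 pu nP)).
  rewrite (_ : (_ - _ = 16)%N) in td; last by clear -Q2E; lia.
  by have [t0 t0d t0E] := em_descend (nzM f_neq0 (nzX (2 * Q).-1 ka_neq0)) tE td; exists t0.
exists s, t; split=> //.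
apply: (canc (nzM f_neq0 (nzX (2 * Q).-1 ka_neq0))).
have -> : r = ka * s - (ka * s - r) by ring.
by rewrite mulrBr -yE tE; ring.
Qed.

End ModThree.

(** * Integer certificates *)

From mathcomp Require Import ssrZ.

Section ListPolynomials.

Variables (T : Type) (z0 : T) (addT mulT : T -> T -> T).

Fixpoint ladd (a b : seq T) : seq T :=
  match a, b with
  | x :: a', y :: b' => addT x y :: ladd a' b'
  | [::], _ => b
  | _, [::] => a
  end.

Fixpoint lmul (a b : seq T) : seq T :=
  if a is x :: a' then ladd (map (mulT x) b) (z0 :: lmul a' b) else [::].

Fixpoint lder (a : seq T) : seq T :=
  if a is x :: a' then ladd (z0 :: lder a') a' else [::].

Variables (R : comNzRingType) (den : T -> R).
Hypotheses (den0 : den z0 = 0) (denD : forall x y, den (addT x y) = den x + den y).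

Definition pden (a : seq T) : {poly R} := foldr (fun x p => p * 'X + (den x)%:P) 0 a.

Lemma coef_pden a i : (pden a)`_i = den (nth z0 a i).
Proof.
elim: a i => [|x a IH] [|i] /=; rewrite ?coef0 ?nth_nil ?den0 //.
  by rewrite coefD coefMX coefC add0r.
by rewrite coefD coefMX coefC /= addr0 IH.
Qed.

Lemma size_pden a : (size (pden a) <= size a)%N.
Proof. by apply/leq_sizeP => i le_i; rewrite coef_pden nth_default. Qed.

Lemma pdenD a b : pden (ladd a b) = pden a + pden b.
Proof.
elim: a b => [|x a IH] [|y b] /=; rewrite ?add0r ?addr0 // IH denD polyCD.
ring.
Qed.

Lemma pdenM (denM : forall x y, den (mulT x y) = den x * den y) a b :
  pden (lmul a b) = pden a * pden b.
Proof.
have scale x : pden (map (mulT x) b) = (den x)%:P * pden b.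
  elim: b => [|y b IH] /=; first by rewrite mulr0.
  by rewrite IH denM polyCM; ring.
elim: a => [|x a IH] /=; first by rewrite mul0r.
by rewrite pdenD scale /= IH den0 polyC0; ring.
Qed.

Lemma pden_der a : pden (lder a) = (pden a)^`().
Proof.
elim: a => [|x a IH]; first by rewrite /= deriv0.
rewrite (_ : lder (x :: a) = ladd (z0 :: lder a) a) // pdenD /= IH den0 polyC0 addr0.
by rewrite derivMXaddC addrC.
Qed.

End ListPolynomials.

Notation zadd := (ladd Z.add).
Notation zmul := (lmul Z0 Z.add Z.mul).
Notation badd := (ladd zadd).
Notation bmul := (lmul [::] zadd zmul).
Notation bscale c := (map (map (Z.mul c))).
Notation bdy := (lder [::] zadd).
Notation bdx := (map (lder Z0 Z.add)).

Section Denotation.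

Variable R : comNzRingType.

(** Reading binary integers in an arbitrary ring lets one computation on lists serve over Z, over
    F_3 and over algebraically closed fields. *)
Definition zden (z : Z) : R := (int_of_Z z)%:~R.

Lemma zden0 : zden Z0 = 0. Proof. by []. Qed.
Lemma zdenD x y : zden (Z.add x y) = zden x + zden y.
Proof. by rewrite /zden -intrD -rmorphD. Qed.
Lemma zdenM x y : zden (Z.mul x y) = zden x * zden y.
Proof. by rewrite /zden -intrM -rmorphM. Qed.

Definition uden := pden zden.
Definition bden := pden uden.

Lemma uden0 : uden [::] = 0. Proof. by []. Qed.
Definition udenD := pdenD zdenD.
Definition udenM := pdenM zden0 zdenD zdenM.

Lemma bdenD a b : bden (badd a b) = bden a + bden b.
Proof. exact: (pdenD udenD). Qed.
Lemma bdenM a b : bden (bmul a b) = bden a * bden b.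
Proof. exact: (pdenM uden0 udenD udenM). Qed.
Lemma bden_dy a : bden (bdy a) = (bden a)^`().
Proof. exact: (pden_der uden0 udenD). Qed.

Lemma coef_bden a i j : (bden a)`_j`_i = zden (nth Z0 (nth [::] a j) i).
Proof. by rewrite (coef_pden uden0) (coef_pden zden0). Qed.

Lemma bden_dx a : bden (bdx a) = dX (bden a).
Proof.
apply/polyP => j; rewrite coef_dX !(coef_pden uden0).
by elim: a j => [|x a IH] [|j] //=; rewrite ?deriv0 // /uden (pden_der zden0 zdenD).
Qed.

Lemma bden_scale c a : bden (bscale c a) = (zden c)%:P%:P * bden a.
Proof.
apply: poly2P => i j; rewrite !coefCM !coef_bden.
elim: a j => [|x a IH] [|j] //=; rewrite ?nth_nil ?zden0 ?mulr0 //.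
by elim: x i {IH} => [|y x IHx] [|i] //=; rewrite ?zden0 ?mulr0 // zdenM.
Qed.

Definition bzero (m : Z) : seq (seq Z) -> bool := all (all (fun z => Z.eqb (Z.modulo z m) Z0)).

Lemma bzero_div m a : ~~ Z.eqb m Z0 -> bzero m a ->
  bden a = (zden m)%:P%:P * bden (map (map (fun z => Z.div z m)) a).
Proof.
move=> /Z.eqb_spec m0 az; rewrite -bden_scale; congr bden.
elim: a az => [//|x a IH] /= /andP[xz /IH <-]; congr (_ :: _).
elim: x xz => [//|z x IHx] /= /andP[/Z.eqb_spec zz /IHx <-]; congr (_ :: _).
by rewrite {1}(Zdiv.Z_div_mod_eq_full z m) zz; lia.
Qed.

Lemma bden_eq0 m a : ~~ Z.eqb m Z0 -> zden m = 0 -> bzero m a -> bden a = 0.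
Proof. by move=> m0 m0' /(bzero_div m0)->; rewrite m0' polyC0 mul0r. Qed.

Lemma bden_x0 m a y : ~~ Z.eqb m Z0 -> zden m = 0 ->
  all (fun r => Z.eqb (Z.modulo (head Z0 r) m) Z0) a -> ev2 0 y (bden a) = 0.
Proof.
move=> /Z.eqb_spec m0 m0' az; rewrite ev2E (_ : map_poly _ _ = 0) ?horner0 //.
apply/polyP => j; rewrite coef_map coef0 /= /horner_eval horner_coef0 coef_bden.
elim: a j az => [|r a IH] [|j] //= /andP[rz az]; last exact: IH.
move: rz; rewrite nth0 => /Z.eqb_spec rz.
by rewrite (Zdiv.Z_div_mod_eq_full (head Z0 r) m) rz zdenD zdenM m0' mul0r add0r.
Qed.

Definition btdeg d (a : seq (seq Z)) : bool :=
  all (fun j => all (Z.eqb Z0) (drop (d.+1 - j) (nth [::] a j))) (iota 0 (size a)).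

Lemma bden_tdeg d a : btdeg d a -> tdeg_le d (bden a).
Proof.
move=> /allP ad; apply: tdeg_leE => i j lt_d; rewrite coef_bden.
have [lt_j|le_j] := ltnP j (size a); last by rewrite (nth_default [::]) // nth_nil.
have /ad/(all_nthP Z0) : j \in iota 0 (size a) by rewrite mem_iota.
have [lt_i|le_i] := ltnP i (size (nth [::] a j)); last by move=> _; rewrite nth_default.
move=> /(_ (i - (d.+1 - j))%N); rewrite nth_drop size_drop subnKC; last by lia.
by rewrite ltn_sub2r ?(leq_ltn_trans _ lt_i) //; [move=> /(_ isT)/Z.eqb_spec <-|lia].
Qed.

Definition bshift i j (a : seq (seq Z)) := nseq j [::] ++ map (cat (nseq i Z0)) a.

Lemma bden_shift i j a : bden (bshift i j a) = 'X^i%:P * 'X^j * bden a.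
Proof.
rewrite /bshift; elim: j => [|j IH] /=; last by rewrite -/bden IH ?uden0 polyC0 addr0 exprS; ring.
rewrite expr0 mulr1; elim: a => [|r a IH] /=; first by rewrite mulr0.
have -> : uden (nseq i Z0 ++ r) = 'X^i * uden r.
  elim: i {IH} => [|i IHi] /=; first by rewrite expr0 mul1r.
  by rewrite -/uden IHi zden0 polyC0 addr0 exprS; ring.
by rewrite -/bden IH polyCM; ring.
Qed.

Fixpoint zdot (l a : seq Z) : Z :=
  match l, a with
  | c :: l', x :: a' => Z.add (Z.mul c x) (zdot l' a')
  | _, _ => Z0
  end.

Lemma zdotP l a : zden (zdot l a) = \sum_(i < size l) zden (nth Z0 l i) * zden (nth Z0 a i).
Proof.
elim: l a => [|c l IH] [|x a] /=; rewrite ?big_ord0 //.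
  by rewrite big1 // => i _; rewrite [nth Z0 [::] _]nth_nil zden0 mulr0.
by rewrite big_ord_recl /= zdenD zdenM IH.
Qed.

Fixpoint bdot (l a : seq (seq Z)) : Z :=
  match l, a with
  | c :: l', x :: a' => Z.add (zdot c x) (bdot l' a')
  | _, _ => Z0
  end.

Definition blam (l : seq (seq Z)) (f : {poly {poly R}}) : R :=
  \sum_(j < size l) \sum_(i < size (nth [::] l j)) zden (nth Z0 (nth [::] l j) i) * f`_j`_i.

Lemma blamD l f g : blam l (f + g) = blam l f + blam l g.
Proof.
rewrite /blam -big_split; apply: eq_bigr => j _; rewrite -big_split; apply: eq_bigr => i _.
by rewrite !coefD mulrDr.
Qed.

Lemma blamZ l c f : blam l (c%:P%:P * f) = c * blam l f.
Proof.
rewrite /blam mulr_sumr; apply: eq_bigr => j _; rewrite mulr_sumr; apply: eq_bigr => i _.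
by rewrite !coefCM mulrCA.
Qed.

Lemma blam_bden l a : blam l (bden a) = zden (bdot l a).
Proof.
rewrite /blam; under eq_bigr => j _ do under eq_bigr => i _ do rewrite coef_bden.
elim: l a => [|c l IH] [|x a] /=; rewrite ?big_ord0 //.
  rewrite big1 // => j _; rewrite big1 // => i _.
  by rewrite [nth [::] [::] _]nth_nil [nth Z0 [::] _]nth_nil zden0 mulr0.
by rewrite big_ord_recl /= zdenD -IH zdotP.
Qed.

Lemma tdeg_functional (F : {poly {poly R}} -> R) d f :
    (forall f g, F (f + g) = F f + F g) -> (forall c f, F (c%:P%:P * f) = c * F f) ->
    tdeg_le d f ->
  F f = \sum_(j < d.+1) \sum_(i < d.+1 | (i + j <= d)%N) f`_j`_i * F ('X^i%:P * 'X^j).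
Proof.
move=> FD FZ fd; have F0 : F 0 = 0.
  by rewrite -[X in F X](mul0r (0%:P)) -polyC0 -polyC0 FZ mul0r.
rewrite {1}(tdeg_mono_sum fd) (big_morph F FD F0); apply: eq_bigr => j _.
rewrite (big_morph F FD F0); apply: eq_bigr => i _.
by rewrite -mul_polyC polyCM -mulrA FZ.
Qed.

End Denotation.

Lemma bden_map (R S : comNzRingType) (phi : {rmorphism R -> S}) a :
  map_poly (map_poly phi) (bden R a) = bden S a.
Proof.
by apply: poly2P => i j; rewrite coef_map /= coef_map /= !coef_bden /zden rmorph_int.
Qed.

Fixpoint digits (b : N) (n : nat) (z : N) : seq Z :=
  if n is n'.+1 then
    let: (t, r) := N.div_eucl z b in Z.of_N r :: digits b n' t
  else [::].

(** Row j holds the d + 1 - j coefficients of y^j, packed in base b with the lowest power of x in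
    the lowest digit. *)
Definition unpack (b : N) (d : nat) (rows : seq N) : seq (seq Z) :=
  [seq digits b (d.+1 - jr.1) jr.2 | jr <- zip (iota 0 d.+1) rows].

Definition balance (z : Z) : Z := if Z.eqb z (Zpos 2) then Zneg 1 else z.

(* Coefficients in {-1, 0, 1}: row j is written in base 3, with 2 standing for -1. *)
Definition tern (d : nat) (rows : seq N) : seq (seq Z) := map (map balance) (unpack 3 d rows).

Definition Q_rows : seq N := [:: 286437; 326644; 16485; 9985; 991; 6178; 1896; 22; 190; 22; 7; 4; 1]%num.
Definition F0_rows : seq N := [:: 719939; 1213954; 1043207; 225993; 91916; 41199; 3749; 4906; 723; 255; 107; 0; 0; 0; 0]%num.
Definition K_rows : seq N := [:: 67167739; 1244389; 13277154; 44854; 594066; 426337; 144917; 7553; 8251; 6201; 35; 3; 0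
  ; 0; 0; 0; 0]%num.
Definition G0_rows : seq N := [:: 13718; 37225; 3540; 2045; 925; 181; 160; 13; 3; 8; 1]%num.
Definition R_rows : seq N := [:: 165513011270019; 200930954215987; 17414351858387; 20096501246792; 1927965033933
  ; 2477193797703; 833261912393; 198558982483; 91436656535; 18554920649; 8052334776
  ; 2875878388; 0; 0; 0; 0; 0; 0; 0; 0; 0; 0; 0; 0; 0; 0; 0; 0; 0; 0; 0]%num.
Definition S_rows : seq N := [:: 519649585898684025; 19812820494992442; 6139281183536475; 157331894847552
  ; 109402206760488; 12704854147552; 2099728239316; 165709055237; 26230299629; 2890224348
  ; 334918064; 41204081; 380264; 279663; 44654; 6436; 165; 40; 8]%num.
Definition lam_rows : seq N := [:: 439285790242299; 149960145953346; 54529668111748; 11425635988646; 2339303109526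
  ; 1795605450684; 6484577516; 187681523672; 17477221249; 13055930655; 934945173
  ; 864778814; 116959754; 175319319; 73332276; 35490116; 2709002; 3829790; 501138; 281258
  ; 126611; 24188; 18671; 3858; 714; 685; 129; 51; 13; 6; 2]%num.
Definition smx0_rows : seq N := [:: 1526147001; 807334392; 283975209; 50553514; 28775368; 7588159; 692162; 1250819; 475140
  ; 6982; 243; 0; 0; 0; 0; 0; 0; 0; 0; 0]%num.
Definition smx1_rows : seq N := [:: 5074682496; 1666883414; 1140430184; 159363206; 120762069; 33328432; 3698697; 2960003
  ; 1566575; 286903; 14684; 486; 0; 0; 0; 0; 0; 0; 0; 0; 0]%num.
Definition smx2_rows : seq N := [:: 8727135816; 2695692073; 916057566; 139610654; 65827044; 41934497; 7657055; 578; 0; 0; 0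
  ; 0; 0; 0; 0; 0; 0; 0; 0; 0; 0]%num.
Definition smx3_rows : seq N := [:: 6973568802; 0; 0; 0; 0; 0; 0; 0; 0; 0; 0; 0; 0; 0; 0; 0; 0; 0; 0; 0; 0]%num.
Definition smy0_rows : seq N := [:: 3109791307; 314180521; 23732449; 78807162; 17963618; 12165314; 3197349; 791381; 34825
  ; 17164; 45167; 18241; 1657; 2161; 48; 198; 78; 9; 8; 1]%num.
Definition smy1_rows : seq N := [:: 5329849727; 544873866; 844321726; 267887409; 81545335; 33990041; 2262115; 2304096
  ; 453809; 333899; 73403; 51349; 0; 0; 0; 0; 0; 0; 0; 0; 0]%num.
Definition smy2_rows : seq N := [:: 10154796907; 295283128; 124810311; 191794949; 96229051; 21188404; 6937014; 332; 0; 0; 0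
  ; 0; 0; 0; 0; 0; 0; 0; 0; 0; 0]%num.
Definition smy3_rows : seq N := [:: 3486784401; 0; 0; 0; 0; 0; 0; 0; 0; 0; 0; 0; 0; 0; 0; 0; 0; 0; 0; 0; 0]%num.
Definition smz0_rows : seq N := [:: 2312188835; 1093109810; 303877566; 102129097; 10707727; 9366260; 2489383; 964891
  ; 213096; 128997; 17511; 0; 0; 0; 0; 0; 0; 0; 0; 0]%num.
Definition smz1_rows : seq N := [:: 1359207313; 1852503246; 672589568; 347273134; 13206231; 14425553; 3366001; 3211764
  ; 1014200; 132879; 95127; 8769; 0; 0; 0; 0; 0; 0; 0; 0; 0]%num.
Definition smz2_rows : seq N := [:: 6952097829; 2270795408; 1018409487; 124739638; 117322391; 41280029; 392785; 19; 0; 0; 0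
  ; 0; 0; 0; 0; 0; 0; 0; 0; 0; 0]%num.
Definition smz3_rows : seq N := [:: 6973568802; 0; 0; 0; 0; 0; 0; 0; 0; 0; 0; 0; 0; 0; 0; 0; 0; 0; 0; 0; 0]%num.
Definition cpx0_rows : seq N := [:: 692577802482; 1116107286951; 206813136465; 204475818016; 16825826716; 23819940330
  ; 8048257465; 2937607022; 827153906; 168291069; 1220277; 0; 0; 0; 0; 0; 0; 0; 0; 0; 0; 0
  ; 0; 0; 0; 0; 0]%num.
Definition cpx1_rows : seq N := [:: 396884683503; 274907789041; 911038465; 12681985875; 616169964; 2025634994; 198389561
  ; 55391609; 124392404; 15296389; 0; 0; 0; 0; 0; 0; 0; 0; 0; 0; 0; 0; 0; 0; 0]%num.
Definition cpx2_rows : seq N := [:: 43665833113541; 11042358695878; 1979746490968; 1517481580982; 4537392680; 176244711356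
  ; 91349748330; 24000581152; 0; 0; 0; 0; 0; 0; 0; 0; 0; 0; 0; 0; 0; 0; 0; 0; 0; 0; 0; 0
  ; 0]%num.
Definition cpz0_rows : seq N := [:: 4172006948250; 2416055833846; 350658626082; 165856185861; 46440830210; 16071276014
  ; 7001883577; 331692225; 616115614; 308241998; 511443; 0; 0; 0; 0; 0; 0; 0; 0; 0; 0; 0
  ; 0; 0; 0; 0; 0]%num.
Definition cpz1_rows : seq N := [:: 30303245134; 64014446300; 77695681808; 1545034543; 1602995620; 1386135887; 646559512
  ; 90712115; 124763857; 7273488; 0; 0; 0; 0; 0; 0; 0; 0; 0; 0; 0; 0; 0; 0; 0]%num.
Definition cpz2_rows : seq N := [:: 16374178913716; 6897583590400; 1350798085916; 1423539191084; 768308195979; 248101530654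
  ; 84675083016; 20902685378; 0; 0; 0; 0; 0; 0; 0; 0; 0; 0; 0; 0; 0; 0; 0; 0; 0; 0; 0; 0
  ; 0]%num.
Definition hw_rows : seq N := [:: 115899079716473496356052573; 55480132973674903056419968; 187194533696540673983151
  ; 164292439943122482529399891; 60753170687235211758612016; 127821386917633501317886131
  ; 165399964772622069702605932; 74173383548714021214093420; 159203696269593060013457103
  ; 9331469364039978050615907; 36429484698747593464276905; 92788429077215613502215753
  ; 51343165018491546778250708; 77656823226961431455124762; 31703792461884628209060401
  ; 127829476322668457881545815; 24042926391798709373511325; 42888736222569148196447787
  ; 27581258247224986556518936; 163096210521471881859875409; 156916837114514609467533573
  ; 18688445116369360998073714; 139477324969131849309446042; 138548531583460931516848889
  ; 102135970181487563125796619; 41254767954394888319565489; 14840935767642960769163898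
  ; 87397918934392624625565168; 147027197342616147730565963; 71361329863293377600505714
  ; 71193693244727338363643461; 101969931252081328332570965; 77474761245947351726824107
  ; 17030415359271828063630222; 73437297096669874047589048; 125070868154734946712441347
  ; 143025792536226366911827947; 64003357205352044492111218; 90591766509075614436957114
  ; 29846587331039690910965032; 39630189796351304067253751; 60396732468969284298655084
  ; 15553550064948510747339749; 127825514044231504367320253; 3630385169078835271310264
  ; 14595353276839136020986638; 133926696328561409374731091; 172969486093375306374071252
  ; 87366696078733626679623510; 53457551324180099081635832; 140461615384938811504130381
  ; 165436056514106657332137063; 146640768110337151541539787; 172163331021463735225573607
  ; 91220743142554032191270136]%num.
Definition beta_cert : N * N := (6085, 6922)%num.
Arguments bden : simpl never.
Arguments uden : simpl never.

Definition Ql := Eval vm_compute in tern 12 Q_rows.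
(* F0 K = G0^3 + 3 R + S Q modulo 9: the reduction modulo 3 carries a 3-torsion class, and [lam]
   kills the degree 30 part of (F0, K, Q) modulo 3 but not R. *)
Definition F0l := Eval vm_compute in tern 14 F0_rows.
Definition Kl := Eval vm_compute in tern 16 K_rows.
Definition G0l := Eval vm_compute in tern 10 G0_rows.
Definition Rl := tern 30 R_rows.
Definition Sl := unpack 9 18 S_rows.
Definition lam := tern 30 lam_rows.

Definition Qxl := Eval vm_compute in bdx Ql.
Definition Qyl := Eval vm_compute in bdy Ql.
(** By Euler's relation this is the partial derivative in z of the homogenized equation, at z =
    1. *)
Definition Qzl := Eval vm_compute in
  badd (bscale (Zpos 12) Ql) (badd (bscale (Zneg 1) (bshift 1 0 Qxl)) (bscale (Zneg 1) (bshift 0 1 Qyl))).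
Definition bone : seq (seq Z) := [:: [:: Zpos 1]].
Definition gaml := Eval vm_compute in [seq take 1 r | r <- behead Ql].
Definition betl := Eval vm_compute in [seq behead r | r <- Ql].

Definition lincomb (cs : seq (seq (seq Z) * seq (seq Z))) : seq (seq Z) :=
  foldr (fun ab s => badd (bmul ab.1 ab.2) s) [::] cs.

Lemma bden_lincomb (R : comNzRingType) cs :
  bden R (lincomb cs) = \sum_(ab <- cs) bden R ab.1 * bden R ab.2.
Proof. by elim: cs => [|ab cs IH]; rewrite ?big_nil // big_cons /= bdenD bdenM IH. Qed.

(** Cofactors of Q and of its three partial derivatives. Modulo 3 the combinations for [smx], [smy]
    and [smz] are x^31, y^31 and z^31, the last being 1 after dehomogenization. *)
Definition smooth_cert (rs : seq N * seq N * seq N * seq N) :=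
  let: (a, b, c, d) := rs in
  [:: (tern 19 a, Ql); (tern 20 b, Qxl); (tern 20 c, Qyl); (tern 20 d, Qzl)].
(** Cofactors of F0, K and Q; the combinations for [cpx] and [cpz] are x^40 and z^40 modulo 3. *)
Definition coprime_cert (rs : seq N * seq N * seq N) :=
  let: (a, b, c) := rs in [:: (tern 26 a, F0l); (tern 24 b, Kl); (tern 28 c, Ql)].

Definition smooth_tdeg (rs : seq N * seq N * seq N * seq N) :=
  let: (a, b, c, d) := rs in
  [&& btdeg 19 (tern 19 a), btdeg 20 (tern 20 b), btdeg 20 (tern 20 c) & btdeg 20 (tern 20 d)].
Definition coprime_tdeg (rs : seq N * seq N * seq N) :=
  let: (a, b, c) := rs in
  [&& btdeg 26 (tern 26 a), btdeg 24 (tern 24 b) & btdeg 28 (tern 28 c)].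

Definition smx := (smx0_rows, smx1_rows, smx2_rows, smx3_rows).
Definition smy := (smy0_rows, smy1_rows, smy2_rows, smy3_rows).
Definition smz := (smz0_rows, smz1_rows, smz2_rows, smz3_rows).
Definition cpx := (cpx0_rows, cpx1_rows, cpx2_rows).
Definition cpz := (cpz0_rows, cpz1_rows, cpz2_rows).

Definition cert_check (i j : nat) cs :=
  bzero (Zpos 3) (badd (lincomb cs) (bscale (Zneg 1) (bshift i j bone))).

Lemma smx_check : cert_check 31 0 (smooth_cert smx). Proof. by vm_compute. Qed.
Lemma smy_check : cert_check 0 31 (smooth_cert smy). Proof. by vm_compute. Qed.
Lemma smz_check : cert_check 0 0 (smooth_cert smz). Proof. by vm_compute. Qed.
Lemma cpx_check : cert_check 40 0 (coprime_cert cpx). Proof. by vm_compute. Qed.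
Lemma cpz_check : cert_check 0 0 (coprime_cert cpz). Proof. by vm_compute. Qed.

Lemma smooth_tdeg_check : [&& smooth_tdeg smx, smooth_tdeg smy & smooth_tdeg smz].
Proof. by vm_compute. Qed.
Lemma coprime_tdeg_check : coprime_tdeg cpx && coprime_tdeg cpz.
Proof. by vm_compute. Qed.

Lemma rel_check : bzero (Zpos 9) (badd (bmul F0l Kl) (bscale (Zneg 1)
  (badd (bmul G0l (bmul G0l G0l)) (badd (bscale (Zpos 3) Rl) (bmul Sl Ql))))).
Proof. by vm_compute. Qed.

(** A Bezout relation modulo 3 between Q(0, y) and beta(0, y): [beta_cert] packs the two cofactors,
    which are polynomials in y. *)
Lemma beta_check : all (fun r => Z.eqb (Z.modulo (head Z0 r) (Zpos 3)) Z0)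
  (badd (bscale (Zneg 1) bone) (lincomb [:: ([seq [:: d] | d <- digits 3 8 beta_cert.1], Ql);
    ([seq [:: d] | d <- digits 3 9 beta_cert.2], betl)])).
Proof. by vm_compute. Qed.

Definition monomials (d : nat) : seq (nat * nat) :=
  flatten [seq [seq (i, j) | i <- iota 0 (d.+1 - j)] | j <- iota 0 d.+1].

Lemma mem_monomials d i j : (i + j <= d)%N -> (i, j) \in monomials d.
Proof.
move=> ijd; apply/flatten_mapP; exists j; first by rewrite mem_iota /=; lia.
by apply/mapP; exists i => //; rewrite mem_iota /=; lia.
Qed.

Definition lam_kills d a :=
  all (fun m => Z.eqb (Z.modulo (bdot lam (bshift m.1 m.2 a)) (Zpos 3)) Z0) (monomials d).

Lemma lam_check : [&& lam_kills 16 F0l, lam_kills 14 Kl, lam_kills 18 Ql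
  & ~~ Z.eqb (Z.modulo (bdot lam Rl) (Zpos 3)) Z0].
Proof. by vm_compute. Qed.

Definition Q2l := Eval vm_compute in bmul Ql Ql.

Definition hw_vector (k l : nat) : seq Z :=
  let s := bshift k l Q2l in
  [seq Z.sub (nth Z0 (nth [::] s (3 * m.2 + 2)%N) (3 * m.1 + 2)%N)
     (if m == (k, l) then Zpos 1 else Z0) | m <- monomials 9].

(** The 55 packed rows form a left inverse modulo 3 of the Hasse-Witt matrix minus the identity, on
    the 55 monomials of degree at most 9; their number is the genus. *)
Lemma hw_check : let vs := [seq (m, hw_vector m.1 m.2) | m <- monomials 9] in
  all (fun nr => all (fun mv => Z.eqb (Z.modulo (Z.sub (zdot nr.2 mv.2)
      (if mv.1 == nr.1 then Zpos 1 else Z0)) (Zpos 3)) Z0) vs)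
   (zip (monomials 9) [seq digits 3 55 n | n <- hw_rows]).
Proof. by vm_compute. Qed.

Section CurveFacts.

Variable R : comNzRingType.

Lemma size_bden a : (size (bden R a) <= size a)%N.
Proof. exact: (size_pden (uden0 R)). Qed.

Lemma Q_lead : (bden R Ql)`_12 = 1.
Proof.
by rewrite /bden (coef_pden (uden0 R)) [nth _ _ _]/= /uden [pden _ _]/= mul0r add0r /zden rmorph1.
Qed.

Lemma Q_size : size (bden R Ql) = 13.
Proof.
apply/eqP; rewrite eqn_leq (size_bden Ql) /= ltnNge; apply/negP => le.
by have := oner_neq0 {poly R}; rewrite -Q_lead nth_default ?eqxx.
Qed.

Lemma Q_monic : bden R Ql \is monic.
Proof. by apply/monicP; rewrite /lead_coef Q_size Q_lead. Qed.

Lemma Q_tdeg : tdeg_le 12 (bden R Ql).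
Proof. exact: bden_tdeg. Qed.

Lemma Qx_E : bden R Qxl = dX (bden R Ql).
Proof. by rewrite -bden_dx; congr (bden R _); vm_compute; reflexivity. Qed.

Lemma Qy_E : bden R Qyl = (bden R Ql)^`().
Proof. by rewrite -bden_dy; congr (bden R _); vm_compute; reflexivity. Qed.

Lemma zdenZ (n : nat) : zden R (Z.of_nat n) = n%:R.
Proof. by rewrite /zden (Z_of_intK (Posz n) : int_of_Z (Z.of_nat n) = _) -pmulrn. Qed.

Lemma zden3 : zden R (Zpos 3) = 3%:R. Proof. exact: (zdenZ 3). Qed.
Lemma zdenN1 : zden R (Zneg 1) = -1. Proof. by rewrite /zden rmorphN1. Qed.

Lemma bden_one i j : bden R (bshift i j bone) = 'X^i%:P * 'X^j.
Proof.
by rewrite bden_shift /bone /bden /uden ![pden _ _]/= /zden rmorph1 !mul0r !add0r !polyC1 mulr1.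
Qed.

Lemma Qz_E : bden R Qzl = bden R Ql *+ 12 - 'X%:P * dX (bden R Ql) - 'X * (bden R Ql)^`().
Proof.
have -> : Qzl = badd (bscale (Zpos 12) Ql) (badd (bscale (Zneg 1) (bshift 1 0 Qxl)) (bscale (Zneg 1) (bshift 0 1 Qyl))).
  by vm_compute.
rewrite !bdenD !bden_scale !bden_shift Qx_E Qy_E zdenN1 (zdenZ 12) expr0 polyC1 !polyCN !polyC1.
by rewrite !polyC_natr -mulr_natl; ring.
Qed.

Lemma Q_gam_bet : bden R Ql = 'X * bden R gaml + 'X%:P * bden R betl.
Proof.
have -> : 'X * bden R gaml + 'X%:P * bden R betl = bden R (badd (bshift 0 1 gaml) (bshift 1 0 betl)).
  by rewrite bdenD !bden_shift expr0 polyC1 mul1r expr0 mulr1.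
by congr (bden R _); vm_compute; reflexivity.
Qed.

Lemma ev2_00 a : ev2 0 0 (bden R a) = zden R (nth Z0 (nth [::] a 0) 0).
Proof. by rewrite /ev2 polyC0 (horner_coef0 (bden R a)) horner_coef0 coef_bden. Qed.

Lemma cert_char3 i j cs : 3%:R = 0 :> R -> cert_check i j cs ->
  \sum_(ab <- cs) bden R ab.1 * bden R ab.2 = 'X^i%:P * 'X^j.
Proof.
move=> char3 chk; apply/eqP; rewrite -subr_eq0 -bden_lincomb -bden_one; apply/eqP.
have := bden_eq0 (R := R) (m := Zpos 3) (a := badd (lincomb cs) (bscale (Zneg 1) (bshift i j bone))).
by rewrite bdenD bden_scale zdenN1 !polyCN !polyC1 mulN1r zden3 => ->.
Qed.

End CurveFacts.

Lemma ev2M (R : comNzRingType) (x y : R) f g : ev2 x y (f * g) = ev2 x y f * ev2 x y g.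
Proof. exact: (rmorphM (ev2 x y)). Qed.
Lemma ev2B (R : comNzRingType) (x y : R) f g : ev2 x y (f - g) = ev2 x y f - ev2 x y g.
Proof. by rewrite /ev2 !hornerE. Qed.
Lemma ev2Mn (R : comNzRingType) (x y : R) f n : ev2 x y (f *+ n) = ev2 x y f *+ n.
Proof.
by rewrite /ev2 !hornerMn.
Qed.

Section ChartEvaluation.

Variables (k : closedFieldType) (c : bool) (x y : k).

Definition evc (d : nat) (f : {poly {poly k}}) : k := ev2 x y (chart c d f).

Lemma evcD d f g : evc d (f + g) = evc d f + evc d g.
Proof. by rewrite /evc chartD rmorphD. Qed.

Lemma evcM d e f g : tdeg_le d f -> tdeg_le e g -> evc (d + e) (f * g) = evc d f * evc e g.
Proof. by move=> fd ge; rewrite /evc chartM // rmorphM. Qed.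

Lemma evcZ d (a : k) f : evc d (a%:P%:P * f) = a * evc d f.
Proof.
rewrite /evc; case: c => /=; last by rewrite rmorphM /= ev2C hornerC.
have -> : flip d (a%:P%:P * f) = a%:P%:P * flip d f.
  by apply: poly2P => i j; rewrite !coefCM !coef_flip !coefCM; case: ifP; rewrite ?mulr0.
by rewrite rmorphM /= ev2C hornerC.
Qed.

Lemma evc_mono d i j : (i + j <= d)%N ->
  evc d ('X^i%:P * 'X^j) = if c then x ^+ (d - i - j) * y ^+ j else x ^+ i * y ^+ j.
Proof.
move=> ijd; rewrite /evc; case: c => /=; last first.
  by rewrite rmorphM /= ev2C hornerXn (rmorphXn (ev2 x y)) /= ev2X.
have := flip_mono (1 : k) ijd; rewrite !scale1r => ->.
by rewrite rmorphM /= ev2C hornerXn (rmorphXn (ev2 x y)) /= ev2X.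
Qed.

Definition singular (q : {poly {poly k}}) := [/\ ev2 x y (chart c 12 q) = 0,
  ev2 x y (dX (chart c 12 q)) = 0 & ev2 x y (chart c 12 q)^`() = 0].

Lemma evcME d e n f g : n = (d + e)%N -> tdeg_le d f -> tdeg_le e g ->
  evc n (f * g) = evc d f * evc e g.
Proof. by move=> ->; apply: evcM. Qed.

(** In the chart [true] the affine partial derivatives give Q_y and Q_z, and Euler's relation
    supplies Q_x; in the chart [false] it supplies Q_z. *)
Lemma singular_forms (q qx qy qz : {poly {poly k}}) :
    tdeg_le 12 q -> tdeg_le 11 qx -> tdeg_le 11 qy -> tdeg_le 11 qz ->
    qx = dX q -> qy = q^`() -> qz = q *+ 12 - 'X%:P * dX q - 'X * q^`() -> singular q ->
  [/\ evc 12 q = 0, evc 11 qx = 0, evc 11 qy = 0 & evc 11 qz = 0].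
Proof.
move=> tq tx ty tz xE yE zE; rewrite /singular /evc; case: c; rewrite /chart => -[q0 qx0 qy0]; last first.
  rewrite xE yE; split=> //; rewrite zE !ev2B ev2Mn !ev2M.
  by rewrite q0 qx0 qy0 !mulr0 mul0rn !subr0.
have y0 : ev2 x y (flip 11 qy) = 0 by rewrite yE flip_deriv.
have z0 : ev2 x y (flip 11 qz) = 0.
  have E : 'X%:P * dX (flip 12 q) = 'X%:P * flip 11 qz.
    by rewrite flip_euler // -zE (_ : 12 = 11 + 1)%N // flip_shift ?expr1.
  have X0 : 'X%:P != 0 :> {poly {poly k}} by rewrite polyC_eq0 polyX_eq0.
  by rewrite -(mulfI X0 E).
split=> //.
have E : 'X%:P * qx = q *+ 12 - 'X * qy - qz by rewrite zE xE yE; ring.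
have f1 : flip 12 ('X%:P * qx) = flip 11 qx.
  by rewrite (_ : 12 = 1 + 11)%N // flipM ?flip1_Xx ?mul1r //; exact: tdeg_leXx.
have f2 : flip 12 ('X * qy) = flip 1 'X * flip 11 qy.
  by rewrite (_ : 12 = 1 + 11)%N // flipM //; exact: tdeg_leXy.
have f3 : flip 12 qz = 'X%:P * flip 11 qz.
  by rewrite (_ : 12 = 11 + 1)%N // flip_shift ?expr1.
have f4 : flip 12 (q *+ 12) = flip 12 q *+ 12.
  by apply: poly2P => i j; rewrite !(coefMn, coef_flip); case: ifP; rewrite ?mul0rn.
rewrite -f1 E !flipB f2 f3 f4 !ev2B ev2Mn !ev2M.
by rewrite q0 y0 z0 !mulr0 mul0rn !subr0.
Qed.

Let q := bden k Ql.

Lemma Qz_tdeg : tdeg_le 11 (bden k Qzl). Proof. exact: bden_tdeg. Qed.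
Lemma Qx_tdeg : tdeg_le 11 (bden k Qxl). Proof. exact: bden_tdeg. Qed.
Lemma Qy_tdeg : tdeg_le 11 (bden k Qyl). Proof. exact: bden_tdeg. Qed.

Lemma singular_eval : singular q ->
  [/\ evc 12 q = 0, evc 11 (bden k Qxl) = 0, evc 11 (bden k Qyl) = 0 & evc 11 (bden k Qzl) = 0].
Proof.
exact: (singular_forms (Q_tdeg k) Qx_tdeg Qy_tdeg Qz_tdeg (Qx_E k) (Qy_E k) (Qz_E k)).
Qed.

Lemma smooth_cert_eval rs : singular q -> smooth_tdeg rs -> evc 31 (\sum_(ab <- smooth_cert rs) bden k ab.1 * bden k ab.2) = 0.
Proof.
case: rs => [[[a b] d] e] /singular_eval[q0 qx qy qz].
move=> /and4P[/(bden_tdeg k) ta /(bden_tdeg k) tb /(bden_tdeg k) td /(bden_tdeg k) te].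
rewrite /smooth_cert !big_cons big_nil addr0 !evcD.
rewrite (@evcME 19 12) //; last exact: Q_tdeg.
rewrite (@evcME 20 11) //; last exact: Qx_tdeg.
rewrite (@evcME 20 11) //; last exact: Qy_tdeg.
rewrite (@evcME 20 11) //; last exact: Qz_tdeg.
by rewrite q0 qx qy qz !mulr0 !addr0.
Qed.

End ChartEvaluation.

Lemma smooth_from_singular (k : closedFieldType) c :
  (forall x y : k, ~ singular c x y (bden k Ql)) -> smooth (chart c 12 (bden k Ql)).
Proof.
move=> ns x y q0; have [qx|qx] := eqVneq (ev2 x y (dX (chart c 12 (bden k Ql)))) 0; last by left.
have [qy|qy] := eqVneq (ev2 x y (chart c 12 (bden k Ql))^`()) 0; last by right.
by case: (ns x y).
Qed.

(** In each chart one coordinate is 1, so at a singular point the certificate for its 31st power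
    reads 1 = 0. *)
Lemma smooth_char3 (k : closedFieldType) c : 3%:R = 0 :> k -> smooth (chart c 12 (bden k Ql)).
Proof.
move=> char3; apply: smooth_from_singular => x y sg.
have /and3P[tx _ tz] := smooth_tdeg_check.
case: c sg => sg.
  have := smooth_cert_eval sg tx.
  rewrite (cert_char3 char3 smx_check) evc_mono // (_ : (31 - 31 - 0)%N = 0%N) // !expr0 mulr1.
  by move/eqP; rewrite oner_eq0.
have := smooth_cert_eval sg tz.
rewrite (cert_char3 char3 smz_check) evc_mono // !expr0 mulr1.
by move/eqP; rewrite oner_eq0.
Qed.

(** Nakayama's lemma for the ideal (3): the determinant of 1 - 3 B is 1 modulo 3, hence a nonzero
    integer, so the linear system has only the zero solution. *)
Lemma nakayama3 (F : numFieldType) (I : finType) (mu : I -> F) (B : I -> I -> int) :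
  (forall i, mu i = 3%:R * \sum_j (B i j)%:~R * mu j) -> forall i, mu i = 0.
Proof.
move=> muE; pose n := #|I|.
pose M : 'M[int]_n := 1%:M - 3%:R *: \matrix_(i, j) B (enum_val j) (enum_val i).
pose v : 'rV[F]_n := \row_j mu (enum_val j).
have vM : v *m map_mx intr M = 0.
  apply/rowP => j; rewrite !mxE (bigD1 j) //= !mxE eqxx.
  have -> : \sum_(i | i != j) v 0 i * map_mx intr M i j =
      - \sum_(i | i != j) 3%:R * ((B (enum_val j) (enum_val i))%:~R * mu (enum_val i)).
    rewrite -sumrN; apply: eq_bigr => i ij; rewrite !mxE (negbTE ij) sub0r.
    by rewrite rmorphN rmorphM /= mulrN mulrCA [_ * mu _]mulrC mulrA.
  have E := muE (enum_val j).
  rewrite (reindex (@enum_val I I)) /= in E; last exact: onW_bij (enum_val_bij I).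
  rewrite (bigD1 j) //= mulrDr mulr_sumr in E.
  rewrite rmorphB rmorphM /= mulrBr mulr1 {1}E; ring.
have d0 : \det (map_mx intr M : 'M[F]_n) != 0.
  rewrite det_map_mx intr_eq0; apply/eqP => /(congr1 (intr : int -> 'F_3)).
  rewrite -det_map_mx rmorphB /= map_mx1 map_mxZ.
  rewrite [X in _ - X *: _](_ : _ = 0); last exact/eqP.
  by rewrite scale0r subr0 det1 rmorph0 => /eqP; rewrite oner_eq0.
have v0 : v = 0.
  have : v *m map_mx intr M *m \adj (map_mx intr M) = 0 by rewrite vM mul0mx.
  rewrite -mulmxA mul_mx_adj mul_mx_scalar => /eqP; rewrite scaler_eq0 (negbTE d0) => /eqP.
  exact.
by move=> i; have /rowP/(_ (enum_rank i)) := v0; rewrite !mxE enum_rankK.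
Qed.

Lemma smooth_lincomb_tdeg (R : comNzRingType) rs : smooth_tdeg rs ->
  tdeg_le 31 (bden R (lincomb (smooth_cert rs))).
Proof.
case: rs => [[[a b] d] e] /and4P[/(bden_tdeg R) ta /(bden_tdeg R) tb /(bden_tdeg R) td /(bden_tdeg R) te].
have tx : tdeg_le 11 (bden R Qxl) by exact: bden_tdeg.
have ty : tdeg_le 11 (bden R Qyl) by exact: bden_tdeg.
have tz : tdeg_le 11 (bden R Qzl) by exact: bden_tdeg.
rewrite bden_lincomb /smooth_cert !big_cons big_nil addr0.
apply: tdeg_leD; first exact: (tdeg_leM ta (Q_tdeg R)).
apply: tdeg_leD; first exact: (tdeg_leM tb tx).
by apply: tdeg_leD; [exact: (tdeg_leM td ty)|exact: (tdeg_leM te tz)].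
Qed.

Section CharZero.

Variables (k : closedFieldType) (c : bool) (x y : k).
Hypothesis char0 : forall B : 'I_92 * 'I_92 -> 'I_92 * 'I_92 -> int,
  forall mu : 'I_92 * 'I_92 -> k,
  (forall i, mu i = 3%:R * \sum_j (B i j)%:~R * mu j) -> forall i, mu i = 0.
Hypothesis three_neq0 : 3%:R != 0 :> k.

Notation ev := (evc c x y).

Hypothesis sg : singular c x y (bden k Ql).

(** Over the integers the certificate has an error divisible by 3. At a singular point the
    combination itself vanishes and only the error remains. *)
Lemma char0_cert i j rs : cert_check i j (smooth_cert rs) -> smooth_tdeg rs -> (i + j <= 31)%N ->
  exists2 e, tdeg_le 31 (bden k e) & ev 31 ('X^i%:P * 'X^j) = 3%:R * ev 31 (bden k e).
Proof.
move=> chk td ij; have := smooth_cert_eval sg td; rewrite -bden_lincomb => E.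
have := bzero_div k (m := Zpos 3) isT chk.
rewrite bdenD bden_scale bden_one zdenN1 !polyCN !polyC1 mulN1r zden3.
set e := map _ _ => dE; exists (bscale (Zneg 1) e).
  rewrite bden_scale zdenN1 !polyCN !polyC1 mulN1r; apply: tdeg_leN.
  apply: tdeg_leE => i' j' lt31; apply: (mulfI three_neq0); rewrite mulr0 -!coefCM -dE.
  apply: (tdeg_le_coef _ lt31); apply: tdeg_leB; first exact: smooth_lincomb_tdeg.
  apply: (tdeg_leW ij); apply: tdeg_leM; first by apply: tdeg_leC; rewrite size_polyXn.
  by rewrite -[j in tdeg_le j]muln1; apply: tdeg_leX; apply: tdeg_leXy.
have -> : 'X^i%:P * 'X^j = bden k (lincomb (smooth_cert rs)) - 3%:R%:P%:P * bden k e.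
  by rewrite -dE opprB addrC subrK.
rewrite bden_scale zdenN1 evcD E add0r !polyCN !polyC1 mulN1r.
have evN f : ev 31 (- f) = - ev 31 f.
  by rewrite -mulN1r -[-1](polyCN 1) -polyCN evcZ mulN1r.
by rewrite !evN evcZ mulrN.
Qed.

(** The degree 91 = 3 * 30 + 1 is the first in which every monomial in x, y, z has an exponent of at
    least 31. *)
Let mu (s : 'I_92 * 'I_92) : k := if (s.1 + s.2 <= 91)%N then ev 91 ('X^(s.1)%:P * 'X^(s.2)) else 0.

Lemma ev_span e : tdeg_le 91 (bden k e) ->
  exists b : 'I_92 * 'I_92 -> int, ev 91 (bden k e) = \sum_s (b s)%:~R * mu s.
Proof.
move=> te; exists (fun s : 'I_92 * 'I_92 => int_of_Z (nth Z0 (nth [::] e s.2) s.1)).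
rewrite (tdeg_functional (evcD c x y 91) (evcZ c x y 91) te).
rewrite (exchange_big_dep xpredT) //= pair_big_dep /= [RHS]big_mkcond [LHS]big_mkcond /=.
apply: eq_bigr => -[i j] _; rewrite /mu /=; case: ifP => _; last by rewrite mulr0.
by rewrite coef_bden.
Qed.

(* Integral forms of degree 91 generate a module equal to 3 times itself: every monomial of
   degree 91 is divisible by x^31, y^31 or z^31, which are 3 times integral forms at a
   singular point. *)
Lemma no_singular_char0 : False.
Proof.
have step s : exists b : 'I_92 * 'I_92 -> int, mu s = 3%:R * \sum_t (b t)%:~R * mu t.
  case: s => i j; rewrite {1}/mu /=; case: (leqP (i + j) 91) => [ij|_]; last first.
    by exists (fun=> 0); rewrite big1 ?mulr0 // => t _; rewrite mul0r.
  have /and3P[tx ty tz] := smooth_tdeg_check.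
  suff [e [i' [j' [te ij' E]]]] : exists e i' j', [/\ tdeg_le 31 (bden k e), (i' + j' <= 60)%N &
      ev 91 ('X^i%:P * 'X^j) = 3%:R * (ev 31 (bden k e) * ev 60 ('X^i'%:P * 'X^j'))].
    have tm : tdeg_le 60 ('X^i'%:P * 'X^j' : {poly {poly k}}).
      apply: (tdeg_leW ij'); apply: tdeg_leM; first by apply: tdeg_leC; rewrite size_polyXn.
      by rewrite -[j' in tdeg_le j']muln1; apply: tdeg_leX; apply: tdeg_leXy.
    have te' : tdeg_le 91 (bden k (bshift i' j' e)).
      by rewrite bden_shift mulrC; apply: (tdeg_leM te tm).
    have [b bE] := ev_span te'; exists b; rewrite -bE E; congr (_ * _).
    rewrite bden_shift [X in _ = ev _ X]mulrC; symmetry.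
    exact: (@evcME k c x y 31 60 91 _ _ erefl te tm).
  have tmono a b d : (a + b <= d)%N -> tdeg_le d ('X^a%:P * 'X^b : {poly {poly k}}).
    move=> abd; apply: (tdeg_leW abd); apply: tdeg_leM; first by apply: tdeg_leC; rewrite size_polyXn.
    by rewrite -[b in tdeg_le b]muln1; apply: tdeg_leX; apply: tdeg_leXy.
  have split a b a' b' : (a + b <= 31)%N -> (a' + b' <= 60)%N -> i = (a + a')%N :> nat -> j = (b + b')%N :> nat ->
      ev 91 ('X^i%:P * 'X^j) = ev 31 ('X^a%:P * 'X^b) * ev 60 ('X^a'%:P * 'X^b').
    move=> ab ab' -> ->; rewrite -(@evcME k c x y 31 60 91) //; try exact: tmono.
    by congr ev; rewrite !exprD polyCM; ring.
  have [le_i|lt_i] := leqP 31 i.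
    have [e te eE] := char0_cert smx_check tx isT.
    exists e, (i - 31)%N, j; split=> //; first by clear -ij le_i; lia.
    by rewrite mulrA -eE; apply: split => //; clear -ij le_i; lia.
  have [le_j|lt_j] := leqP 31 j.
    have [e te eE] := char0_cert smy_check ty isT.
    exists e, i, (j - 31)%N; split=> //; first by clear -ij le_j; lia.
    by rewrite mulrA -eE; apply: split => //; clear -ij le_j; lia.
  have [e te eE] := char0_cert smz_check tz isT.
  exists e, i, j; split=> //; first by clear -lt_i lt_j; lia.
  by rewrite mulrA -eE; apply: split => //; clear -lt_i lt_j; lia.
have [B BE] := fin_all_exists step.
have mu0 := char0 BE.
have mE i j (li : (i < 92)%N) (lj : (j < 92)%N) : (i + j <= 91)%N ->
    0 = if c then x ^+ (91 - i - j) * y ^+ j else x ^+ i * y ^+ j.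
  by move=> ij; rewrite -(mu0 (Ordinal li, Ordinal lj)) -evc_mono // /mu ij.
have e1 := mE 91 0 isT isT isT; have e0 := mE 0 0 isT isT isT.
suff /eqP : 0 = 1 :> k by rewrite eq_sym oner_eq0.
case: (c) e1 e0 => e1 e0; first by rewrite e1 !expr0 mulr1.
by rewrite e0 !expr0 mulr1.
Qed.

End CharZero.

Lemma smooth_char0 (k : numClosedFieldType) c : smooth (chart c 12 (bden k Ql)).
Proof.
apply: smooth_from_singular => x y sg; apply: (no_singular_char0 _ _ sg).
  by move=> B mu; apply: nakayama3.
by rewrite pnatr_eq0.
Qed.

Lemma coprime_char3 (k : closedFieldType) c (x y : k) : 3%:R = 0 :> k ->
    ev2 x y (chart c 12 (bden k Ql)) = 0 ->
  evc c x y 14 (bden k F0l) != 0 \/ evc c x y 16 (bden k Kl) != 0.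
Proof.
move=> char3 q0; have [f0|] := eqVneq (evc c x y 14 (bden k F0l)) 0; last by left.
right; apply/eqP => k0.
have ev0 rs : coprime_tdeg rs -> evc c x y 40 (\sum_(ab <- coprime_cert rs) bden k ab.1 * bden k ab.2) = 0.
  case: rs => [[a b] d] /and3P[/(bden_tdeg k) ta /(bden_tdeg k) tb /(bden_tdeg k) td].
  have tf : tdeg_le 14 (bden k F0l) by exact: bden_tdeg.
  have tk : tdeg_le 16 (bden k Kl) by exact: bden_tdeg.
  rewrite /coprime_cert !big_cons big_nil addr0 !evcD.
  rewrite (@evcME k c x y 26 14) // (@evcME k c x y 24 16) // (@evcME k c x y 28 12) //; last exact: Q_tdeg.
  by rewrite f0 k0 [evc c x y 12 _]q0 !mulr0 !addr0.
have /andP[tx tz] := coprime_tdeg_check.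
case: c q0 f0 k0 ev0 => q0 f0 k0 ev0.
  have := ev0 _ tx.
  rewrite (cert_char3 char3 cpx_check) evc_mono // (_ : (40 - 40 - 0)%N = 0%N) // !expr0 mulr1.
  by move/eqP; rewrite oner_eq0.
have := ev0 _ tz; rewrite (cert_char3 char3 cpz_check) evc_mono // !expr0 mulr1.
by move/eqP; rewrite oner_eq0.
Qed.

Lemma beta_char3 (k : closedFieldType) (y : k) : 3%:R = 0 :> k ->
  ev2 0 y (bden k Ql) = 0 -> ev2 0 y (bden k betl) != 0.
Proof.
move=> char3 q0; apply/eqP => b0.
have := bden_x0 y (m := Zpos 3) isT (eq_trans (zden3 k) char3) beta_check.
have bo : bden k bone = 1 by rewrite -[bone]/(bshift 0 0 bone) bden_one !expr0 polyC1 mulr1.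
have evD a b : ev2 0 y (a + b) = ev2 0 y a + ev2 0 y b by exact: rmorphD.
have evM a b : ev2 0 y (a * b) = ev2 0 y a * ev2 0 y b by exact: rmorphM.
rewrite bdenD bden_scale zdenN1 bo mulr1 bden_lincomb !big_cons big_nil addr0.
have gen u a a' v v' : ev2 0 y v = 0 -> ev2 0 y v' = 0 ->
    ev2 0 y (u + (a * v + a' * v')) = ev2 0 y u.
  by move=> v0 v'0; rewrite !evD !evM v0 v'0 !mulr0 !addr0.
rewrite (gen _ _ _ _ _ q0 b0).
rewrite ev2C hornerC => /eqP.
by rewrite oppr_eq0 oner_eq0.
Qed.

Lemma zden_F3 z : zden 'F_3 z = 0 -> Z.eqb (Z.modulo z (Zpos 3)) Z0.
Proof.
have Z3 : zden 'F_3 (Zpos 3) = 0 by apply: val_inj; vm_compute.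
rewrite {1}(Zdiv.Z_div_mod_eq_full z (Zpos 3)) zdenD zdenM Z3 mul0r add0r.
have := Zdiv.Z_mod_lt z (Zpos 3) (erefl _); move: (Z.modulo z (Zpos 3)) => r [r0 r3].
have : r = Z0 \/ r = Zpos 1 \/ r = Zpos 2 by lia.
case=> [-> //|[->|->]] /(congr1 (fun a : 'F_3 => nat_of_ord a)); vm_compute; by [].
Qed.

Lemma F3_zden z : Z.eqb (Z.modulo z (Zpos 3)) Z0 -> zden 'F_3 z = 0.
Proof.
move=> /Z.eqb_spec E; rewrite (Zdiv.Z_div_mod_eq_full z (Zpos 3)) E zdenD zdenM zden3 char3F mul0r.
by rewrite add0r.
Qed.

Lemma blam_kills (l : seq (seq Z)) d a f :
    all (fun m => Z.eqb (Z.modulo (bdot l (bshift m.1 m.2 a)) (Zpos 3)) Z0) (monomials d) ->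
  tdeg_le d f -> blam l (bden 'F_3 a * f) = 0.
Proof.
move=> /allP la tf; rewrite (tdeg_functional (F := fun f => blam l (bden 'F_3 a * f)) _ _ tf).
- rewrite big1 // => j _; rewrite big1 // => i ij.
  have /F3_zden := la (nat_of_ord i, nat_of_ord j) (mem_monomials ij).
  by rewrite -blam_bden bden_shift mulrC => ->; rewrite mulr0.
- by move=> g h; rewrite mulrDr blamD.
- by move=> c g; rewrite mulrCA blamZ.
Qed.

Lemma blam_obstruction (l r a b d : seq (seq Z)) (s t e : {poly {poly 'F_3}}) m n o :
    (forall f, tdeg_le m f -> blam l (bden 'F_3 a * f) = 0) ->
    (forall f, tdeg_le n f -> blam l (bden 'F_3 b * f) = 0) ->
    (forall f, tdeg_le o f -> blam l (bden 'F_3 d * f) = 0) ->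
    tdeg_le m s -> tdeg_le n t -> tdeg_le o e ->
  bden 'F_3 r = bden 'F_3 a * s - bden 'F_3 b * t + e * bden 'F_3 d -> zden 'F_3 (bdot l r) = 0.
Proof.
move=> ka kb kd ds dt de E; rewrite -blam_bden E blamD blamD ka // [e * _]mulrC kd //.
have -> : - (bden 'F_3 b * t) = (-1)%:P%:P * (bden 'F_3 b * t) by rewrite !polyCN !polyC1 mulN1r.
by rewrite blamZ kb // mulr0 !addr0.
Qed.

Lemma lam_obstruction (s t e : {poly {poly 'F_3}}) :
    tdeg_le 14 s -> tdeg_le 16 t -> tdeg_le 18 e ->
  bden 'F_3 Rl <> bden 'F_3 Kl * s - bden 'F_3 F0l * t + e * bden 'F_3 Ql.
Proof.
move=> ds dt de E; have /and4P[lF lK lQ /negP] := lam_check; apply; apply: zden_F3.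
exact (blam_obstruction (fun f => @blam_kills lam 14 Kl f lK) (fun f => @blam_kills lam 16 F0l f lF)
  (fun f => @blam_kills lam 18 Ql f lQ) ds dt de E).
Qed.

Lemma zdenB (R : comNzRingType) x y : zden R (Z.sub x y) = zden R x - zden R y.
Proof. by apply: (addIr (zden R y)); rewrite -zdenD Z.sub_add subrK. Qed.

(** * The Hasse-Witt condition over F_3 *)

Section HasseWittFunctionals.

Variables (Q2 : seq (seq Z)) (ms : seq (nat * nat)).

(** A row n of the left inverse in [hw_check], seen as a functional: it returns one coefficient of
    f, and it vanishes when f is fixed by the Cartier operator. *)
Definition hw_form (n : seq Z) (f : {poly {poly 'F_3}}) : 'F_3 :=
  \sum_(t < size ms) zden 'F_3 (nth Z0 n t) *
    ((bden 'F_3 Q2 * f)`_(3 * (nth (0, 0)%N ms t).2 + 2)`_(3 * (nth (0, 0)%N ms t).1 + 2)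
       - f`_((nth (0, 0)%N ms t).2)`_((nth (0, 0)%N ms t).1)).

Lemma hw_formD n f g : hw_form n (f + g) = hw_form n f + hw_form n g.
Proof.
rewrite /hw_form -big_split; apply: eq_bigr => t _ /=.
by rewrite [bden _ _ * (_ + _)]mulrDr !coefD -mulrDr opprD addrACA.
Qed.

Lemma hw_formZ n c f : hw_form n (c%:P%:P * f) = c * hw_form n f.
Proof.
rewrite /hw_form mulr_sumr; apply: eq_bigr => t _.
by rewrite [bden _ _ * _]mulrCA !coefCM -mulrBr mulrCA.
Qed.

Lemma hw_form_mono n k l : size n = size ms ->
  hw_form n ('X^k%:P * 'X^l) = zden 'F_3 (zdot n
    [seq Z.sub (nth Z0 (nth [::] (bshift k l Q2) (3 * m.2 + 2)%N) (3 * m.1 + 2)%N)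
     (if m == (k, l) then Zpos 1 else Z0) | m <- ms]).
Proof.
move=> sn; rewrite zdotP sn; apply: eq_bigr => t _; congr (_ * _).
rewrite (nth_map (0, 0)%N) // [bden _ _ * _]mulrC -bden_shift coef_bden.
rewrite zdenB; congr (_ - _).
rewrite coefCM !coefXn; case: (nth (0, 0)%N ms t) => i j; rewrite xpair_eqE /=.
by rewrite mulr_natr coefMn coefXn; case: (j == l); case: (i == k).
Qed.

Lemma hw_form_cartier n f : cartier (bden 'F_3 Q2 * f) = f -> hw_form n f = 0.
Proof.
move=> fE; have fE' i j : f`_j`_i = (bden 'F_3 Q2 * f)`_(3 * j + 2)`_(3 * i + 2).
  by rewrite -{1}fE coef_cartier.
by rewrite /hw_form big1 // => t _; rewrite [X in _ - X]fE' subrr mulr0.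
Qed.

Lemma hw_forms_separate d H : tdeg_le d H -> cartier (bden 'F_3 Q2 * H) = H ->
    (forall i j, (i + j <= d)%N -> exists n, forall k l, (k + l <= d)%N ->
       hw_form n ('X^k%:P * 'X^l) = ((k, l) == (i, j))%:R) -> H = 0.
Proof.
move=> Hd HE sep; apply: poly2P => i j; rewrite !coef0.
have [ij|ij] := leqP (i + j) d; last by rewrite (tdeg_le_coef Hd).
have [n nE] := sep i j ij.
have := hw_form_cartier n HE; rewrite (tdeg_functional (hw_formD n) (hw_formZ n) Hd).
have jd : (j < d.+1)%N by clear -ij; lia.
have id : (i < d.+1)%N by clear -ij; lia.
rewrite (eq_bigr (fun j' : 'I_d.+1 => \sum_(i' < d.+1 | (i' + j' <= d)%N)
    H`_j'`_i' * (((i' : nat), (j' : nat)) == (i, j))%:R)); last first.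
  by move=> j' _; apply: eq_bigr => i' ij'; rewrite nE.
rewrite (bigD1 (Ordinal jd)) //= [X in _ + X]big1 ?addr0; last first.
  move=> j' ne; rewrite big1 // => i' _; rewrite xpair_eqE.
  by have /negPf-> : (j' : nat) != j by []; rewrite andbF mulr0.
rewrite (bigD1 (Ordinal id)) //= eqxx mulr1 big1 ?addr0 // => i' /andP[_ ne].
rewrite xpair_eqE; have /negPf-> : (i' : nat) != i by [].
by rewrite mulr0.
Qed.

End HasseWittFunctionals.

Lemma size_digits b m z : size (digits b m z) = m.
Proof. by elim: m z => //= m IH z; case: N.div_eucl => ? ?; rewrite /= IH. Qed.

Lemma zip_rows (ms : seq (nat * nat)) (rows : seq (seq Z)) (V : nat -> nat -> seq Z) i j :
    (let vs := [seq (m, V m.1 m.2) | m <- ms] in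
     all (fun nr => all (fun mv => Z.eqb (Z.modulo (Z.sub (zdot nr.2 mv.2)
      (if mv.1 == nr.1 then Zpos 1 else Z0)) (Zpos 3)) Z0) vs) (zip ms rows)) ->
    size rows = size ms -> (i, j) \in ms ->
  exists2 n, n \in rows &
    forall k l, (k, l) \in ms -> zden 'F_3 (zdot n (V k l)) = ((k, l) == (i, j))%:R.
Proof.
move=> /allP chk srows ijm; have := index_mem (i, j) ms; rewrite ijm.
move: (index _ _) (nth_index (0, 0)%N ijm) => t tE t_lt.
exists (nth [::] rows t); first by rewrite mem_nth // srows.
move=> k l klm; have := chk ((i, j), nth [::] rows t).
have -> : ((i, j), nth [::] rows t) \in zip ms rows.
  apply/(nthP ((0, 0)%N, [::])); exists t; first by rewrite size_zip srows minnn.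
  by rewrite nth_zip ?srows // tE.
move=> /(_ isT)/allP/(_ ((k, l), V k l)).
have -> : ((k, l), V k l) \in [seq (m, V m.1 m.2) | m <- ms] by apply/mapP; exists (k, l).
move=> /(_ isT)/F3_zden; rewrite zdenB => /eqP; rewrite subr_eq0 => /eqP ->.
by rewrite /=; case: eqP.
Qed.

Lemma hw_row i j : (i + j <= 9)%N -> exists n, size n = size (monomials 9) /\
  forall k l, (k + l <= 9)%N -> zden 'F_3 (zdot n (hw_vector k l)) = ((k, l) == (i, j))%:R.
Proof.
move=> ij; have [||n nr nE] := @zip_rows _ _ _ i j hw_check.
- by rewrite size_map.
- exact: mem_monomials.
exists n; split=> [|k l kl]; last by apply: nE; apply: mem_monomials.
by case/mapP: nr => z _ ->; rewrite size_digits.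
Qed.

Lemma hasse_witt_F3 H : tdeg_le 9 H -> cartier (bden 'F_3 Ql * bden 'F_3 Ql * H) = H -> H = 0.
Proof.
move=> H9; have -> : bden 'F_3 Ql * bden 'F_3 Ql = bden 'F_3 Q2l.
  by rewrite -bdenM; apply: (congr1 (bden 'F_3)); vm_compute.
move=> HE; apply: (hw_forms_separate (ms := monomials 9) H9 HE) => i j ij.
have [n [sn nE]] := hw_row ij; exists n => k l kl.
by rewrite hw_form_mono // nE.
Qed.

(** * From characteristic 3 to the integers *)

(** Each cubing gains a factor 3 on the first-order term and at least as much on the rest, so modulo
    3^(j+2) only the linear term of the expansion is left. Through that term the quotient R enters
    the argument. *)
Lemma pow3_expand (R : comNzRingType) j (a b : R) : exists c,
  (a + 3%:R * b) ^+ (3 ^ j) =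
    a ^+ (3 ^ j) + (3 ^ j.+1)%:R * (a ^+ (3 ^ j).-1 * b) + (3 ^ j.+2)%:R * c.
Proof.
elim: j => [|j [c IH]]; first by exists 0; rewrite expn0 expn1 !expr1 expr0; ring.
have Q0 : (0 < 3 ^ j)%N by rewrite expn_gt0.
set Q := (3 ^ j)%N in IH Q0 *; rewrite expnSr exprM {}IH.
have e1 : (3 ^ j.+1 = 3 * Q)%N by rewrite expnS.
have e2 : (3 ^ j.+2 = 9 * Q)%N by rewrite !expnS mulnA.
have e3 : (3 ^ j.+3 = 27 * Q)%N by rewrite !expnS !mulnA.
have aE : a ^+ (Q * 3).-1 = a ^+ Q.-1 * a ^+ Q * a ^+ Q.
  by rewrite -!exprD; congr (_ ^+ _); clear -Q0; lia.
have aQ : a ^+ (Q * 3) = a ^+ Q * a ^+ Q * a ^+ Q by rewrite -!exprD; congr (_ ^+ _); clear; lia.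
rewrite -!expnSr !expnS -/Q in e1 e2 e3 *.
rewrite [(3 * Q)%N]mulnC aE aQ !natrM.
move: (a ^+ Q.-1) (a ^+ Q) (Q%:R : R) => r s t.
exists (s * s * c + t * (s * (r * b + 3%:R * c) ^+ 2) + t * t * (r * b + 3%:R * c) ^+ 3); ring.
Qed.

Lemma pow3_congr (R : comNzRingType) j (a b : R) : exists c,
  (a + 3%:R * b) ^+ (3 ^ j) = a ^+ (3 ^ j) + (3 ^ j.+1)%:R * c.
Proof.
have [c ->] := pow3_expand j a b; exists (a ^+ (3 ^ j).-1 * b + 3%:R * c).
by rewrite !(expnSr 3 j.+1) natrM; ring.
Qed.

Section CoordinateDivisibility.

Variables (R : comNzRingType) (q : {poly {poly R}}).
Hypotheses (q_monic : q \is monic) (q_gt1 : (1 < size q)%N).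
Notation A := {poly %/ q}.
Notation cl := (in_qpoly q).

Lemma polyn_xM N (w : A) : polyn (cl 'X%:P ^+ N * w) = 'X^N%:P * polyn w.
Proof.
rewrite -in_qpolyX -polyC_exp -[w in LHS]cl_id -in_qpolyM cl_small //.
rewrite mul_polyC (leq_ltn_trans (size_scale_leq _ _)) //; exact: size_qpoly_lt.
Qed.

Lemma x_dvd N (z : A) : (forall i j, (i < N)%N -> (polyn z)`_j`_i = 0) ->
  exists z', z = cl 'X%:P ^+ N * z'.
Proof.
move=> low; pose f : {poly {poly R}} := \poly_(j < size (polyn z)) drop_poly N (polyn z)`_j.
have sf : (size f < size q)%N by apply: leq_ltn_trans (size_poly _ _) (size_qpoly_lt q_monic q_gt1 z).
exists (cl f); apply: val_inj; rewrite /= -[LHS]/(polyn z) -[RHS]/(polyn (cl 'X%:P ^+ N * cl f)).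
rewrite polyn_xM cl_small //; apply: poly2P => i j; rewrite coefCM coefXnM coef_poly.
case: ltnP => [lt_i|le_i]; first exact: low.
case: ltnP => [lt_j|le_j]; last by rewrite [(polyn z)`_j]nth_default // !coef0.
by rewrite coef_drop_poly subnK.
Qed.

End CoordinateDivisibility.

Section ReductionModThree.

Variables (p3 : {rmorphism int -> 'F_3}) (q : {poly {poly int}}).
Hypotheses (q_monic : q \is monic) (q_gt1 : (1 < size q)%N).
Notation m3 := (map_poly (map_poly p3)).
Notation A := {poly %/ q}.
Notation cl := (in_qpoly q).
Notation red := (@qmap _ _ (map_poly p3) q).

Lemma p3_eq0 z : p3 z = 0 -> exists y, z = 3%:Z * y.
Proof.
move=> z0; exists (z %/ 3)%Z; rewrite {1}(divz_eq z 3) mulrC.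
have : p3 (z %% 3)%Z = 0.
  have p33 : p3 3 = 0 by rewrite -[3]/(3%:R) rmorph_nat char3F.
  by move: z0; rewrite {1}(divz_eq z 3) rmorphD rmorphM p33 mulr0 add0r.
have : (0 <= (z %% 3)%Z < 3) by rewrite modz_ge0 // ltz_pmod.
case: (z %% 3)%Z => // [[|[|[|m]]]] // _; rewrite ?addr0 //.
  by rewrite -natz rmorph_nat => /eqP.
by rewrite -natz rmorph_nat => /eqP.
Qed.

Lemma polyn_natM (n : nat) (a : A) : polyn (n%:R * a) = n%:R * polyn a.
Proof.
elim: n => [|n IH]; first by rewrite !mul0r raddf0.
by rewrite -natr1 mulrDl mul1r poly_of_qpolyD IH -natr1 mulrDl mul1r.
Qed.

Lemma natM_inj n (a b : A) : (0 < n)%N -> n%:R * a = n%:R * b -> a = b.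
Proof.
move=> n0 /(congr1 (fun c : A => polyn c)); rewrite !polyn_natM => E.
have n0' : n%:R != 0 :> {poly {poly int}}.
  by rewrite -!polyC_natr !polyC_eq0 pnatr_eq0 -lt0n.
exact: val_inj (mulfI n0' E).
Qed.

Lemma red_eq0 a : red a = 0 -> exists2 b, a = 3%:R * b & forall d, gr d a -> gr d b.
Proof.
move=> /(congr1 (fun c => polyn c)); rewrite val_qmap // raddf0 => a0.
have aP i j : exists y, (a : {poly {poly int}})`_j`_i = 3%:Z * y.
  apply: p3_eq0; have /(congr1 (fun f : {poly {poly 'F_3}} => f`_j`_i)) := a0.
  by rewrite coef_map coef_map !coef0.
pose f : {poly {poly int}} := \poly_(j < size (polyn a)) \poly_(i < size ((polyn a)`_j)%R) ((polyn a)`_j`_i %/ 3)%Z.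
have fE i j : f`_j`_i = ((polyn a)`_j`_i %/ 3)%Z.
  rewrite coef_poly; case: ltnP => le_j; last by rewrite [(polyn a)`_j]nth_default // !coef0.
  by rewrite coef_poly; case: ltnP => // le_i; rewrite (nth_default _ le_i).
have f3 : polyn a = 3%:R * f.
  apply: poly2P => i j; rewrite -polyC_natr -polyC_natr !coefCM fE.
  by have [y ->] := aP i j; rewrite mulrC mulzK // mulrC.
have sf : (size f < size q)%N by apply: leq_ltn_trans (size_poly _ _) (size_qpoly_lt q_monic q_gt1 a).
exists (cl f).
  by apply: val_inj; rewrite /= -[LHS]/(polyn a) f3 -[RHS]/(polyn (3%:R * cl f)) polyn_natM cl_small.
move=> d da; rewrite /gr cl_small //; apply: tdeg_leE => i j lt_d.
by rewrite fE (tdeg_le_coef da).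
Qed.

Lemma red_lift (a : {poly %/ m3 q}) :
  exists2 b : A, red b = a & forall d, gr d a -> gr d b.
Proof.
pose f : {poly {poly int}} := \poly_(j < size (polyn a)) \poly_(i < size ((polyn a)`_j)%R) (((polyn a)`_j`_i)%R : nat)%:Z.
have fE i j : f`_j`_i = (((polyn a)`_j`_i)%R : nat)%:Z.
  rewrite coef_poly; case: ltnP => le_j; last by rewrite [(polyn a)`_j]nth_default // !coef0.
  by rewrite coef_poly; case: ltnP => // le_i; rewrite (nth_default _ le_i).
have sf : (size f < size q)%N.
  apply: leq_ltn_trans (size_poly _ _) _; rewrite -(size_map_monic (map_poly p3) q_monic).
  by apply: size_qpoly_lt; rewrite ?map_monic_id ?size_map_monic.
have f3 : m3 f = polyn a.
  apply: poly2P => i j; rewrite coef_map /= coef_map /= fE -natz rmorph_nat.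
  exact: natr_Zp.
exists (cl f) => [|d da].
  apply: val_inj; rewrite /= -[LHS]/(polyn (red (cl f))) val_qmap // cl_small //.
by rewrite /gr cl_small //; apply: tdeg_leE => i j lt_d; rewrite fE (tdeg_le_coef da).
Qed.

(** Multiplication by x shifts coordinates, so divisibility by a power of x is the vanishing of
    certain integer coordinates, which the factor m does not affect. *)
Lemma x_saturated N m (w z : A) : (0 < m)%N -> cl 'X%:P ^+ N * w = m%:R * z ->
  exists z', z = cl 'X%:P ^+ N * z'.
Proof.
move=> m0 E; apply: (x_dvd q_monic q_gt1) => i j lt_i.
have := congr1 (fun c : A => (polyn c)`_j`_i) E.
rewrite (polyn_xM q_monic q_gt1) polyn_natM coefCM coefXnM lt_i -polyC_natr -polyC_natr !coefCM => /esym/eqP.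
by rewrite mulf_eq0 pnatr_eq0 -(negbK (m == 0)%N) -lt0n m0 => /eqP.
Qed.

End ReductionModThree.

(** * Forms of total contact over the integers *)

Section NoIntegralForm.

Variables (k : closedFieldType) (phi : {rmorphism 'F_3 -> k}) (p3 : {rmorphism int -> 'F_3}).
Variables (q gam bet : {poly {poly int}}).
Notation m3 := (map_poly (map_poly p3)).
Notation ph := (map_poly (map_poly phi)).
Hypotheses (q_monic : q \is monic) (q_size : size q = 13) (q_tdeg : tdeg_le 12 q).
Hypothesis q_smooth : forall c, smooth (chart c 12 (ph (m3 q))).
Hypothesis qy_neq0 : (m3 q)^`() != 0.
Hypothesis hasse_witt : forall H, tdeg_le 9 H -> cartier (m3 q * m3 q * H) = H -> H = 0.
Hypothesis qE : q = 'X * gam + 'X%:P * bet.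
Hypothesis gam0 : ev2 0 0 (ph (m3 gam)) != 0.
Hypothesis bet0 : forall y, ev2 0 y (ph (m3 q)) = 0 -> ev2 0 y (ph (m3 bet)) != 0.

Notation A := {poly %/ q}.
Notation q3 := (m3 q).
Notation A3 := {poly %/ q3}.
Notation cl := (in_qpoly q).
Notation red := (@qmap _ _ (map_poly p3) q).
Notation em := (@qmap _ _ (map_poly phi) q3).
Let x := cl 'X%:P.
Let g := cl gam.

Variables F0 K G0 R0 : A.
Hypotheses (F0d : gr 14 F0) (Kd : gr 16 K) (G0d : gr 10 G0) (R0d : gr 30 R0).
Hypothesis relZ : F0 * K = G0 ^+ 3 + 3%:R * R0.
Hypotheses (f00 : evq 0 0 (em (red F0)) != 0) (ka_neq0 : red K != 0).
Hypothesis cop : forall c x0 y0, ev2 x0 y0 (chart c 12 (ph q3)) = 0 ->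
  evq x0 y0 (cc 12 c 14 (em (red F0))) != 0 \/ evq x0 y0 (cc 12 c 16 (em (red K))) != 0.
Hypothesis noR : forall s t : A3, gr 14 s -> gr 16 t -> red R0 <> red K * s - red F0 * t.

Let q_gt1 : (1 < size q)%N. Proof. by rewrite q_size. Qed.
Let N_gt0 := ltn0Sn 11.
Let q3m : q3 \is monic. Proof. exact: map_monic_id. Qed.
Let q3s : size q3 = 13. Proof. by rewrite size_map_monic. Qed.
Let q3t : tdeg_le 12 q3. Proof. exact: tdeg_le_map. Qed.
Let q3g : (1 < size q3)%N. Proof. by rewrite q3s. Qed.
Let q3E : q3 = 'X * m3 gam + 'X%:P * m3 bet.
Proof. by rewrite {1}qE rmorphD !rmorphM /= map_polyX map_polyC /= map_polyX. Qed.
Let redM a b : red (a * b) = red a * red b. Proof. exact: qmapM. Qed.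
Let redD a b : red (a + b) = red a + red b. Proof. exact: qmapD. Qed.
Let red1 : red 1 = 1. Proof. by rewrite -(rmorph1 cl) qmap_cl // !rmorph1. Qed.
Let redX a n : red (a ^+ n) = red a ^+ n.
Proof. by elim: n => [|n IH]; rewrite ?expr0 ?red1 // !exprS redM IH. Qed.
Let red0 : red 0 = 0. Proof. by rewrite -(in_qpoly0 q) qmap_cl // !rmorph0. Qed.
Let redn n a : red (n%:R * a) = n%:R * red a.
Proof. by elim: n => [|n IH]; rewrite ?mul0r ?red0 // -!natr1 !mulrDl !mul1r redD IH. Qed.
Let redB a b : red (a - b) = red a - red b.
Proof. by apply: (addIr (red b)); rewrite -redD !subrK. Qed.
Let red_x : red x = in_qpoly q3 'X%:P. Proof. by rewrite qmap_cl // map_polyC /= map_polyX. Qed.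
Let red_g : red g = in_qpoly q3 (m3 gam). Proof. by rewrite qmap_cl. Qed.
Let red_gr d a : gr d a -> gr d (red a).
Proof. by move=> da; rewrite /gr val_qmap //; apply: tdeg_le_map. Qed.
Let three0 (a : A3) : 3%:R * a = 0.
Proof.
have -> : 3%:R = 0 :> A3 by rewrite -(rmorph_nat (in_qpoly q3)) -polyC_natr -polyC_natr char3F !polyC0 rmorph0.
by rewrite mul0r.
Qed.
Let gZM d e (a b : A) : gr d a -> gr e b -> gr (d + e) (a * b).
Proof. exact: (grM q_monic q_size N_gt0 q_tdeg). Qed.
Let gZX d (a : A) n : gr d a -> gr (n * d) (a ^+ n).
Proof. exact: (grX q_monic q_size N_gt0 q_tdeg). Qed.
Let gZN d (a : A) : gr d a -> gr d (- a).
Proof. exact: (grN q_monic q_size N_gt0 q_tdeg). Qed.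
Let canc (c a b : A3) : c != 0 -> c * a = c * b -> a = b.
Proof. exact: (mul_cancel q3m q3s q3t q_smooth). Qed.
Let nzX (a : A3) n : a != 0 -> a ^+ n != 0.
Proof. by move=> a0; exact: (exp_neq0 q3m q3s q3t q_smooth n a0). Qed.
Let red_eq a b : red a = red b -> exists2 c, a = b + 3%:R * c & forall d, gr d a -> gr d b -> gr d c.
Proof.
move=> E; have : red (a - b) = 0 by rewrite redB E subrr.
case/(red_eq0 q_monic q_gt1) => c cE cd; exists c; first by rewrite -cE addrC subrK.
by move=> d da db; apply: cd; apply: grD => //; apply: gZN.
Qed.
Let pow3_inj j (a b : A3) : a ^+ (3 ^ j) = b ^+ (3 ^ j) -> a = b.
Proof.
elim: j => [|j IH]; rewrite ?expr1 // expnSr !exprM.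
by move/(cube_inj q3m q3s q3t q_smooth).
Qed.
Let rel0 : red F0 * red K = red G0 ^+ 3.
Proof. by rewrite -redM relZ redD redn three0 addr0 redX. Qed.

Section Contact.

Variables (j u : nat) (F w : A).
Let Q := (3 ^ j)%N.
Let n := (Q * u)%N.
Hypotheses (u1 : (u %% 3 = 1)%N) (Fd : gr n F) (FE : g ^+ (12 * n) * F = x ^+ (12 * n) * w).
Hypothesis fT : total_contact (ph (m3 gam)) 12 n (em (red F)).

Let twist D a := @twisted_root k phi q3 (m3 gam) q3m q3s q3t q_smooth qy_neq0 hasse_witt gam0
  j u Q n (red F) (erefl _) (erefl _) u1 fT D a.
Let Q_gt0 : (0 < Q)%N. Proof. by rewrite expn_gt0. Qed.
Let F0r := red_gr F0d.
Let Kr := red_gr Kd.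
Let red_f0_neq0 : red F0 != 0 := f0_neq0 q3m q3s f00.
Let f_neq0 : red F != 0.
Proof.
have [_ _ _ [r rE r0]] := fT.
have := total_contact_neq0 N_gt0 (plane_curve_map phi q3m q3s q3t) q_smooth fT.
by apply: contraNneq => ->; rewrite (em0 phi q3m q3s).
Qed.

(** V and T lift the roots of F F0^Q and F K^(2Q). The relation between T G0 and V K holds because
    both have the same power 3 Q modulo 3, and cubing is injective there. *)
Lemma twisted_roots : exists V T a b1 b2 : A,
  [/\ gr ((u + 14) %/ 3) V /\ gr ((u + 32) %/ 3) T,
      red F * red F0 ^+ Q = red V ^+ (3 * Q), red F * red K ^+ (2 * Q) = red T ^+ (3 * Q),
      T * G0 = V * K + 3%:R * b1 & g ^+ (4 * u) * V = x ^+ (4 * u) * a + 3%:R * b2].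
Proof.
have [cF cK] := cubic_f0_ka q3m q3s q3t q_smooth F0r Kr (red_gr G0d) rel0 f00 ka_neq0 cop.
have [v vd vE] := twist F0r red_f0_neq0 erefl cF.
have [t td tE] : exists2 t : A3, gr ((u + 32) %/ 3) t & red F * (red K ^+ 2) ^+ Q = t ^+ (3 * Q).
  apply: twist => //; first exact: (grX q3m q3s N_gt0 q3t 2 Kr).
    exact: nzX.
  move=> c x0 y0 p m q0 pu; rewrite (emX phi q3m q3s).
  have [l ol] := pord_ex N_gt0 (plane_curve_map phi q3m q3s q3t) q_smooth q0 pu (em_gr phi q3m q3s Kr) (em_neq0 phi q3m q3s ka_neq0).
  move=> /(pord_uniq N_gt0 (plane_curve_map phi q3m q3s q3t) q_smooth q0 pu
    (pordX N_gt0 (plane_curve_map phi q3m q3s q3t) q0 2 (em_gr phi q3m q3s Kr) ol)) <-.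
  by rewrite dvdn_mull // (cK c x0 y0 p).
have tg : t * red G0 = v * red K.
  have e1 : red G0 ^+ (3 * Q) = red F0 ^+ Q * red K ^+ Q by rewrite exprM -rel0 exprMn.
  have e2 : red K ^+ 2 ^+ Q = red K ^+ (2 * Q) by rewrite -exprM.
  have e3 : red K ^+ (3 * Q) = red K ^+ (2 * Q) * red K ^+ Q.
    by rewrite -exprD; congr (_ ^+ _); clear; lia.
  by apply: (@pow3_inj j.+1); rewrite expnS -/Q !exprMn -vE -tE e1 e2 e3; ring.
have v0 : v != 0.
  apply/eqP => v0; have := vE; rewrite v0 expr0n muln_eq0 /= -leqn0 leqNgt Q_gt0 /=.
  move/eqP; apply/negP; exact: (mul_neq0 q3m q3s q3t q_smooth f_neq0 (nzX Q red_f0_neq0)).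
have [a aE] := root_contact q3m q3s q3t q_smooth q3E gam0 (erefl Q) (erefl n) fT vd v0 vE.
have [V Vv Vd] := red_lift q_monic q_gt1 v; have [T Tt Td] := red_lift q_monic q_gt1 t.
have [a' a'E _] := red_lift q_monic q_gt1 a.
have [|b1 b1E _] := @red_eq (T * G0) (V * K); first by rewrite !redM Vv Tt.
have [|b2 b2E _] := @red_eq (g ^+ (4 * u) * V) (x ^+ (4 * u) * a').
  by rewrite !redM !redX red_g red_x Vv a'E aE.
exists V, T, a', b1, b2; split=> //; [by split; [apply: Vd|apply: Td]|by rewrite Vv|].
by rewrite Tt -tE -exprM.
Qed.

Lemma no_total_contact : False.
Proof.
have [V [T [a [b1 [b2 [[Vd Td] VE TE b1E b2E]]]]]] := twisted_roots.
have degE m : (m %% 3 = 2 -> 3 * ((u + m) %/ 3) = u + m)%N by clear -u1; lia.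
have Vd' : gr (n + 14 * Q) (V ^+ (3 * Q)).
  by have := gZX (3 * Q) Vd; rewrite mulnAC degE // mulnDl mulnC [(14 * Q)%N]mulnC -mulnDr mulnC mulnDl [(u * Q)%N]mulnC.
have Td' : gr (n + 32 * Q) (T ^+ (3 * Q)).
  by have := gZX (3 * Q) Td; rewrite mulnAC degE // mulnDl mulnC [(32 * Q)%N]mulnC -mulnDr mulnC mulnDl [(u * Q)%N]mulnC.
have FFd : gr (n + 14 * Q) (F * F0 ^+ Q) by rewrite [(14 * Q)%N]mulnC; apply: gZM => //; apply: gZX.
have FKd : gr (n + 32 * Q) (F * K ^+ (2 * Q)).
  by rewrite (_ : (32 * Q = 2 * Q * 16)%N); [apply: gZM => //; apply: gZX|clear; lia].
have [c1 c1E] := pow3_expand j (G0 ^+ 3) R0.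
have [c2 c2E] := pow3_congr j.+1 (V * K) b1.
have [c3 c3E] := pow3_congr j.+1 (x ^+ (4 * u) * a) b2.
rewrite -/Q -relZ in c1E.
rewrite (_ : (3 ^ j.+1 = 3 * Q)%N) in c2E c3E; last by rewrite expnS.
rewrite -b1E in c2E; rewrite -b2E in c3E.
have n12 : (12 * n = 4 * u * (3 * Q))%N by rewrite /n; clear; lia.
rewrite !exprMn -!exprM -n12 in c3E.
have K3r : red K ^+ (3 * Q) = red K ^+ (2 * Q) * red K ^+ Q.
  by rewrite -exprD; congr (_ ^+ _); clear; lia.
(* V has contact 4 u modulo 3, so V^(3 Q) has contact 12 n modulo 3^(j+2). Subtracting this from the
   contact of F F0^Q and cancelling 3^(i+1) by saturation leaves the contact of G modulo 3. *)
have contact i c G : (i <= j)%N -> F * F0 ^+ Q = c%:R * V ^+ (3 * Q) + (3 ^ i.+1)%:R * G ->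
    exists z, red g ^+ (12 * n) * red G = red x ^+ (12 * n) * z.
  move=> le_ij GE; pose e := (3 ^ (j.+1 - i))%N.
  have ej : (3 ^ j.+2 = 3 ^ i.+1 * e)%N by rewrite -expnD; congr (_ ^ _)%N; clear -le_ij; lia.
  have [||z' z'E] := @x_saturated q q_monic q_gt1 (12 * n) (3 ^ i.+1) (w * F0 ^+ Q - c%:R * a ^+ (3 * Q))
      (g ^+ (12 * n) * G + c%:R * (e%:R * c3)).
  - by rewrite expn_gt0.
  - have E : g ^+ (12 * n) * F * F0 ^+ Q = x ^+ (12 * n) * w * F0 ^+ Q by rewrite FE.
    rewrite -mulrA GE mulrDr mulrCA c3E ej natrM in E.
    have -> : cl 'X%:P ^+ (12 * n) * (w * F0 ^+ Q - c%:R * a ^+ (3 * Q)) = x ^+ (12 * n) * w * F0 ^+ Q - c%:R * (x ^+ (12 * n) * a ^+ (3 * Q)) by rewrite /x; ring.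
    rewrite -E; ring.
  exists (red z'); have := congr1 (fun c => red c) z'E.
  have e0 : red (e%:R * c3) = 0 by rewrite /e subSn // expnS natrM -mulrA redn three0.
  by rewrite redD redn e0 mulr0 addr0 !redM !redX.
(* Elimination of F through (F F0^Q) K^(3 Q) = (F K^(2 Q)) (F0 K)^Q. Raising the congruence of T G0
   and V K to the power 3 Q leaves an error of 3^(j+2) only, so the term with R that comes from (F0
   K)^Q is the leading one. *)
have cross i c G Y : F * F0 ^+ Q = c%:R * V ^+ (3 * Q) + (3 ^ i.+1)%:R * G ->
    F * K ^+ (2 * Q) = c%:R * T ^+ (3 * Q) + (3 ^ i.+1)%:R * Y ->
    exists b, (3 ^ i.+1)%:R * (G * K ^+ (3 * Q) - Y * (F0 * K) ^+ Q) =
      (3 ^ j.+1)%:R * (c%:R * (T ^+ (3 * Q) * ((G0 ^+ 3) ^+ Q.-1 * R0)) + 3%:R * b).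
  move=> GE YE; exists (c%:R * (T ^+ (3 * Q) * c1 + c2)).
  have K3 : K ^+ (3 * Q) = K ^+ (2 * Q) * K ^+ Q by rewrite -exprD; congr (_ ^+ _); clear; lia.
  have -> : (3 ^ i.+1)%:R * (G * K ^+ (3 * Q) - Y * (F0 * K) ^+ Q) =
      c%:R * (T ^+ (3 * Q) * (F0 * K) ^+ Q - V ^+ (3 * Q) * K ^+ (3 * Q)).
    have : (F * F0 ^+ Q) * K ^+ (3 * Q) = (F * K ^+ (2 * Q)) * (F0 * K) ^+ Q.
      by rewrite K3 exprMn; ring.
    rewrite GE YE => /eqP; rewrite -subr_eq0 => /eqP E0.
    apply/eqP; rewrite -subr_eq0; apply/eqP; rewrite -[RHS]E0; ring.
  have e3 : (3 ^ j.+2)%:R = (3 ^ j.+1)%:R * 3%:R :> A by rewrite expnSr natrM.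
  have TG : T ^+ (3 * Q) * (G0 ^+ 3) ^+ Q = V ^+ (3 * Q) * K ^+ (3 * Q) + (3 ^ j.+2)%:R * c2.
    by rewrite -exprMn -c2E -exprM -exprMn.
  rewrite c1E !mulrDr TG e3; ring.
have step i : (i <= j)%N -> exists c (G Y : A),
    [/\ gr (n + 14 * Q) G /\ gr (n + 32 * Q) Y, (c %% 3 = 1)%N,
        F * F0 ^+ Q = c%:R * V ^+ (3 * Q) + (3 ^ i.+1)%:R * G
      & F * K ^+ (2 * Q) = c%:R * T ^+ (3 * Q) + (3 ^ i.+1)%:R * Y].
  elim: i => [_|i IH lt_ij].
    have [|G GE Gd] := @red_eq (F * F0 ^+ Q) (V ^+ (3 * Q)); first by rewrite redM !redX.
    have [|Y YE Yd] := @red_eq (F * K ^+ (2 * Q)) (T ^+ (3 * Q)); first by rewrite redM !redX.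
    exists 1%N, G, Y; rewrite !mul1r expn1 GE YE; split=> //.
    by split; [apply: Gd|apply: Yd].
  have [c [G [Y [[Gd Yd] cm1 GE YE]]]] := IH (ltnW lt_ij).
  have [z zE] := contact i c G (ltnW lt_ij) GE.
  have [b bE] := cross i c G Y GE YE; set W := T ^+ _ * _ in bE.
  have jE : (3 ^ j.+1 = 3 ^ i.+1 * (3 * 3 ^ (j - i.+1)))%N.
    by rewrite -expnS -expnD; congr (_ ^ _)%N; clear -lt_ij; lia.
  rewrite jE natrM -mulrA in bE.
  have /natM_inj : (0 < 3 ^ i.+1)%N by rewrite expn_gt0.
  move=> /(_ _ _ _ bE)/(congr1 (fun c => red c)).
  rewrite natrM -[3%:R * _ * _]mulrA redn three0 => /eqP.
  rewrite redB !redM !redX redM subr_eq0 K3r exprMn => /eqP E.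
  have {}E : red G * red K ^+ (2 * Q) = red Y * red F0 ^+ Q.
    by apply: (canc (nzX Q ka_neq0)); rewrite mulrC -mulrA E; ring.
  rewrite red_g red_x in zE.
  have [d [dG dY]] := vanishing_multiple q3m q3s q3t q_smooth q3E gam0 F0r Kr f00 ka_neq0 cop fT
     (red_gr Gd) (red_gr Yd) zE E.
  have dE : in_qpoly q3 d%:P%:P = (d : nat)%:R.
    by rewrite -{1}[d]natr_Zp polyC_natr polyC_natr rmorph_nat.
  rewrite dE VE in dG; rewrite dE TE in dY.
  have [|G' GE' Gd'] := @red_eq G ((d : nat)%:R * V ^+ (3 * Q)); first by rewrite redn redX.
  have [|Y' YE' Yd'] := @red_eq Y ((d : nat)%:R * T ^+ (3 * Q)); first by rewrite redn redX.
  (* The same constant d occurs for G and for Y, so both expansions keep a common coefficient, and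
     it stays 1 modulo 3. *)
  exists (c + 3 ^ i.+1 * d)%N, G', Y'; rewrite GE YE GE' YE'; split.
  - by split; [apply: Gd'|apply: Yd'] => //; apply: gr_natl.
  - by rewrite expnS -mulnA -modnDmr modnMr addn0.
  - rewrite (expnSr 3 i.+1) natrD !natrM; ring.
  - rewrite (expnSr 3 i.+1) natrD !natrM; ring.
(* At i = j both sides of the elimination carry the factor 3^(j+1), so after its cancellation the
   term with R survives the reduction. *)
have [c [G [Y [[Gd Yd] cm1 GE YE]]]] := step j (leqnn j).
have [z zE] := contact j c G (leqnn j) GE.
have [b bE] := cross j c G Y GE YE.
have /natM_inj : (0 < 3 ^ j.+1)%N by rewrite expn_gt0.
move=> /(_ _ _ _ bE)/(congr1 (fun c => red c)) {bE}.
have cR (a' : A3) : c%:R * a' = a'.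
  by rewrite (divn_eq c 3) cm1 natrD natrM mulrDl -mulrA mulrCA three0 add0r mul1r.
rewrite redB redD !redn three0 addr0 cR !redM !redX redM K3r exprMn -TE -rel0 => E.
have E' : red G * red K ^+ (2 * Q) = red Y * red F0 ^+ Q +
    red F * red K ^+ (2 * Q).-1 * red F0 ^+ Q.-1 * red R0.
  apply: (canc (nzX Q ka_neq0)).
  have QP : red K ^+ Q = red K ^+ Q.-1 * red K by rewrite -exprSr prednK.
  have Q2P : red K ^+ (2 * Q) = red K ^+ (2 * Q).-1 * red K by rewrite -exprSr prednK // muln_gt0.
  move/eqP: E; rewrite subr_eq => /eqP E.
  have -> : red K ^+ Q * (red G * red K ^+ (2 * Q)) = red G * (red K ^+ (2 * Q) * red K ^+ Q) by ring.
  rewrite E exprMn QP Q2P; ring.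
rewrite red_g red_x in zE.
have [s [t [sd td rE]]] := obstruction q3m q3s q3t q_smooth q3E gam0 F0r Kr f00 ka_neq0 cop
   (erefl Q) fT (red_gr Gd) (red_gr Yd) (red_gr R0d) zE E'.
exact: noR rE.
Qed.

End Contact.

Theorem no_primitive_contact n (F w : A) : (0 < n)%N -> gr n F ->
  g ^+ (12 * n) * F = x ^+ (12 * n) * w -> red F = 0.
Proof.
move=> n0 Fd FE; apply/eqP; apply/negPn/negP => rF0.
have [u u3 nE] := pfactor_coprime (isT : prime 3) n0.
have contactP m (H z : A) : gr m H -> red H != 0 -> g ^+ (12 * m) * H = x ^+ (12 * m) * z ->
    total_contact (ph (m3 gam)) 12 m (em (red H)).
  move=> Hd rH HE; have qC := plane_curve_map phi q3m q3s q3t.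
  have qkE : ph q3 = 'X * ph (m3 gam) + 'X%:P * ph (m3 bet).
    by rewrite {1}q3E rmorphD !rmorphM /= map_polyX map_polyC /= map_polyX.
  apply: (total_contactP N_gt0 qC q_smooth qkE bet0 (r := em (red z))).
  - exact: (em_neq0 phi q3m q3s rH).
  - by apply: (em_gr phi q3m q3s); apply: red_gr.
  have := congr1 (fun c => em (red c)) HE.
  rewrite !redM !redX red_g red_x !(qmapM (map_poly phi) q3m q3g) !(emX phi q3m q3s).
  by rewrite !(qmap_cl (map_poly phi) q3m q3g) map_polyC /= map_polyX.
have F2 : g ^+ (12 * (2 * n)) * F ^+ 2 = x ^+ (12 * (2 * n)) * w ^+ 2.
  have -> : (12 * (2 * n) = 12 * n * 2)%N by clear; lia.
  by rewrite [g ^+ _]exprM [x ^+ _]exprM -!exprMn FE.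
have F2d : gr (2 * n) (F ^+ 2) by apply: gZX.
have rF20 : red (F ^+ 2) != 0 by rewrite redX; apply: nzX.
have T1 := contactP _ _ _ Fd rF0 FE; have T2 := contactP _ _ _ F2d rF20 F2.
have : (u %% 3 = 1 \/ (2 * u) %% 3 = 1)%N.
  by move: u3; rewrite prime_coprime // /dvdn; clear; lia.
case=> u1.
  rewrite nE mulnC in Fd FE T1.
  exact: (no_total_contact u1 Fd FE T1).
rewrite (_ : (2 * n = 3 ^ logn 3 n * (2 * u))%N) in F2d F2 T2; last by rewrite {1}nE; clear; lia.
exact: (no_total_contact u1 F2d F2 T2).
Qed.

End NoIntegralForm.

Lemma evq_cc_cl (k : closedFieldType) (q : {poly {poly k}}) N c d g x y :
    (0 < N)%N -> plane_curve q N -> tdeg_le d g -> ev2 x y (chart c N q) = 0 ->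
  evq x y (cc N c d (in_qpoly q g)) = ev2 x y (chart c d g).
Proof.
move=> N0 qC dg q0; rewrite -(evq_cl (chart_monic N0 qC c) (chart_gt1 N0 qC c) _ q0) /cc.
congr evq; apply: (chart_cl_eq N0 qC) => //; last by rewrite cl_id.
exact: (gr_cl (curve_monic qC) (curve_size qC) N0 (curve_tdeg qC)).
Qed.

Lemma tdeg_le_natl (R : comNzRingType) d n (f : {poly {poly R}}) :
  tdeg_le d f -> tdeg_le d (n%:R * f).
Proof.
by move=> fd; elim: n => [|n IH]; rewrite ?mul0r -?natr1 ?mulrDl ?mul1r; [apply: tdeg_le0|apply: tdeg_leD].
Qed.

(** The functional [lam] acts on polynomials, so an identity in the quotient ring has to be lifted
    with a degree bound on the multiple of q. *)
Lemma in_qpoly_lift (R : comNzRingType) (q r a b : {poly {poly R}}) N d e (s t : {poly %/ q}) :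
    q \is monic -> size q = N.+1 -> (0 < N)%N -> tdeg_le N q ->
    tdeg_le (d + e) r -> tdeg_le d a -> tdeg_le e b -> gr e s -> gr d t ->
    in_qpoly q r = in_qpoly q a * s - in_qpoly q b * t ->
  exists2 c, tdeg_le (d + e - N) c & r = a * polyn s - b * polyn t + c * q.
Proof.
move=> qm qs N0 qt rd ad bd sd td; rewrite -{1}[s]cl_id -{1}[t]cl_id -!in_qpolyM -in_qpolyB => E.
have dd : tdeg_le (d + e) (r - (a * polyn s - b * polyn t)).
  apply: tdeg_leB => //; apply: tdeg_leB; first exact: tdeg_leM.
  by rewrite addnC; apply: tdeg_leM.
have [c [r' [rE sr _ cd _]]] := tdeg_le_divE qm qs N0 qt dd.
exists c => //; suff r0 : r' = 0 by rewrite r0 add0r in rE; rewrite -rE addrC subrK.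
have : in_qpoly q (r' + c * q) = 0 by rewrite -rE in_qpolyB E subrr.
have q_gt1 : (1 < size q)%N by rewrite qs.
rewrite in_qpolyD in_qpolyM (cl_q qm q_gt1) mulr0 addr0.
by move/(congr1 (fun a => polyn a)); rewrite cl_small // raddf0.
Qed.

Section ConcreteIntegralCurve.

Let q := bden int Ql.
Notation cl := (in_qpoly q).
Let N_gt0 := ltn0Sn 11.
Let qm : q \is monic. Proof. exact: Q_monic. Qed.
Let qs : size q = 13. Proof. exact: Q_size. Qed.
Let qg : (1 < size q)%N. Proof. by rewrite qs. Qed.
Let qt : tdeg_le 12 q. Proof. exact: Q_tdeg. Qed.

(** The certificate holds modulo 9. Its error is absorbed by 3 R + 9 E = 3 (R + 3 E), which leaves R
    unchanged modulo 3. *)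
Lemma integral_relation : exists2 E, tdeg_le 30 E &
  cl (bden int F0l) * cl (bden int Kl) =
  cl (bden int G0l) ^+ 3 + 3%:R * cl (bden int Rl + 3%:R * E).
Proof.
have := bzero_div int (m := Zpos 9) isT rel_check.
set e := map _ (badd (bmul F0l Kl) _).
rewrite (bdenD int (bmul F0l Kl)) (bdenM int F0l Kl) (bden_scale int _ (badd _ _)).
rewrite (bdenD int (bmul G0l _)) (bdenM int G0l) (bdenM int G0l G0l) (bdenD int (bscale _ _)).
rewrite (bden_scale int (Zpos 3)) (bdenM int Sl Ql) zdenN1 zden3.
have -> : zden int (Zpos 9) = 9%:R by [].
rewrite !polyCN !polyC1 mulN1r !polyC_natr => E; exists (bden int e).
  have td : tdeg_le 30 (9%:R * bden int e).
    rewrite -E; apply: tdeg_leB; first by apply: (tdeg_leM (d := 14) (e := 16)); exact: bden_tdeg.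
    have t10 : tdeg_le 10 (bden int G0l) by exact: bden_tdeg.
    apply: tdeg_leD; first exact: (tdeg_leM t10 (tdeg_leM t10 t10)).
    apply: tdeg_leD.
      by apply: tdeg_le_natl; exact: bden_tdeg.
    by apply: (tdeg_leM (d := 18)); [exact: bden_tdeg|exact: qt].
  apply: tdeg_leE => i j lt30; have := tdeg_le_coef td lt30.
  by rewrite -polyC_natr -polyC_natr !coefCM => /eqP; rewrite mulf_eq0 => /orP[//|/eqP].
rewrite -in_qpolyM -in_qpolyX -[3%:R in RHS](rmorph_nat cl) -in_qpolyM -in_qpolyD; apply/cl_eq => //.
exists (bden int Sl); have -> : bden int F0l * bden int Kl =
   9%:R * bden int e + (bden int G0l * (bden int G0l * bden int G0l) + (3%:R * bden int Rl + bden int Sl * q)).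
  by rewrite -E subrK.
ring.
Qed.

Theorem no_integral_contact n (F w : {poly %/ q}) : (0 < n)%N -> gr n F ->
  cl (bden int gaml) ^+ (12 * n) * F = cl 'X%:P ^+ (12 * n) * w ->
  qmap (map_poly (intmul 1 : {rmorphism int -> 'F_3})) F = 0.
Proof.
have [k [phi _]] := countable_algebraic_closure 'F_3.
have char3 : 3%:R = 0 :> k by rewrite -(rmorph_nat phi) char3F rmorph0.
set p3 := (intmul 1 : {rmorphism int -> 'F_3}).
have [E Ed relE] := integral_relation.
have m3E a : map_poly (map_poly p3) (bden int a) = bden 'F_3 a by exact: bden_map.
have phE a : map_poly (map_poly phi) (map_poly (map_poly p3) (bden int a)) = bden k a.
  by rewrite m3E bden_map.
have qC : plane_curve (map_poly (map_poly phi) (map_poly (map_poly p3) q)) 12.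
  by rewrite phE; split; [exact: Q_monic|exact: Q_size|exact: Q_tdeg].
have redE f : qmap (map_poly p3) (cl f) = in_qpoly (map_poly (map_poly p3) q) (map_poly (map_poly p3) f).
  exact: qmap_cl.
have q3m : map_poly (map_poly p3) q \is monic by rewrite m3E; exact: Q_monic.
have q3s : size (map_poly (map_poly p3) q) = 13 by rewrite m3E; exact: Q_size.
have q3t : tdeg_le 12 (map_poly (map_poly p3) q) by rewrite m3E; exact: Q_tdeg.
have q3g : (1 < size (map_poly (map_poly p3) q))%N by rewrite q3s.
have emE f : qmap (map_poly phi) (qmap (map_poly p3) (cl f)) =
    in_qpoly (map_poly (map_poly phi) (map_poly (map_poly p3) q)) (map_poly (map_poly phi) (map_poly (map_poly p3) f)).
  by rewrite redE qmap_cl.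
have grc d a : btdeg d a -> gr d (cl (bden int a)).
  by move=> /(bden_tdeg int); exact: (gr_cl qm qs N_gt0 qt).
have R0E : map_poly (map_poly p3) (bden int Rl + 3%:R * E) = bden 'F_3 Rl.
  have n3 : 3%:R = 0 :> {poly {poly 'F_3}} by rewrite -polyC_natr -polyC_natr char3F !polyC0.
  have -> : map_poly (map_poly p3) (bden int Rl + 3%:R * E) =
      map_poly (map_poly p3) (bden int Rl) + 3%:R * map_poly (map_poly p3) E.
    by rewrite -[3%:R in RHS](rmorph_nat (map_poly (map_poly p3))) -rmorphM -rmorphD.
  by rewrite m3E n3 mul0r addr0.
apply: (@no_primitive_contact k phi p3 q (bden int gaml) (bden int betl) qm qs qt _ _ _ _ _ _
   (cl (bden int F0l)) (cl (bden int Kl)) (cl (bden int G0l)) (cl (bden int Rl + 3%:R * E))) => //.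
- by move=> c; rewrite phE; exact: smooth_char3.
- rewrite m3E; apply/eqP => /(congr1 (fun f : {poly {poly 'F_3}} => f`_0`_0)).
  by rewrite coef_deriv coefMn coef_bden !coef0 => /eqP.
- by move=> H; rewrite m3E; exact: hasse_witt_F3.
- exact: Q_gam_bet.
- by rewrite phE ev2_00; apply/eqP => /eqP; rewrite (_ : zden k _ = 1) ?oner_eq0.
- by move=> y; rewrite !phE; exact: beta_char3.
- exact: grc.
- exact: grc.
- exact: grc.
- apply: (gr_cl qm qs N_gt0 qt); apply: tdeg_leD; first exact: bden_tdeg.
  exact: tdeg_le_natl.
- rewrite emE phE evq_cl ?(curve_monic qC) ?(curve_size qC) //; last by rewrite phE ev2_00.
  by rewrite ev2_00; apply/eqP => /eqP; rewrite (_ : zden k _ = -1) ?oppr_eq0 ?oner_eq0.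
- apply/eqP => /(congr1 (fun a => qmap (map_poly phi) a)); rewrite emE phE (em0 phi q3m q3s).
  move=> /(congr1 (evq 0 0)); rewrite evq_cl ?(curve_monic qC) ?(curve_size qC) //; last by rewrite phE ev2_00.
  by rewrite evq0 ev2_00 (_ : zden k _ = 1) // => /eqP; rewrite oner_eq0.
- move=> c x0 y0 q0; rewrite !emE !phE.
  have q0' : ev2 x0 y0 (chart c 12 (bden k Ql)) = 0 by rewrite -phE.
  have tf : tdeg_le 14 (bden k F0l) by exact: bden_tdeg.
  have tk : tdeg_le 16 (bden k Kl) by exact: bden_tdeg.
  rewrite phE in qC.
  rewrite (evq_cc_cl N_gt0 qC tf q0') (evq_cc_cl N_gt0 qC tk q0').
  exact: (@coprime_char3 k c x0 y0 char3 q0').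
move=> s t sd td; rewrite !redE R0E (m3E Kl) (m3E F0l) => Eq.
have [||| c cd cE] := in_qpoly_lift q3m q3s N_gt0 q3t (d := 16) (e := 14) _ _ _ sd td Eq.
- exact: bden_tdeg.
- exact: bden_tdeg.
- exact: bden_tdeg.
apply: (@lam_obstruction (polyn s) (polyn t) c sd td cd).
by rewrite cE; apply: (congr1 (fun f => _ + c * f)); exact: m3E.
Qed.

End ConcreteIntegralCurve.

(** * Descent of contact forms *)

(** The rank of an integer matrix is the same over all fields of characteristic 0, so a solution
    over k yields a rational one, and its primitive integral multiple is not divisible by 3. *)
Lemma int_kernel (k : numFieldType) (I J : finType) (M : I -> J -> int) (c : I -> k) :
    (exists i, c i != 0) -> (forall j, \sum_i c i * (M i j)%:~R = 0) ->
  exists2 u : I -> int, forall j, \sum_i u i * M i j = 0 & exists i, ~~ (3 %| u i)%Z.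
Proof.
move=> [i0 ci0] cM; pose A : 'M[rat]_(#|I|, #|J|) := \matrix_(i, j) (M (enum_val i) (enum_val j))%:~R.
have kA : kermx A != 0.
  rewrite kermx_eq0; apply/negP => fA.
  have fA' : row_free (map_mx (ratr : rat -> k) A) by rewrite row_free_map.
  have : \row_i c (enum_val i) *m map_mx (ratr : rat -> k) A = 0.
    apply/rowP => j; rewrite !mxE -[RHS](cM (enum_val j)) [RHS](reindex _ (onW_bij _ (enum_val_bij I))).
    by apply: eq_bigr => i _; rewrite !mxE ratr_int.
  move/eqP; rewrite mulmx_free_eq0 // => /eqP/rowP/(_ (enum_rank i0)).
  by rewrite !mxE enum_rankK => /eqP; rewrite (negPf ci0).
have /rowV0Pn[v /sub_kermxP vA v0] := kA.
have [p [a a0 pE]] := rat_poly_scale (rVpoly v).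
pose z := zprimitive p; pose u (i : I) : int := z`_(enum_rank i).
pose b : rat := a%:~R^-1 * (zcontents p)%:~R.
have vE i : v 0 i = b * (z`_i)%:~R.
  have := coef_rVpoly_ord v i; rewrite pE coefZ coef_map /= {1}[p]zpolyEprim coefZ rmorphM /= => <-.
  by rewrite mulrA.
have b0 : b != 0.
  by apply: contraNneq v0 => b0; apply/eqP/rowP => i; rewrite vE b0 mul0r mxE.
have p0 : p != 0.
  by apply: contraNneq b0 => p0; rewrite /b p0 zcontents0 mulr0.
exists u => [j|].
  apply/eqP; rewrite -(intr_eq0 rat) rmorph_sum /= -(mulrI_eq0 _ (mulfI b0)) mulr_sumr; apply/eqP.
  have /rowP/(_ (enum_rank j)) := vA; rewrite !mxE => vA0; apply: etrans vA0.
  rewrite [LHS](reindex _ (onW_bij _ (enum_val_bij I))).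
  by apply: eq_bigr => i _; rewrite !mxE vE /u enum_valK enum_rankK rmorphM mulrA.
apply/existsP; apply: contraT; rewrite negb_exists => /forallP all3.
have : (3 %| zcontents z)%Z.
  rewrite dvdz_contents; apply/polyOverP => i.
  have [lt_i|le_i] := ltnP i #|I|.
    by have := all3 (enum_val (Ordinal lt_i)); rewrite negbK /u enum_valK.
  rewrite nth_default ?dvdz0 //; apply: leq_trans le_i; rewrite /z size_zprimitive.
  have <- : size (rVpoly v) = size p.
    by rewrite pE size_scale ?invr_eq0 ?intr_eq0 // size_map_inj_poly // => ? ? /intr_inj.
  exact: size_poly.
by rewrite /z zcontents_primitive p0.
Qed.

Lemma tdeg_functional_pair (R : comNzRingType) (F : {poly {poly R}} -> R) d f :
    (forall f g, F (f + g) = F f + F g) -> (forall c f, F (c%:P%:P * f) = c * F f) ->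
    tdeg_le d f ->
  F f = \sum_(s : 'I_d.+1 * 'I_d.+1) f`_(s.2)`_(s.1) * F ('X^(s.1)%:P * 'X^(s.2)).
Proof.
move=> FD FZ fd; rewrite (tdeg_functional FD FZ fd).
rewrite -(pair_bigA _ (fun i j : 'I_d.+1 => f`_j`_i * F ('X^i%:P * 'X^j))) exchange_big /=.
apply: eq_bigr => j _; rewrite big_mkcond; apply: eq_bigr => i _.
by case: leqP => // lt_d; rewrite (tdeg_le_coef fd lt_d) mul0r.
Qed.

Lemma qmapX (R S : comNzRingType) (phi : {rmorphism R -> S}) (q : {poly R}) a n :
  q \is monic -> (1 < size q)%N -> qmap phi (a ^+ n) = qmap phi a ^+ n :> {poly %/ (map_poly phi q)}.
Proof.
move=> qm qg; elim: n => [|n IH]; last by rewrite !exprS qmapM // IH.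
by rewrite !expr0 -(rmorph1 (in_qpoly q)) qmap_cl // !rmorph1.
Qed.

Section Descent.

Variables (k : numFieldType) (p3 : {rmorphism int -> 'F_3}) (q gam : {poly {poly int}}) (N : nat).
Hypotheses (q_monic : q \is monic) (q_size : size q = N.+1) (N_gt0 : (0 < N)%N).
Notation mk := (map_poly (map_poly (intmul 1 : {rmorphism int -> k}))).

Let q_gt1 : (1 < size q)%N. Proof. by rewrite q_size. Qed.
Let qkm : mk q \is monic. Proof. exact: map_monic_id. Qed.
Let qks : size (mk q) = N.+1. Proof. by rewrite size_map_monic. Qed.
Let qkg : (1 < size (mk q))%N. Proof. by rewrite qks. Qed.

(** Contact means that in gamma^e C the coefficients of x^0, ..., x^(e-1) vanish in every
    coordinate, which is a linear system over Z in the coefficients of C. *)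
Lemma descend_contact n e (C w : {poly %/ mk q}) : C != 0 -> gr n C ->
    in_qpoly (mk q) (mk gam) ^+ e * C = in_qpoly (mk q) 'X%:P ^+ e * w ->
  exists F w' : {poly %/ q}, [/\ gr n F,
    in_qpoly q gam ^+ e * F = in_qpoly q 'X%:P ^+ e * w' & qmap (map_poly p3) F != 0].
Proof.
move=> C0 Cn CE; pose I := ('I_n.+1 * 'I_n.+1)%type.
pose L (R : comNzRingType) (q' g : {poly {poly R}}) j i f : R :=
  (polyn (in_qpoly q' g ^+ e * in_qpoly q' f))`_j`_i.
have LD (R : comNzRingType) (q' g : {poly {poly R}}) j i f h :
    L R q' g j i (f + h) = L R q' g j i f + L R q' g j i h.
  by rewrite /L in_qpolyD mulrDr poly_of_qpolyD !coefD.
have LZ (R : comNzRingType) (q' g : {poly {poly R}}) j i c f :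
    q' \is monic -> (1 < size q')%N -> L R q' g j i (c%:P%:P * f) = c * L R q' g j i f.
  move=> qm qg; rewrite /L in_qpolyM mulrCA; set z := in_qpoly q' g ^+ e * in_qpoly q' f.
  rewrite -[in LHS](cl_id z) -in_qpolyM cl_small ?coefCM //.
  by rewrite mul_polyC (leq_ltn_trans (size_scale_leq _ _)) //; exact: size_qpoly_lt.
pose mono (R : comNzRingType) (s : I) : {poly {poly R}} := 'X^(s.1)%:P * 'X^(s.2).
pose ok (s : I) := (s.1 + s.2 <= n)%N && (s.2 < N)%N.
(* The first family of equations expresses contact. The second sets to zero the coefficients of
   total degree above n or of degree at least N in y, so that a solution is a canonical
   representative. *)
pose M (s : I) (t : 'I_N * 'I_e + I) : int :=
  match t with inl ji => L int q gam ji.1 ji.2 (mono _ s) | inr s' => ((s == s') && ~~ ok s)%:R end.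
pose c (s : I) : k := (polyn C)`_(s.2)`_(s.1).
have c_ok s : ~~ ok s -> c s = 0.
  rewrite negb_and -!ltnNge /c => /orP[lt_n|le_N]; first by rewrite (tdeg_le_coef Cn).
  rewrite [(polyn C)`_(s.2)]nth_default ?coef0 //.
  by rewrite -ltnS (leq_trans (size_qpoly_lt qkm qkg C)) // qks.
have mapE (S : comNzRingType) (f : {rmorphism int -> S}) j i s :
    L S (map_poly (map_poly f) q) (map_poly (map_poly f) gam) j i (mono _ s) = f (L int q gam j i (mono _ s)).
  rewrite /L -coef_map -coef_map -(val_qmap (map_poly f) q_monic q_gt1).
  have -> : mono S s = map_poly (map_poly f) (mono int s).
    rewrite /mono rmorphM; congr (_ * _); last by rewrite /= map_polyXn.
    by transitivity ((map_poly f 'X^(s.1))%:P); [rewrite map_polyXn|symmetry; exact: map_polyC].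
  by rewrite qmapM // qmapX // !qmap_cl.
have [|j|u uM [s0 us0]] := @int_kernel k _ _ M c.
- have [s cs|c0] := pickP (fun s => c s != 0); first by exists s.
  case/eqP: C0; rewrite -[C]cl_id -(in_qpoly0 (mk q)); congr in_qpoly.
  apply: poly2P => i j; rewrite !coef0.
  have [ij|lt_n] := leqP (i + j) n; last by rewrite (tdeg_le_coef Cn lt_n).
  have i_lt : (i < n.+1)%N by clear -ij; lia.
  have j_lt : (j < n.+1)%N by clear -ij; lia.
  by have /eqP := c0 (Ordinal i_lt, Ordinal j_lt).
- case: j => [[j i]|s'] /=; last first.
    rewrite (bigD1 s') //= eqxx big1 ?addr0 => [|s /negPf ->]; last by rewrite /= mulr0.
    by case: (boolP (ok s')) => [_|/c_ok ->]; rewrite /= ?mul0r ?mulr0.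
  have := congr1 (fun a : {poly %/ mk q} => (polyn a)`_j`_i) CE; rewrite polyn_xM // coefCM coefXnM ltn_ord -{1}[C]cl_id.
  rewrite -/(L k (mk q) (mk gam) j i (polyn C)).
  rewrite (tdeg_functional_pair (LD _ _ _ j i) (fun c f => LZ _ _ _ j i c f qkm qkg) Cn) => E; apply: etrans E.
  by apply: eq_bigr => s _; rewrite -/(mono k s) mapE.
have u_ok s : ~~ ok s -> u s = 0.
  move=> nok; have := uM (inr s); rewrite (bigD1 s) //= eqxx nok mulr1 big1 ?addr0 // => s' /negPf ->.
  by rewrite mulr0.
pose f : {poly {poly int}} := \poly_(j < n.+1) \poly_(i < n.+1) u (inord i, inord j).
have fE (s : I) : f`_(s.2)`_(s.1) = u s.
  by rewrite coef_poly ltn_ord coef_poly ltn_ord !inord_val; case: s.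
have fn : tdeg_le n f.
  apply: tdeg_leE => i j lt_n; rewrite coef_poly; case: ltnP => // lt_j; last by rewrite coef0.
  rewrite coef_poly; case: ltnP => // lt_i; apply: u_ok; rewrite negb_and -ltnNge /= !inordK //.
  by rewrite lt_n.
have fN : (size f < size q)%N.
  rewrite q_size ltnS; apply/leq_sizeP => j le_j; apply/polyP => i; rewrite coef0 coef_poly.
  case: ltnP => // lt_j; last by rewrite coef0.
  rewrite coef_poly; case: ltnP => // lt_i; apply: u_ok; rewrite negb_and -!ltnNge /= !inordK // ltnS.
  by rewrite le_j orbT.
have [i j lt_e|w' wE] := @x_dvd _ q q_monic q_gt1 e (in_qpoly q gam ^+ e * in_qpoly q f).
  have [lt_j|le_j] := ltnP j N; last first.
    rewrite [(polyn _)`_j]nth_default ?coef0 //.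
    by rewrite -ltnS (leq_trans (size_qpoly_lt q_monic q_gt1 _)) // q_size.
  rewrite -/(L int q gam j i f).
  rewrite (tdeg_functional_pair (LD _ _ _ j i) (fun c f => LZ _ _ _ j i c f q_monic q_gt1) fn).
  rewrite -[RHS](uM (inl (Ordinal lt_j, Ordinal lt_e))).
  by apply: eq_bigr => s _; rewrite fE.
exists (in_qpoly q f), w'; split=> //; first by rewrite /gr cl_small.
apply: contraNneq us0 => red0.
have := congr1 (fun a : {poly %/ map_poly (map_poly p3) q} => (polyn a)`_(s0.2)`_(s0.1)) red0.
rewrite val_qmap // cl_small // raddf0 !coef0 coef_map coef_map fE => /(@p3_eq0 p3)[y ->].
by rewrite dvdz_mulr.
Qed.

End Descent.

(** * Homogeneous forms and vanishing orders *)

From mathcomp Require Import freeg mpoly.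

Lemma mmap_homog (n : nat) (R S : comNzRingType) (h : {rmorphism R -> S}) (a : S) (g : 'I_n -> S)
    d (F : {mpoly R[n]}) :
  F \is d.-homog -> mmap h (fun i => a * g i) F = a ^+ d * mmap h g F.
Proof.
move=> /dhomogP Fd; rewrite /mmap mulr_sumr !big_seq; apply: eq_bigr => m /Fd /= dE.
rewrite mulrCA; congr (_ * _); rewrite /mmap1 -dE mdegE -prodrXr -big_split /=.
by apply: eq_bigr => i _; rewrite exprMn.
Qed.

Lemma rmorph_mmap (n : nat) (R S T : comNzRingType) (h : {rmorphism R -> S}) (f : {rmorphism S -> T})
    (g : 'I_n -> S) (F : {mpoly R[n]}) :
  f (mmap h g F) = mmap (f \o h) (f \o g) F.
Proof.
rewrite /mmap rmorph_sum; apply: eq_bigr => m _; rewrite rmorphM; congr (_ * _).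
by rewrite /mmap1 rmorph_prod; apply: eq_bigr => i _; rewrite rmorphXn.
Qed.

Section HomogeneousCharts.

Variable k : closedFieldType.
Notation form := {mpoly k[3]}.
Implicit Types (F : form) (c : bool).

(* Chart [false] is (x : y : 1) and chart [true] is (1 : y : x). *)
Definition chart_coord c (i : 'I_3) : {poly {poly k}} :=
  if i == 1%N :> nat then 'X else if (i == 0%N :> nat) (+) c then 'X%:P else 1.

(** The factor w makes room for normalized coordinates, which are w times the coordinates of the
    chart. *)
Definition dehom (w : k) c : form -> {poly {poly k}} :=
  mmap (polyC \o polyC) (fun i => w%:P%:P * chart_coord c i).

Definition in_chart c (w x y : k) (v : 'I_3 -> k) :=
  w != 0 /\ forall i, v i = w * ev2 x y (chart_coord c i).

HB.instance Definition _ w c := GRing.RMorphism.on (dehom w c).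

Lemma dehom_scale w c d F : F \is d.-homog -> dehom w c F = (w ^+ d)%:P%:P * dehom 1 c F.
Proof.
move=> Fd; rewrite /dehom (mmap_homog _ _ _ Fd) (mmap_homog _ _ _ Fd) mulrA.
by rewrite !polyC1 expr1n mulr1 !polyC_exp.
Qed.

Lemma ev2_dehom w c x y v F : (forall i, v i = w * ev2 x y (chart_coord c i)) ->
  ev2 x y (dehom w c F) = F.@[v].
Proof.
move=> vE; rewrite (rmorph_mmap _ (ev2 x y)) /meval /mmap; apply: eq_bigr => m _.
rewrite /= ev2C hornerC; congr (_ * _); apply: mmap1_eq => i /=.
by rewrite vE ev2M ev2C hornerC.
Qed.

Definition xi c : 'I_3 := if c then ord_max else ord0.
Definition yi : 'I_3 := fintype.lift ord0 ord0.

Lemma coef_dehom c F i j :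
  (dehom 1 c F)`_j`_i = \sum_(m <- msupp F) F@_m * ((m (xi c) == i) && (m yi == j))%:R.
Proof.
rewrite /dehom /mmap !coef_sum; apply: eq_bigr => m _.
rewrite /= !coefCM; congr (_ * _).
have -> : mmap1 (fun i => 1%:P%:P * chart_coord c i) m = 'X^(m (xi c))%:P * 'X^(m yi) :> {poly {poly k}}.
  rewrite /mmap1 !big_ord_recl big_ord0 /chart_coord /= !polyC1 !mul1r mulr1 polyC_exp.
  by rewrite /xi /yi; case: (c) => /=; rewrite expr1n ?mulr1 ?mul1r // mulrC; congr (_ ^+ _ * _); congr (m _); apply: val_inj.
rewrite coefCM !coefXn mulr_natr coefMn coefXn.
by rewrite [i == _]eq_sym [j == _]eq_sym; case: (_ == i); case: (_ == j).
Qed.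

Lemma mdeg3 (m : 'X_{1..3}) c : mdeg m = (m (xi c) + m yi + m (xi (~~ c)))%N.
Proof.
have e : mdeg m = (m ord0 + m yi + m ord_max)%N.
  rewrite mdegE !big_ord_recl big_ord0 addn0 addnA.
  by congr (_ + m _ + m _)%N; apply: val_inj.
by rewrite e /xi; case: c => /=; lia.
Qed.

Lemma dehom_eq0 c d F : F \is d.-homog -> dehom 1 c F = 0 -> F = 0.
Proof.
move=> /dhomogP Fd F0; apply/mpolyP => m; rewrite mcoeff0.
have [mF|] := boolP (m \in msupp F); last by apply: memN_msupp_eq0.
have := coef_dehom c F (m (xi c)) (m yi); rewrite F0 !coef0 (bigD1_seq m) //= !eqxx mulr1.
rewrite big_seq_cond big1 ?addr0 => [-> //|m' /andP[m'F ne]].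
case: eqP => [e1|]; rewrite ?mulr0 //; case: eqP => [e2|]; rewrite ?mulr0 //.
case/eqP: ne; apply/mnmP => i.
have := Fd _ mF; have := Fd _ m'F; rewrite /= !(mdeg3 _ c) e1 e2 => <- /eqP.
rewrite eqn_add2l => /eqP e3.
have [->|[->|->]] // : i = xi c \/ i = yi \/ i = xi (~~ c).
by case: i => [[|[|[|//]]] lti]; rewrite /xi; case: c {e1 e2 e3 F0} => /=;
  [right;right|left|right;left|right;left|left|right;right]; apply: val_inj.
Qed.

Lemma dehom_tdeg d F : F \is d.-homog -> tdeg_le d (dehom 1 false F).
Proof.
move=> /dhomogP Fd; apply: tdeg_leE => i j lt_d; rewrite coef_dehom big_seq big1 // => m /Fd /=.
rewrite (mdeg3 _ false) => dE; case: eqP => [e1|]; rewrite ?mulr0 //; case: eqP => [e2|]; rewrite ?mulr0 //.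
by move: lt_d; rewrite -dE e1 e2 ltnNge leq_addr.
Qed.

Lemma dehom_chart c d F : F \is d.-homog -> dehom 1 c F = chart c d (dehom 1 false F).
Proof.
case: c => // Fd; apply: poly2P => i j; rewrite /= coef_flip !coef_dehom.
move/dhomogP: Fd => Fd; case: ifP => [ij|/negbT ij]; last first.
  rewrite big_seq big1 // => m /Fd; rewrite /= (mdeg3 _ true) => dE.
  case: eqP => [e1|]; rewrite ?mulr0 //; case: eqP => [e2|]; rewrite ?mulr0 //.
  by case/negP: ij; rewrite -dE e1 e2 leq_addr.
rewrite big_seq [RHS]big_seq; apply: eq_bigr => m /Fd; rewrite /= (mdeg3 _ true) /= => dE.
congr (_ * (nat_of_bool _)%:R); case: (m yi =P j) => [e2|]; rewrite ?andbF // !andbT.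
by apply/eqP/eqP; clear -e2 ij dE; lia.
Qed.

Definition hom c D (f : {poly {poly k}}) : form :=
  \sum_(j < size f) \sum_(i < size f`_j)
    f`_j`_i *: ('X_(xi c) ^+ i * 'X_yi ^+ j * 'X_(xi (~~ c)) ^+ (D - i - j)).

Lemma hom_homog c D f : tdeg_le D f -> hom c D f \is D.-homog.
Proof.
move=> fD; apply: rpred_sum => j _; apply: rpred_sum => i _.
have [ij|lt_D] := leqP (i + j) D; last by rewrite (tdeg_le_coef fD lt_D) scale0r rpred0.
apply: rpredZ; rewrite !mpolyXn -!mpolyXD dhomogX /= !mdegD !mdegMn !mdeg1 !mul1n.
by rewrite -subnDA subnKC.
Qed.

Lemma dehom_hom c D f : dehom 1 c (hom c D f) = f.
Proof.
have dZ a (F : form) : dehom 1 c (a *: F) = a%:P%:P * dehom 1 c F by exact: mmapZ.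
have dX i : dehom 1 c 'X_i = chart_coord c i.
  by rewrite /dehom mmapX mmap1U !polyC1 mul1r.
rewrite /hom rmorph_sum.
transitivity (\sum_(j < size f) \sum_(i < size f`_j) (f`_j`_i)%:P%:P * ('X%:P ^+ i * 'X ^+ j)).
  apply: eq_bigr => j _; rewrite rmorph_sum; apply: eq_bigr => i _.
  rewrite /= dZ !rmorphM !rmorphXn /= !dX; congr (_ * _).
  by rewrite /chart_coord /xi; case: (c); rewrite /= expr1n mulr1.
rewrite -[f in RHS]coefK poly_def; apply: eq_bigr => j _.
rewrite -mul_polyC.
transitivity ((\sum_(i < size f`_j) (f`_j`_i)%:P * 'X^i)%:P * 'X^j); last first.
  congr (polyC _ * _); rewrite -[RHS]coefK poly_def; apply: eq_bigr => i _.
  by rewrite mul_polyC.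
rewrite raddf_sum mulr_suml; apply: eq_bigr => i _ /=.
by rewrite polyCM polyC_exp mulrA.
Qed.

Lemma meval_chart c w x y v lam D F : in_chart c w x y v -> F \is D.-homog ->
  F.@[fun i => lam * v i] = (lam * w) ^+ D * ev2 x y (dehom 1 c F).
Proof.
move=> [w0 vE] FD; rewrite (@ev2_dehom 1 c x y (fun i => ev2 x y (chart_coord c i))); last by move=> i; rewrite mul1r.
rewrite /meval -(mmap_homog _ _ _ FD); rewrite /mmap; apply: eq_bigr => m _; congr (_ * _).
by apply: mmap1_eq => i; rewrite vE mulrA.
Qed.

End HomogeneousCharts.

Section PointOrder.

Variables (f : {mpoly rat[2]}) (q : {poly {poly algC}}) (N : nat).
Hypotheses (N_gt0 : (0 < N)%N) (qC : plane_curve q N).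
Hypothesis q_smooth : forall c, smooth (chart c N q).
Hypotheses (fh : curve_form f \is N.-homog) (fq : dehom 1 false (curve_form f) = q).
Variables (P : point f) (c : bool) (w x y : algC) (p : {poly %/ chart c N q}).
Hypotheses (Pc : in_chart c w x y (val P)) (pu : uniformizer x y p).
Notation qc := (chart c N q).
Notation cl := (in_qpoly qc).
Let qm := chart_monic N_gt0 qC c.
Let qg := chart_gt1 N_gt0 qC c.
Let dom : qdomain qc := chart_domain N_gt0 qC q_smooth (c := c).

Lemma dehom_curve : dehom 1 c (curve_form f) = qc.
Proof. by rewrite (dehom_chart c fh) fq. Qed.

Let w0 : w != 0. Proof. by case: Pc. Qed.
Let ev_v F : ev2 x y (dehom w c F) = F.@[val P].
Proof. by apply: ev2_dehom; case: Pc. Qed.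

Lemma ev2_curve : ev2 x y qc = 0.
Proof.
have := valP P => /andP[_ /eqP]; rewrite -ev_v (dehom_scale _ _ fh) dehom_curve ev2M ev2C hornerC.
by move/eqP; rewrite mulf_eq0 expf_eq0 (negPf w0) andbF => /eqP.
Qed.

Let q0 := ev2_curve.

(** A form in the ideal of the point dehomogenizes to an element vanishing there, hence to a
    multiple of p after multiplication by the common denominator s0. A sum of products of n such
    forms thus becomes a multiple of p^n with the single denominator s0^n. *)
Lemma vanishing_le_ord n m d F : F \is d.-homog -> vanishes_to_order P n F ->
  ordat x y p (cl (dehom 1 c F)) m -> (n <= m)%N.
Proof.
move=> Fd [S [B [S0 [s sI E]]]] [s1 [u1 [s10 u10 om]]].
have [p0 [s0 s00 sP] _] := pu.
have [b bE] : exists b, s0 ^+ n * cl (dehom w c (\sum_(t <- s) t.1 * \prod_(i < n) tnth t.2 i)) = p ^+ n * b.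
  elim: s sI {E} => [|t s IH] sI.
    by exists 0; rewrite big_nil rmorph0 in_qpoly0 !mulr0.
  have [|b bE] := IH; first by move=> t' t's; apply: sI; rewrite inE t's orbT.
  have tI i : exists b, s0 * cl (dehom w c (tnth t.2 i)) = p * b.
    apply: sP; rewrite (evq_cl qm qg _ q0) ev_v.
    by have := sI t (mem_head _ _) i 1; apply: etrans; apply: eq_bigr => m' _; congr (_ * _); apply: mmap1_eq => j; rewrite mul1r.
  have [h hE] := fin_all_exists tI.
  exists (cl (dehom w c t.1) * \prod_(i < n) h i + b).
  rewrite big_cons rmorphD in_qpolyD mulrDr bE mulrDr; congr (_ + _).
  rewrite rmorphM rmorph_prod in_qpolyM rmorph_prod mulrCA [RHS]mulrCA; congr (_ * _).
  have cE (a : {poly %/ qc}) : a ^+ n = \prod_(i < n) a by rewrite prodr_const card_ord.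
  rewrite !cE -!big_split; apply: eq_bigr => i _ /=; exact: hE.
rewrite leqNgt; apply/negP => lt_mn.
have /(congr1 cl) := congr1 (dehom w c) E.
have dM G G' : dehom w c (G * G') = dehom w c G * dehom w c G' by exact: rmorphM.
have dB G G' : dehom w c (G - G') = dehom w c G - dehom w c G' by exact: rmorphB.
rewrite dB !dM (dehom_scale w c Fd) (dehom_scale w c fh) dehom_curve.
rewrite in_qpolyB !in_qpolyM (cl_q qm qg) !mulr0 subr0 => {}E.
pose W := cl (w ^+ d)%:P%:P.
have W0 : evq x y W != 0 by rewrite (evq_cl qm qg _ q0) ev2C hornerC expf_neq0.
have S0' : evq x y (cl (dehom w c S)) != 0 by rewrite (evq_cl qm qg _ q0) ev_v.
have : p ^+ m * (s0 ^+ n * cl (dehom w c S) * W * u1) = p ^+ m * (p ^+ (n - m) * b * s1).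
  have -> : p ^+ m * (p ^+ (n - m) * b * s1) = p ^+ m * p ^+ (n - m) * b * s1 by ring.
  rewrite -exprD subnKC 1?ltnW // -bE -E -/W.
  have -> : p ^+ m * (s0 ^+ n * cl (dehom w c S) * W * u1) =
    s0 ^+ n * cl (dehom w c S) * W * (u1 * p ^+ m) by ring.
  by rewrite -om; ring.
have pm0 : p ^+ m != 0 by apply: (qdom_expf_neq0 dom); apply: (unif_neq0 qm qg dom q0 pu).
move/(qdom_mulfI dom pm0)/(congr1 (evq x y)).
rewrite !(evqM qm qg _ _ q0) !(evqX qm qg _ _ q0) p0 expr0n subn_eq0 leqNgt lt_mn /= !mul0r.
move/eqP; apply/negP; rewrite !mulf_neq0 ?expf_neq0 //.
Qed.

(** The local equation s F = u p^m + e q is homogenized in a degree D large enough for all its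
    terms, and the homogenization of p lies in the ideal of the point. *)
Lemma ord_vanishing n m d F : F \is d.-homog -> ordat x y p (cl (dehom 1 c F)) m -> (n <= m)%N ->
  vanishes_to_order P n F.
Proof.
move=> Fd [s [u [s0 u0 E]]] le_nm.
have [e eE] : exists e : {poly {poly algC}},
    qpoly.polyn s * dehom 1 c F = qpoly.polyn u * qpoly.polyn p ^+ m + e * qc.
  by apply/(cl_eq qm qg); rewrite !in_qpolyM in_qpolyX !cl_id.
have [d1 t1] := tdeg_le_exists (qpoly.polyn s); have [d2 t2] := tdeg_le_exists (qpoly.polyn u).
have [d3 t3] := tdeg_le_exists (qpoly.polyn p); have [d4 t4] := tdeg_le_exists e.
pose T := (d1 + d2 + d3 + d4)%N; pose D := (T + d + N + m * T)%N.
pose S := hom c (D - d) (qpoly.polyn s); pose U := hom c (D - m * T) (qpoly.polyn u).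
pose H := hom c T (qpoly.polyn p); pose E' := hom c (D - N) e.
have Sd : S \is (D - d).-homog by apply: hom_homog; apply: tdeg_leW t1; rewrite /D /T; clear; lia.
have Ud : U \is (D - m * T).-homog by apply: hom_homog; apply: tdeg_leW t2; rewrite /D /T; clear; lia.
have Hd : H \is T.-homog by apply: hom_homog; apply: tdeg_leW t3; rewrite /T; clear; lia.
have Ed : E' \is (D - N).-homog by apply: hom_homog; apply: tdeg_leW t4; rewrite /D /T; clear; lia.
have eqn : S * F - E' * curve_form f = U * H ^+ m.
  apply/eqP; rewrite -subr_eq0; apply/eqP; apply: (@dehom_eq0 _ c D).
    have e1 : D = (D - d + d)%N by rewrite /D; clear; lia.
    have e2 : D = (D - N + N)%N by rewrite /D; clear; lia.
    have e3 : D = (D - m * T + T * m)%N by rewrite /D; clear; lia.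
    apply: rpredB; first apply: rpredB.
    - by rewrite {1}e1; apply: dhomogM.
    - by rewrite {1}e2; apply: dhomogM.
    - by rewrite {1}e3; apply: dhomogM => //; apply: dhomogMn.
  have dM G G' : dehom 1 c (G * G') = dehom 1 c G * dehom 1 c G' by exact: rmorphM.
  have dB G G' : dehom 1 c (G - G') = dehom 1 c G - dehom 1 c G' by exact: rmorphB.
  have dX G i : dehom 1 c (G ^+ i) = dehom 1 c G ^+ i by exact: rmorphXn.
  rewrite !dB !dM dX /S /U /H /E' !dehom_hom dehom_curve eE.
  by rewrite addrK subrr.
exists S, E'; split.
  have := meval_chart 1 Pc Sd; rewrite /S dehom_hom => sE.
  have -> : S.@[val P] = (1 * w) ^+ (D - d) * ev2 x y (qpoly.polyn s).
    by rewrite -sE; apply: eq_bigr => m' _; congr (_ * _); apply: mmap1_eq => j; rewrite mul1r.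
  by rewrite mulf_neq0 // expf_neq0 // mul1r.
exists [:: (U * H ^+ (m - n), [tuple of nseq n H])].
  move=> t; rewrite inE => /eqP-> i lam; rewrite tnth_nseq (meval_chart _ Pc Hd) /H dehom_hom.
  by case: pu => p0 _ _; rewrite -[ev2 x y _]/(evq x y p) p0 mulr0.
rewrite big_seq1 eqn -mulrA /= (eq_bigr (fun=> H)) => [|i _]; last by rewrite tnth_nseq.
by rewrite prodr_const card_ord -exprD subnK.
Qed.

Lemma not_vanishing_neq0 d F : F \is d.-homog -> ~ vanishes_on_curve f F ->
  in_qpoly q (dehom 1 false F) != 0.
Proof.
move=> Fd nv; apply/eqP => F0; apply: nv.
have qm' := curve_monic qC; have qs := curve_size qC; have qt := curve_tdeg qC.
have [e [r [rE sr _ ed e0]]] := tdeg_le_divE qm' qs N_gt0 qt (dehom_tdeg Fd).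
have qg' : (1 < size q)%N by rewrite qs.
have r0 : r = 0.
  have : in_qpoly q r = 0.
    by have := congr1 (in_qpoly q) rE; rewrite F0 in_qpolyD in_qpolyM (cl_q qm' qg') mulr0 addr0.
  by move/(congr1 (fun a => qpoly.polyn a)); rewrite cl_small // raddf0.
rewrite r0 add0r in rE; have [lt_d|le_N] := ltnP d N.
  exists 0; rewrite mul0r; apply: (dehom_eq0 (c := false) Fd).
  by rewrite rE e0 // mul0r.
exists (hom false (d - N) e); apply/eqP; rewrite -subr_eq0; apply/eqP.
have dM G G' : dehom 1 false (G * G') = dehom 1 false G * dehom 1 false G' by exact: rmorphM.
have dB G G' : dehom 1 false (G - G') = dehom 1 false G - dehom 1 false G' by exact: rmorphB.
apply: (@dehom_eq0 _ false d); last by rewrite dB dM dehom_hom fq rE subrr.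
have := dhomogM (hom_homog false ed) fh; rewrite subnK // => ehd.
exact: rpredB Fd ehd.
Qed.

Lemma has_order_ord d F n : F \is d.-homog -> ~ vanishes_on_curve f F -> has_order P F n ->
  ordat x y p (cc N c d (in_qpoly q (dehom 1 false F))) n.
Proof.
move=> Fd nv [vn nvn]; have F0 := not_vanishing_neq0 Fd nv.
have Fg : gr d (in_qpoly q (dehom 1 false F)).
  exact: (gr_cl (curve_monic qC) (curve_size qC) N_gt0 (curve_tdeg qC)) (dehom_tdeg Fd).
have [m om] := ord_exists qm qg dom q0 pu (cc_neq0 N_gt0 qC c Fg F0).
have ccE : cc N c d (in_qpoly q (dehom 1 false F)) = cl (dehom 1 c F).
  rewrite /cc (dehom_chart c Fd); apply: (chart_cl_eq N_gt0 qC) => //; last by rewrite cl_id.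
  exact: dehom_tdeg.
rewrite ccE in om *; suff -> : n = m by [].
have le_nm := vanishing_le_ord Fd vn om.
apply/eqP; rewrite eqn_leq le_nm leqNgt; apply/negP => lt_nm.
exact: nvn (ord_vanishing Fd om lt_nm).
Qed.

End PointOrder.

(** * The fiber over x = 0 *)

Lemma prod_XsubC_count (k : fieldType) (rs : seq k) r : exists2 h : {poly k}, h.[r] != 0 &
  \prod_(s <- rs) ('X - s%:P) = ('X - r%:P) ^+ (count_mem r rs) * h.
Proof.
elim: rs => [|s rs [h hr E]]; first by exists 1; rewrite ?hornerC ?oner_neq0 // big_nil mulr1.
rewrite big_cons E /=; have [->|ne] := eqVneq s r; first by exists h; rewrite // exprS mulrA.
exists (('X - s%:P) * h); last by rewrite add0n mulrCA.
by rewrite hornerM hornerXsubC mulf_neq0 // subr_eq0 eq_sym.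
Qed.

Section ContactForm.

Variables (k : closedFieldType) (q gam bet : {poly {poly k}}) (N : nat) (g0 : {poly k}) (rs : seq k).
Hypotheses (N_gt0 : (0 < N)%N) (qC : plane_curve q N).
Hypothesis q_smooth : forall c, smooth (chart c N q).
Hypothesis qE : q = 'X * gam + 'X%:P * bet.
Hypotheses (gamE : gam = map_poly polyC g0) (g00 : g0.[0] != 0).
Hypothesis rsE : 'X * g0 = \prod_(r <- rs) ('X - r%:P).
Notation A := {poly %/ q}.
Notation cl := (in_qpoly q).
Let qm := curve_monic qC.
Let qg : (1 < size q)%N. Proof. by rewrite (curve_size qC). Qed.
Let dom : qdomain q := chart_domain N_gt0 qC q_smooth (c := false).
Let x := cl 'X%:P.
Let y := cl 'X.
Let g := cl gam.
Let b := cl bet.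

Let ev2_col (u v : k) (f : {poly k}) : ev2 u v (map_poly polyC f) = f.[v].
Proof. by rewrite /ev2 horner_map hornerC. Qed.

Let xy_rel : y * g = - (x * b).
Proof.
apply/eqP; rewrite -addr_eq0 -!in_qpolyM -in_qpolyD -qE; apply/eqP; exact: cl_q.
Qed.

Let ev2_deriv_fiber (r : k) : ev2 0 r q^`() = ('X * g0)^`().[r].
Proof.
have -> : ('X * g0)^`().[r] = ev2 0 r (map_poly polyC ('X * g0)^`()) by rewrite ev2_col.
rewrite qE -deriv_map rmorphM /= map_polyX -gamE derivD (derivM 'X%:P) derivC mul0r add0r.
by rewrite (rmorphD (ev2 0 r)) /= ev2M ev2C hornerX mul0r addr0.
Qed.

(** At a multiple root r the derivative in y vanishes, so by smoothness beta does not. Then y gamma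
    = - x beta on the curve equates (y - r)^e with x up to units, and y - r vanishes at the
    point. *)
Lemma fiber_multiplicity_le_ord r p m : ev2 0 r q = 0 -> uniformizer 0 r p ->
  ordat 0 r p x m -> (count_mem r rs <= m)%N.
Proof.
move=> q0 pu om; have [h hr hE] := prod_XsubC_count rs r; move: (count_mem r rs) hE => e hE.
case: e hE => [//|e] hE.
have m1 : (0 < m)%N.
  case: m om => // /(ord0_unit qm qg q0); rewrite evq_cl // ev2C hornerX eqxx //.
case: e hE => [//|e] hE.
have dq : ev2 0 r q^`() = 0.
  rewrite ev2_deriv_fiber rsE hE exprS -mulrA derivM hornerD !hornerM hornerXsubC subrr mul0r addr0.
  by rewrite exprS hornerM hornerXsubC subrr !mul0r mulr0.
have b0 : evq 0 r b != 0.
  have := @q_smooth false 0 r q0; rewrite /= dq eqxx; case=> //; rewrite evq_cl // qE.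
  rewrite dXD !dXM gamE -[X in dX (map_poly polyC X)](coefK g0).
  have -> : dX (map_poly polyC (\poly_(i < size g0) g0`_i)) = 0.
    by rewrite coefK; apply: poly2P => i j; rewrite coef_dX coef_map /= derivC !coef0.
  have -> : dX 'X = 0 :> {poly {poly k}}.
    by apply: poly2P => i j; rewrite coef_dX coefX -polyC_natr derivC !coef0.
  have evD u v : ev2 0 r (u + v) = ev2 0 r u + ev2 0 r v by exact: rmorphD.
  by rewrite mul0r mulr0 !add0r dXC derivX polyC1 mul1r evD ev2M ev2C hornerX mul0r addr0.
have fib : py q r ^+ e.+2 * cl (map_poly polyC h) = - (x * b).
  have fibE : 'X * map_poly polyC g0 = ('X - r%:P%:P) ^+ e.+2 * map_poly polyC h.
    transitivity (map_poly polyC ('X * g0)); first by rewrite rmorphM /= map_polyX.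
    by rewrite rsE hE rmorphM; congr (_ * _); rewrite rmorphXn /= map_polyXsubC.
  by rewrite -xy_rel -in_qpolyX -!in_qpolyM gamE fibE.
have ob := ord_unit qm qg p q0 b0.
have h0 : evq 0 r (cl (map_poly polyC h)) != 0 by rewrite evq_cl // ev2_col.
have py0 : py q r != 0.
  apply/eqP => E; move: fib; rewrite E expr0n mul0r => /esym/eqP; rewrite oppr_eq0; apply/negP.
  exact: (qdom_mulf_neq0 dom (ord_neq0 qm qg dom q0 pu om) (ord_neq0 qm qg dom q0 pu ob)).
have [l ol] := ord_exists qm qg dom q0 pu py0.
have l1 : (0 < l)%N.
  by case: l ol => // /(ord0_unit qm qg q0); rewrite evq_py // eqxx.
have := ordM qm qg q0 (ordX qm qg q0 e.+2 ol) (ord_unit qm qg p q0 h0); rewrite fib addn0.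
rewrite -mulN1r; have -> : -1 = cl (-1)%:P%:P :> A by rewrite !polyCN !polyC1 rmorphN1.
move=> o1; have uN : evq 0 r (cl (-1)%:P%:P) != 0.
  by rewrite evq_cl // ev2C hornerC oppr_eq0 oner_eq0.
have := ordM qm qg q0 (ord_unit qm qg p q0 uN) (ordM qm qg q0 om ob); rewrite add0n addn0.
move/(ord_uniq qm qg dom q0 pu o1) <-.
by rewrite -{1}[e.+2]muln1 leq_mul2l l1 orbT.
Qed.

Let q0P : ev2 0 0 q = 0.
Proof. by rewrite qE (rmorphD (ev2 0 0)) /= !ev2M ev2X ev2C hornerX !mul0r addr0. Qed.

Let qy0P : ev2 0 0 q^`() != 0.
Proof. by rewrite ev2_deriv_fiber derivM derivX mul1r hornerD hornerM hornerX mul0r addr0. Qed.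

Lemma origin_multiplicity : (count_mem (0%R : k) rs <= 1)%N.
Proof.
have [h hr hE] := prod_XsubC_count rs 0; move: (count_mem (0%R : k) rs) hE => [|[|e]] // hE.
case/eqP: qy0P; rewrite ev2_deriv_fiber rsE hE exprS -mulrA derivM hornerD !hornerM hornerXsubC subrr mul0r addr0.
by rewrite exprS hornerM hornerXsubC subrr !mul0r mulr0.
Qed.

(** The derivative in y does not vanish at the origin, so x itself is a uniformizer there. *)
Lemma origin_ord p m : uniformizer 0 0 p -> ordat 0 0 p x m -> (m <= 1)%N.
Proof.
move=> pu om; have [p0 _ _] := pu.
have [_ [s s0 sP] _] := uniformizer_px qm qg q0P qy0P.
have [c cE] := sP p p0.
have pxE : px q 0 = x by rewrite /px /x subr0.
rewrite pxE in cE.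
have op : ordat 0 0 p p 1.
  by exists 1, 1; rewrite !evq1 // oner_neq0 expr1 mul1r.
have := ordM qm qg q0P (ord_unit qm qg p q0P s0) op; rewrite cE add0n => o1.
have c0 : c != 0.
  apply: contraNneq (ord_neq0 qm qg dom q0P pu o1) => ->.
  by rewrite mulr0.
have [l ol] := ord_exists qm qg dom q0P pu c0.
by rewrite (ord_uniq qm qg dom q0P pu o1 (ordM qm qg q0P om ol)) leq_addr.
Qed.

Definition fiber_mult c (x0 y0 : k) := if ~~ c && (x0 == 0) then count_mem y0 rs else 0%N.

(** If F / G has as divisor n times N P minus the fiber, then x^n F / G has no poles, since x
    vanishes on the fiber. It is the form C of degree n, and its order at P is at least N n. *)
Lemma contact_form_exists n d (F G : A) : gr d F -> gr d G -> F != 0 -> G != 0 ->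
    (forall c x0 y0 p i j, ev2 x0 y0 (chart c N q) = 0 -> uniformizer x0 y0 p ->
       ordat x0 y0 p (cc N c d F) i -> ordat x0 y0 p (cc N c d G) j ->
       (i + n * fiber_mult c x0 y0 = j + N * n * [&& ~~ c, x0 == 0%R & y0 == 0%R])%N) ->
  exists C w : A, [/\ C != 0, gr n C & g ^+ (N * n) * C = x ^+ (N * n) * w].
Proof.
move=> Fd Gd F0 G0 ords; have x0' : x != 0 by exact: (x_neq0 N_gt0 qC).
have xd : gr 1 x.
  apply: (gr_cl qm (curve_size qC) N_gt0 (curve_tdeg qC)).
  by apply: tdeg_leC; rewrite size_polyX.
have xnd : gr (n * 1) (x ^+ n) := grX qm (curve_size qC) N_gt0 (curve_tdeg qC) n xd.
have xFd := grM qm (curve_size qC) N_gt0 (curve_tdeg qC) xnd Fd.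
have xF0 : x ^+ n * F != 0 by exact: (qdom_mulf_neq0 dom (qdom_expf_neq0 dom n x0') F0).
have xord c u v (p : {poly %/ chart c N q}) i : ev2 u v (chart c N q) = 0 -> uniformizer u v p ->
    ordat u v p (cc N c 1 x) i -> (fiber_mult c u v <= i)%N.
  rewrite /fiber_mult; case: c p => //= p quv pu; case: eqP => // u0.
  rewrite /cc cl_id u0 in quv pu * => ox.
  exact: fiber_multiplicity_le_ord quv pu ox.
have [|c u v p i j quv pu oi oj|C Cd CE] := gdvd N_gt0 qC q_smooth xFd Gd _ xF0 G0.
- by rewrite leq_addl.
- have [l ol] := pord_ex N_gt0 qC q_smooth quv pu xd x0'.
  have [m om] := pord_ex N_gt0 qC q_smooth quv pu Fd F0.
  have := pordM N_gt0 qC quv xnd Fd (pordX N_gt0 qC quv n xd ol) om.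
  move=> /(pord_uniq N_gt0 qC q_smooth quv pu oi) ->.
  have := ords c u v p m j quv pu om oj; have := xord c u v p l quv pu ol.
  by move: (fiber_mult _ _ _) => e; clear; nia.
rewrite muln1 addnK in Cd.
have C0 : C != 0 by apply: contraNneq xF0 => C0; rewrite CE C0 mul0r.
have g_neq0 : g != 0.
  apply/eqP => /(congr1 (evq 0 0)); rewrite evq_cl // gamE ev2_col evq0 => /eqP.
  by rewrite (negPf g00).
have gC0 := qdom_mulf_neq0 dom (qdom_expf_neq0 dom (N * n) g_neq0) C0.
have xN0 := qdom_expf_neq0 dom (N * n) x0'.
have [u v p i j quv pu oi oj|w wE] := dvd_by_ord qm qg dom (@q_smooth false) gC0 xN0; last first.
  by exists C, w; rewrite wE mulrC.
have [ox oxE] := ord_exists qm qg dom quv pu x0'.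
rewrite (ord_uniq qm qg dom quv pu oj (ordX qm qg quv (N * n) oxE)).
have [og ogE] := ord_exists qm qg dom quv pu g_neq0.
have [oC oCE] := ord_exists qm qg dom quv pu C0.
rewrite (ord_uniq qm qg dom quv pu oi (ordM qm qg quv (ordX qm qg quv (N * n) ogE) oCE)).
have [oF oFE] := ord_exists qm qg dom quv pu F0.
have [oG oGE] := ord_exists qm qg dom quv pu G0.
have := ordM qm qg quv (ordX qm qg quv n oxE) oFE; rewrite CE.
move=> /(ord_uniq qm qg dom quv pu (ordM qm qg quv oCE oGE)) ordE.
have := ords false u v p oF oG quv pu; rewrite /cc !cl_id => /(_ oFE oGE).
have [u0|u0] := eqVneq u 0; last first.
  have := ord_unit qm qg p quv (a := x); rewrite evq_cl // ev2C hornerX => /(_ u0).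
  by move=> /(ord_uniq qm qg dom quv pu oxE) ->; rewrite muln0.
(* Over x = 0 and off the origin y is a unit, so y g = - x b shows that g vanishes at least as much
   as x. *)
have [v0|v0] := eqVneq v 0; last first.
  have y0 : evq u v y != 0 by rewrite evq_cl // ev2X.
  have := ordM qm qg quv (ord_unit qm qg p quv y0) ogE; rewrite add0n xy_rel => og'.
  have b_neq0 : b != 0.
    apply: contraNneq (ord_neq0 qm qg dom quv pu og') => ->.
    by rewrite mulr0 oppr0.
  have [ob obE] := ord_exists qm qg dom quv pu b_neq0.
  have uN : evq u v (cl (-1)%:P%:P) != 0.
    by rewrite evq_cl // ev2C hornerC oppr_eq0 oner_eq0.
  have := ordM qm qg quv (ord_unit qm qg p quv uN) (ordM qm qg quv oxE obE); rewrite add0n.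
  have -> : cl (-1)%:P%:P * (x * b) = - (x * b) by rewrite !polyCN !polyC1 rmorphN1 mulN1r.
  move/(ord_uniq qm qg dom quv pu og') => -> _.
  by rewrite mulnDr -addnA leq_addr.
rewrite /fiber_mult u0 v0 eqxx /= muln1; rewrite u0 v0 in pu oxE *.
have := origin_multiplicity; have := origin_ord pu oxE.
move: (count_mem (0%R : k) rs) => e; clear -ordE; move: (N * n)%N => M.
case: ox ordE => [|[|//]] ordE _; first by rewrite muln0.
by move: (M * og)%N => t; case: e => [|[|//]] _; lia.
Qed.

End ContactForm.

(** * The curve calQ *)

Section Horner.

Variable S : comNzRingType.
Implicit Types (x y : S).

Definition zhorner x (l : seq Z) : S := foldr (fun z acc => acc * x + zden S z) 0 l.
Definition bhorner x y (a : seq (seq Z)) : S := foldr (fun l acc => acc * y + zhorner x l) 0 a.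

End Horner.

Lemma bden_horner (R : comNzRingType) a : bden R a = bhorner 'X%:P 'X a.
Proof.
have uE l : (uden R l)%:P = zhorner 'X%:P l.
  elim: l => //= z l IH; rewrite -[uden R (z :: l)]/(uden R l * 'X + (zden R z)%:P) polyCD polyCM IH.
  by congr (_ + _); rewrite /zden !rmorph_int.
by elim: a => //= l a IH; rewrite -[bden R (l :: a)]/(bden R a * 'X + (uden R l)%:P) IH uE.
Qed.

(** The equation in an arbitrary ring, so that its image under a morphism can be compared with the
    list [Ql] by [ring] instead of by computing with multinomials. *)
Definition calQ_expr (R : comNzRingType) (x y : R) : R :=
    x^+11*y - x^+7*y^+5 - x^+6*y^+6 - x^+4*y^+8 + x*y^+11 + y^+12
  + x^+11 - x^+10*y + x^+8*y^+3 - x^+6*y^+5 + x^+5*y^+6 + x^+3*y^+8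
    - x^+2*y^+9 - x*y^+10 + y^+11
  + x^+10 + x^+9*y - x^+8*y^+2 + x^+7*y^+3 + x^+6*y^+4 + x^+5*y^+5
    - x^+4*y^+6 + x*y^+9 + y^+10
  - x^+9 + x^+8*y + x^+7*y^+2 + x^+6*y^+3 + x^+5*y^+4
    + x^+4*y^+5 + x^+3*y^+6 - x^+2*y^+7 + y^+9
  + x^+8 - x^+7*y + x^+6*y^+2 - x^+5*y^+3 + x*y^+7 + y^+8
  + x^+7 + x^+6*y + x^+5*y^+2 - x^+2*y^+5 - x*y^+6 + y^+7
  - x^+6 - x^+4*y^+2 - x^+2*y^+4 + x*y^+5
  - x^+5 + x^+3*y^+2 - x^+2*y^+3 + y^+5
  - x^+4 + x^+3*y + x^+2*y^+2 + x*y^+3 + y^+4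
  - x^+2*y - x*y^+2 + y^+3
  - x^+2 - x*y
  + x + y.

Lemma calQ_expr_morph (R S : comNzRingType) (g : {rmorphism R -> S}) x y :
  g (calQ_expr x y) = calQ_expr (g x) (g y).
Proof. by rewrite /calQ_expr !(rmorphXn, rmorphD, rmorphN, rmorphM). Qed.

Lemma calQ_expr_horner (S : comNzRingType) (x y : S) : calQ_expr x y = bhorner x y Ql.
Proof.
have z1 : zden S (Zpos 1) = 1 by [].
have zN1 : zden S (Zneg 1) = -1 by [].
let q := eval vm_compute in Ql in change Ql with q.
rewrite /bhorner /zhorner; cbn [foldr]; rewrite !zden0 !z1 !zN1 /calQ_expr; ring.
Qed.

Lemma calQ_horner (S : comNzRingType) (g : {rmorphism {mpoly rat[2]} -> S}) :
  g calQ = bhorner (g 'X_0) (g 'X_1) Ql.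
Proof. by rewrite -calQ_expr_horner -calQ_expr_morph. Qed.

Section AffineEquation.

Variable f : {mpoly rat[2]}.
Notation aff := (mmap ((polyC \o polyC) \o (ratr : rat -> algC))
  (fun i : 'I_2 => if i == 0%N :> nat then 'X%:P else 'X : {poly {poly algC}})).

Lemma coef_aff i j : (aff f)`_j`_i = \sum_(m <- msupp f) ratr f@_m * ((m ord0 == i) && (m ord_max == j))%:R.
Proof.
rewrite /mmap !coef_sum; apply: eq_bigr => m _.
rewrite /= !coefCM; congr (_ * _).
have -> : mmap1 (fun i : 'I_2 => if i == 0%N :> nat then 'X%:P else 'X : {poly {poly algC}}) m
    = 'X^(m ord0)%:P * 'X^(m ord_max).
  rewrite /mmap1 !big_ord_recl big_ord0 /= mulr1 polyC_exp; congr (_ * _ ^+ m _).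
  exact: val_inj.
rewrite coefCM !coefXn mulr_natr coefMn coefXn.
by rewrite [i == _]eq_sym [j == _]eq_sym; case: (_ == i); case: (_ == j).
Qed.

Let mdeg2 (m : 'X_{1..2}) : mdeg m = (m ord0 + m ord_max)%N.
Proof. by rewrite mdegE !big_ord_recl big_ord0 addn0; congr (_ + m _)%N; apply: val_inj. Qed.

Lemma msize_aff d : tdeg_le d (aff f) -> (aff f)`_d`_0 != 0 -> msize f = d.+1.
Proof.
move=> fd f0; apply/eqP; rewrite eqn_leq; apply/andP; split.
  rewrite msizeE; apply/bigmax_leqP_seq => m mf _; rewrite ltnS leqNgt; apply/negP => lt_d.
  have := tdeg_le_coef fd (i := m ord0) (j := m ord_max); rewrite -mdeg2 => /(_ lt_d).
  rewrite coef_aff (bigD1_seq m) //= !eqxx mulr1 big_seq_cond big1 ?addr0 => [/eqP|m' /andP[_ ne]].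
    by rewrite fmorph_eq0 mcoeff_eq0 mf.
  case: eqP => [e1|]; rewrite ?mulr0 //; case: eqP => [e2|]; rewrite ?mulr0 //.
  case/eqP: ne; apply/mnmP => i; case: i => [[|[|//]] lti].
    by rewrite (_ : Ordinal lti = ord0) //; apply: val_inj.
  by rewrite (_ : Ordinal lti = ord_max) //; apply: val_inj.
have [m mf md] : exists2 m, m \in msupp f & mdeg m = d.
  have [/hasP[m mf /eqP md]|/hasPn no] := boolP (has (fun m : 'X_{1..2} => mdeg m == d) (msupp f)); first by exists m.
  case/eqP: f0; rewrite coef_aff big_seq big1 // => m /no; rewrite mdeg2 => nd.
  case: (m ord0 =P 0%N) nd => [->|_ _]; rewrite /= ?mulr0 //; rewrite add0n => /negPf ->.
  by rewrite mulr0.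
by rewrite -md; apply: msize_mdeg_lt.
Qed.

Lemma curve_form_homog : curve_form f \is (msize f).-1.-homog.
Proof.
rewrite /curve_form /homogenization raddf_sum big_seq; apply: rpred_sum => m mf.
have le_m : (mdeg m <= (msize f).-1)%N by rewrite -ltnS (leq_trans (msize_mdeg_lt mf)) // leqSpred.
rewrite /= map_mpolyZ; apply: rpredZ; rewrite !mpolyXn -!mpolyXD map_mpolyX dhomogX /=.
have e : (m 0%R + m 1%R)%N = mdeg m by rewrite mdeg2; congr (_ + m _)%N; apply: val_inj.
by rewrite !mdegD !mdegMn !mdeg1 !mul1n e subnKC.
Qed.

Lemma dehom_curve_form : dehom 1 false (curve_form f) = aff f.
Proof.
have dZ a (F : {mpoly algC[3]}) : dehom 1 false (a *: F) = a%:P%:P * dehom 1 false F by exact: mmapZ.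
have dM (F G : {mpoly algC[3]}) : dehom 1 false (F * G) = dehom 1 false F * dehom 1 false G by exact: rmorphM.
have dE (F : {mpoly algC[3]}) n : dehom 1 false (F ^+ n) = dehom 1 false F ^+ n by exact: rmorphXn.
have dX i : dehom 1 false ('X_i : {mpoly algC[3]}) = chart_coord _ false i.
  by rewrite /dehom mmapX mmap1U !polyC1 mul1r.
have dS (r : seq 'X_{1..2}) (F : 'X_{1..2} -> {mpoly algC[3]}) :
  dehom 1 false (\sum_(m <- r) F m) = \sum_(m <- r) dehom 1 false (F m) by exact: raddf_sum.
have -> : curve_form f = \sum_(m <- msupp f)
    ratr f@_m *: ('X_0 ^+ m 0 * 'X_1 ^+ m 1 * 'X_2 ^+ ((msize f).-1 - mdeg m)).
  rewrite /curve_form /homogenization raddf_sum; apply: eq_bigr => m _.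
  by rewrite /= map_mpolyZ rmorphM rmorphM /= !rmorphXn /= !map_mpolyX.
rewrite dS /mmap; apply: eq_bigr => m _.
rewrite dZ !dM !dE !dX; congr (_ * _).
rewrite /chart_coord /mmap1 !big_ord_recl big_ord0 /= expr1n !mulr1.
by congr (_ ^+ m _ * _ ^+ m _); apply: val_inj.
Qed.

End AffineEquation.

Lemma aff_calQ : dehom 1 false (curve_form calQ) = bden algC Ql.
Proof.
rewrite dehom_curve_form bden_horner.
pose h : {rmorphism rat -> {poly {poly algC}}} := (polyC \o polyC) \o (ratr : rat -> algC).
pose g : {rmorphism {mpoly rat[2]} -> {poly {poly algC}}} := mmap h
  (fun i : 'I_2 => if i == 0%N :> nat then 'X%:P else 'X : {poly {poly algC}}).
have gX i : g 'X_i = if i == 0%N :> nat then 'X%:P else 'X by rewrite /g /= mmapX mmap1U.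
by rewrite (calQ_horner g) !gX.
Qed.

Lemma calQ_homog : curve_form calQ \is 12.-homog.
Proof.
have := curve_form_homog calQ; rewrite (@msize_aff calQ 12) //.
  by rewrite -dehom_curve_form aff_calQ; exact: Q_tdeg.
rewrite -dehom_curve_form aff_calQ coef_bden.
by rewrite (_ : zden _ _ = 1) // oner_eq0.
Qed.

Definition coords c (x y : algC) (i : 'I_3) : algC := ev2 x y (chart_coord _ c i).

Definition lead (e : 'I_3 -> algC) : algC :=
  if e ord0 != 0 then e ord0 else if e yi != 0 then e yi else e ord_max.

Definition npt (e : 'I_3 -> algC) : {ffun 'I_3 -> algC} := [ffun i => e i / lead e].

Lemma ord3P (i : 'I_3) : [\/ i = ord0, i = yi | i = ord_max].
Proof.
by case: i => [[|[|[|//]]] lti]; [apply: Or31|apply: Or32|apply: Or33]; apply: val_inj.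
Qed.

Lemma npt_normalized e : lead e != 0 -> normalized (npt e).
Proof.
move=> e0; apply/existsP; rewrite /lead in e0.
have [e1|e1] := eqVneq (e ord0) 0; last first.
  exists ord0; rewrite ffunE /lead e1 divff // eqxx; apply/forallP => j.
  by rewrite ltn0.
have [e2|e2] := eqVneq (e yi) 0; last first.
  exists yi; rewrite ffunE /lead e1 eqxx /= e2 divff // eqxx; apply/forallP => j; apply/implyP.
  by case: (ord3P j) => -> //= _; rewrite ffunE e1 mul0r.
exists ord_max; rewrite e1 e2 eqxx /= in e0; rewrite ffunE /lead e1 e2 eqxx /= divff // eqxx.
by apply/forallP => j; apply/implyP; case: (ord3P j) => -> //= _; rewrite ffunE ?e1 ?e2 mul0r.
Qed.

Lemma coords0 c x y : coords c x y ord0 = if c then 1 else x.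
Proof. by rewrite /coords /chart_coord; case: c => /=; [exact: (rmorph1 (ev2 x y))|rewrite ev2C hornerX]. Qed.
Lemma coords1 c x y : coords c x y yi = y.
Proof. by rewrite /coords /chart_coord /= ev2X. Qed.
Lemma coords2 c x y : coords c x y ord_max = if c then x else 1.
Proof. by rewrite /coords /chart_coord; case: c => /=; [rewrite ev2C hornerX|exact: (rmorph1 (ev2 x y))]. Qed.

Lemma lead_coords c x y : lead (coords c x y) != 0.
Proof.
rewrite /lead; case: ifP => // /negbFE/eqP e0; case: ifP => // _.
by rewrite coords2; rewrite coords0 in e0; case: c e0 => // /eqP; rewrite oner_eq0.
Qed.

Lemma npt_chart c x y : in_chart c (lead (coords c x y))^-1 x y (npt (coords c x y)).
Proof. by split=> [|i]; rewrite ?invr_eq0 ?lead_coords // ffunE mulrC. Qed.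

Notation q := (bden algC Ql).
Lemma calQ_plane_curve : plane_curve q 12. Proof. by split; [exact: Q_monic|exact: Q_size|exact: Q_tdeg]. Qed.
Lemma calQ_smooth c : smooth (chart c 12 q). Proof. exact: smooth_char0. Qed.

Lemma on_curve_npt c x y : ev2 x y (chart c 12 q) = 0 -> on_curve calQ (npt (coords c x y)).
Proof.
move=> q0; rewrite /on_curve npt_normalized ?lead_coords //=.
have [w0 vE] := npt_chart c x y; rewrite -(ev2_dehom _ vE) (dehom_scale _ c calQ_homog).
by rewrite (dehom_chart c calQ_homog) aff_calQ ev2M q0 mulr0.
Qed.

Lemma fiber_npt_eq c w x y (v : {ffun 'I_3 -> algC}) r : normalized v -> in_chart c w x y v ->
  (npt (coords false 0 r) == v) = [&& ~~ c, x == 0 & r == y].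
Proof.
move=> nv [w0 vE]; have l0 := lead_coords false 0 r; set l := lead _ in l0.
have v0 : v ord0 = w * (if c then 1 else x) by rewrite vE -/(coords c x y ord0) coords0.
have v1 : v yi = w * y by rewrite vE -/(coords c x y yi) coords1.
have v2 : v ord_max = w * (if c then x else 1) by rewrite vE -/(coords c x y ord_max) coords2.
apply/eqP/idP => [E|/and3P[c0 /eqP x0 /eqP ry]].
  have e0 : v ord0 = 0 by rewrite -E ffunE coords0 mul0r.
  have e1 : v yi = r / l by rewrite -E ffunE coords1.
  have e2 : v ord_max = 1 / l by rewrite -E ffunE coords2.
  move/eqP: e0; rewrite v0 mulf_eq0 (negPf w0) /=; case: (c) v2 => v2; first by rewrite oner_eq0.
  move=> /eqP->; rewrite eqxx /=; apply/eqP; apply: (mulIf (invr_neq0 l0)).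
  by rewrite -e1 v1 -[l^-1]mul1r -e2 v2 mulr1 mulrC.
rewrite (negPf c0) x0 in v0 v2; rewrite mulr0 in v0; rewrite mulr1 in v2.
have wl : w = l^-1.
  have /existsP[i /andP[/eqP vi /forallP vj]] := nv.
  rewrite /l /lead coords0 eqxx /= coords1 coords2 ry.
  case: (ord3P i) vi vj => -> vi vj.
  - by move/eqP: vi; rewrite v0 eq_sym oner_eq0.
  - have y0 : y != 0 by apply/eqP => y0; move/eqP: vi; rewrite v1 y0 mulr0 eq_sym oner_eq0.
    by rewrite y0; apply: (mulIf y0); rewrite mulVf // -v1.
  have := vj yi; rewrite v1 mulf_eq0 (negPf w0) /= => ->.
  by rewrite invr1 -v2.
apply/ffunP => i; rewrite ffunE -/l -wl mulrC.
by case: (ord3P i) => ->; rewrite ?coords0 ?coords1 ?coords2 ?v0 ?v1 ?v2 ?ry ?mulr0 ?mulr1.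
Qed.

Definition fiber_coefs := [seq head Z0 l | l <- gaml].
Definition fiber_poly : {poly algC} := uden algC fiber_coefs.

Lemma gam_fiber_poly : bden algC gaml = map_poly polyC fiber_poly.
Proof.
apply: poly2P => i j; rewrite coef_bden coef_map /= coefC (coef_pden (zden0 algC)).
have -> : gaml = [seq [:: c] | c <- fiber_coefs] by vm_compute.
have [lt_j|le_j] := ltnP j (size fiber_coefs); last first.
  rewrite [nth [::] _ j]nth_default ?size_map // (@nth_default _ Z0 fiber_coefs j le_j) nth_nil zden0.
  by case: (i == 0%N).
by rewrite (nth_map Z0) //; case: i => //= i; rewrite nth_nil zden0.
Qed.

Lemma fiber_roots : exists2 rs : seq algC, 'X * fiber_poly = \prod_(r <- rs) ('X - r%:P) & size rs = 12.
Proof.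
have c11 : fiber_poly`_11 = 1 by rewrite (coef_pden (zden0 algC)).
have s0 : size fiber_poly = 12.
  apply/eqP; rewrite eqn_leq; apply/andP; split; last first.
    by rewrite ltnNge; apply/negP => /leq_sizeP/(_ 11 (leqnn _))/eqP; rewrite c11 oner_eq0.
  by apply/leq_sizeP => j le_j; rewrite (coef_pden (zden0 algC)) nth_default.
have g1 : 'X * fiber_poly \is monic.
  by rewrite monicE lead_coefM lead_coefX mul1r lead_coefE s0 c11.
have [rs rsE] := closed_field_poly_normal ('X * fiber_poly); exists rs.
  by rewrite {1}rsE (monicP g1) scale1r.
have : size ('X * fiber_poly) = 13 by rewrite mulrC size_mulX ?s0 // -size_poly_eq0 s0.
by rewrite rsE (monicP g1) scale1r size_prod_XsubC => -[].
Qed.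

Lemma fiber_poly_at0 : fiber_poly.[0] != 0.
Proof. by rewrite -[fiber_poly]coefK horner_coef0 coefK (coef_pden (zden0 algC)) (_ : zden _ _ = 1) ?oner_eq0. Qed.

Lemma ev2_fiber r : ev2 0 r q = ('X * fiber_poly).[r].
Proof.
rewrite Q_gam_bet gam_fiber_poly (rmorphD (ev2 0 r)) /= !ev2M ev2X ev2C hornerX mul0r addr0 hornerM hornerX.
by rewrite /ev2 horner_map hornerC.
Qed.

Lemma calQ_at_origin : ev2 0 0 (chart false 12 q) = 0.
Proof. by rewrite [chart _ _ _]/= ev2_fiber hornerM hornerX mul0r. Qed.

Definition origin : point calQ := exist (fun v => is_true (on_curve calQ v)) _ (on_curve_npt calQ_at_origin).
(** The default value [origin] serves the values r that are not roots of y gamma(y). *)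
Definition fiber_point (r : algC) : point calQ := insubd origin (npt (coords false 0 r)).
(** For the 12 roots of y gamma(y), counted with multiplicity, this is 12 P minus the fiber x = 0;
    the root 0 contributes nothing. *)
Definition fiber_divisor (rs : seq algC) : divisor calQ :=
  \sum_(r <- rs) (<< origin >> - << fiber_point r >>).

Lemma val_fiber_point r : root ('X * fiber_poly) r -> val (fiber_point r) = npt (coords false 0 r).
Proof. by move=> /rootP r0; rewrite val_insubd on_curve_npt // [chart _ _ _]/= ev2_fiber. Qed.

Lemma coeff_fiber_divisor rs (P : point calQ) c w x y :
    {in rs, forall r, root ('X * fiber_poly) r} -> in_chart c w x y (val P) ->
  coeff P (fiber_divisor rs) =
    (size rs * [&& ~~ c, x == 0%R & y == 0%R])%N%:Z - (fiber_mult rs c x y)%:Z.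
Proof.
move=> rsr Pc; have nP : normalized (val P) by have /andP[] := valP P.
have oE : (origin == P) = [&& ~~ c, x == 0 & y == 0].
  by rewrite -val_eqE /= (fiber_npt_eq 0 nP Pc) [0 == y]eq_sym.
rewrite /fiber_divisor raddf_sum; elim: rs rsr => [|r rs IH] rsr.
  by rewrite big_nil mul0n /fiber_mult /=; case: ifP; rewrite subr0.
rewrite big_cons IH => [|s srs]; last by apply: rsr; rewrite inE srs orbT.
rewrite raddfB /= !coeffU !mul1r oE -[fiber_point r == P]val_eqE val_fiber_point ?rsr ?mem_head //.
rewrite (fiber_npt_eq r nP Pc) mulSn /fiber_mult /= !PoszD.
by case: c {Pc oE IH}; case: (x == 0); case: (r == y); case: (y == 0); rewrite /= ?mulr0n ?mulr1n ?muln0 ?muln1; lia.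
Qed.

Lemma fiber_divisor_nontorsion rs n d (F G : {mpoly algC[3]}) :
    'X * fiber_poly = \prod_(r <- rs) ('X - r%:P) -> size rs = 12 -> (0 < n)%N ->
    F \is d.-homog -> G \is d.-homog -> ~ vanishes_on_curve calQ F -> ~ vanishes_on_curve calQ G ->
    (forall P : point calQ, exists m l : nat, [/\ has_order P F m, has_order P G l
       & n%:Z * coeff P (fiber_divisor rs) = m%:Z - l%:Z]) ->
  False.
Proof.
move=> rsE s12 n0 Fd Gd nF nG ords.
have rsr : {in rs, forall r, root ('X * fiber_poly) r} by move=> r; rewrite rsE root_prod_XsubC.
have N0 : (0 < 12)%N by [].
have Fg := gr_cl (Q_monic algC) (Q_size algC) N0 (Q_tdeg algC) (dehom_tdeg Fd).
have Gg := gr_cl (Q_monic algC) (Q_size algC) N0 (Q_tdeg algC) (dehom_tdeg Gd).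
have F0 := not_vanishing_neq0 N0 calQ_plane_curve calQ_homog aff_calQ Fd nF.
have G0 := not_vanishing_neq0 N0 calQ_plane_curve calQ_homog aff_calQ Gd nG.
have [c x y p i j q0 pu oi oj|C [w [C0 Cn CE]]] :=
    contact_form_exists N0 calQ_plane_curve calQ_smooth (Q_gam_bet algC) gam_fiber_poly fiber_poly_at0 rsE (n := n) Fg Gg F0 G0.
  (* A point of a chart is brought to its normalized representative, to which the given orders
     apply. *)
  pose P : point calQ := exist (fun v => is_true (on_curve calQ v)) _ (on_curve_npt q0).
  have Pc : in_chart c (lead (coords c x y))^-1 x y (val P) := npt_chart c x y.
  have [m [l [om ol E]]] := ords P.
  have om' := has_order_ord N0 calQ_plane_curve calQ_smooth calQ_homog aff_calQ Pc pu Fd nF om.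
  have ol' := has_order_ord N0 calQ_plane_curve calQ_smooth calQ_homog aff_calQ Pc pu Gd nG ol.
  rewrite (pord_uniq N0 calQ_plane_curve calQ_smooth q0 pu oi om') (pord_uniq N0 calQ_plane_curve calQ_smooth q0 pu oj ol').
  rewrite (coeff_fiber_divisor rsr Pc) s12 mulrBr -!PoszM in E.
  clear -E; move: (n * fiber_mult _ _ _ _)%N E => t; case: [&& _, _ & _]; lia.
pose mk := map_poly (map_poly (intmul 1 : {rmorphism int -> algC})).
have mkE a : mk (bden int a) = bden algC a by exact: bden_map.
have [C' [w' [C'0 C'n C'E]]] : exists C w : {poly %/ mk (bden int Ql)}, [/\ C != 0, gr n C
    & in_qpoly (mk (bden int Ql)) (mk (bden int gaml)) ^+ (12 * n) * C =
      in_qpoly (mk (bden int Ql)) 'X%:P ^+ (12 * n) * w].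
  by rewrite !mkE; exists C, w.
have [F' [w'' [F'n F'E]]] := descend_contact (intmul 1 : {rmorphism int -> 'F_3})
  (Q_monic int) (Q_size int) N0 C'0 C'n C'E.
by rewrite (no_integral_contact n0 F'n F'E) eqxx.
Qed.

Lemma prod_XsubC_perm (k : fieldType) (rs ss : seq k) :
  \prod_(r <- rs) ('X - r%:P) = \prod_(r <- ss) ('X - r%:P) -> perm_eq rs ss.
Proof.
move=> E; apply/allP => r _ /=; have [h hr hE] := prod_XsubC_count rs r.
have [h' hr' hE'] := prod_XsubC_count ss r; rewrite hE hE' in E.
move: (count_mem r rs) (count_mem r ss) E => a b; clear -hr hr'.
wlog lt_ab : a b h h' hr hr' / (a < b)%N => [th E|E].
  have [lt|] := ltnP a b; first exact: (th _ _ _ _ hr hr' lt E).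
  rewrite leq_eqVlt => /orP[/eqP->//|lt]; rewrite eq_sym; exact: (th _ _ _ _ hr' hr lt (esym E)).
have Xa0 : ('X - r%:P) ^+ a != 0 by rewrite expf_neq0 // polyXsubC_eq0.
move: E; rewrite -(subnKC (ltnW lt_ab)) exprD -mulrA => /(mulfI Xa0)/(congr1 (horner^~ r)).
rewrite hornerM horner_exp hornerXsubC subrr expr0n subn_eq0 leqNgt lt_ab mul0r => h0.
by rewrite h0 eqxx in hr.
Qed.

(** * Galois invariance of the divisor *)

Section Conjugation.

Variable s : {rmorphism algC -> algC}.

Lemma conj_npt r : conj_coords s (npt (coords false 0 r)) = npt (coords false 0 (s r)).
Proof.
have sc i : s (coords false 0 r i) = coords false 0 (s r) i.
  by case: (ord3P i) => ->; rewrite ?coords0 ?coords1 ?coords2 ?rmorph0 ?rmorph1.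
apply/ffunP => i; rewrite !ffunE fmorph_div sc; congr (_ / _).
rewrite /lead !coords0 !coords1 !coords2 eqxx /= fmorph_eq0.
by case: (r == 0); rewrite /= ?rmorph1.
Qed.

Lemma map_fiber_poly : map_poly s fiber_poly = fiber_poly.
Proof.
apply/polyP => i; rewrite coef_map /fiber_poly (coef_pden (zden0 algC)); exact: rmorph_int.
Qed.

Lemma conj_fiber_root r : root ('X * fiber_poly) r -> root ('X * fiber_poly) (s r).
Proof.
move=> /rootP r0; apply/rootP; rewrite -[RHS](rmorph0 s) -r0 !hornerM !hornerX rmorphM; congr (_ * _).
by rewrite -horner_map map_fiber_poly.
Qed.

(** The polynomial y gamma(y) has integer coefficients, so s permutes its roots with their
    multiplicities, and it fixes the origin. *)
Lemma conj_fiber_divisor rs : 'X * fiber_poly = \prod_(r <- rs) ('X - r%:P) ->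
  conj_divisor s (fiber_divisor rs) = fiber_divisor rs.
Proof.
move=> rsE; have rsr : {in rs, forall r, root ('X * fiber_poly) r} by move=> r; rewrite rsE root_prod_XsubC.
have sg : map_poly s ('X * fiber_poly) = 'X * fiber_poly.
  rewrite rmorphM /= map_polyX; by rewrite map_fiber_poly.
have perm : perm_eq [seq s r | r <- rs] rs.
  apply: prod_XsubC_perm; rewrite -rsE -sg rsE rmorph_prod big_map; apply: eq_bigr => r _.
  by rewrite /= map_polyXsubC.
have cU (P : point calQ) : conj_divisor s << P >> = << conj_point s P >>.
  by rewrite /conj_divisor liftU scale1r.
have cB (D E : divisor calQ) : conj_divisor s (D - E) = conj_divisor s D - conj_divisor s E.
  exact: lift_is_additive.
have c0 : conj_divisor s (0 : divisor calQ) = 0 by have := cB 0 0; rewrite !subrr.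
have cD (D E : divisor calQ) : conj_divisor s (D + E) = conj_divisor s D + conj_divisor s E.
  have cN : conj_divisor s (- E) = - conj_divisor s E by rewrite -sub0r cB c0 sub0r.
  by rewrite -{1}[E]opprK cB cN opprK.
have cP r : root ('X * fiber_poly) r -> conj_point s (fiber_point r) = fiber_point (s r).
  move=> r0; apply: val_inj; rewrite [LHS]/= (val_fiber_point r0) conj_npt.
  by rewrite (val_fiber_point (conj_fiber_root r0)).
have cO : conj_point s origin = origin.
  by apply: val_inj; rewrite [LHS]/= conj_npt rmorph0.
transitivity (fiber_divisor [seq s r | r <- rs]); last exact: perm_big.
rewrite /fiber_divisor big_map; elim: rs rsr {rsE perm} => [|r rs IH] rsr; first by rewrite !big_nil c0.
rewrite !big_cons cD cB !cU cO cP ?rsr ?mem_head // IH // => t trs.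
by apply: rsr; rewrite inE trs orbT.
Qed.

End Conjugation.

Lemma deg_fiber_divisor rs : deg (fiber_divisor rs) = 0.
Proof.
rewrite /fiber_divisor raddf_sum big1 // => r _.
by rewrite raddfB /= !degU subrr.
Qed.

Lemma has_order1 (P : point calQ) : has_order P 1 0.
Proof.
have fP : (curve_form calQ).@[val P] = 0 by have /andP[_ /eqP] := valP P.
split.
  exists 1, 0; rewrite rmorph1 oner_neq0 mulr1 mul0r subr0; split=> //.
  exists [:: (1, [tuple])]; last by rewrite big_seq1 big_ord0 mulr1.
  by move=> t _ [].
move=> [S [B [S0 [t tI E]]]]; case/eqP: S0.
have := congr1 (meval (val P)) E; rewrite rmorphB !rmorphM rmorph1 /= fP mulr0 subr0 mulr1 => ->.
rewrite rmorph_sum big_seq big1 // => u ut; rewrite rmorphM /= big_ord1.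
have := tI u ut ord0 1; rewrite mulrC => z.
have -> : (tnth u.2 ord0).@[val P] = 0; last by rewrite mul0r.
by apply: etrans z; apply: eq_bigr => m _; congr (_ * _); apply: mmap1_eq => i; rewrite mul1r.
Qed.

Lemma principal0 : principal (0 : divisor calQ).
Proof.
have n1 : ~ vanishes_on_curve calQ 1.
  move=> [B E]; have := congr1 (meval (val origin)) E.
  have /andP[_ /eqP fP] := valP origin.
  by rewrite rmorphM rmorph1 /= fP mulr0 => /eqP; rewrite oner_eq0.
exists 0%N, 1, 1; split=> //; [exact: dhomog1|exact: dhomog1|].
move=> P; exists 0%N, 0%N; split; [exact: has_order1|exact: has_order1|].
by rewrite raddf0 subrr.
Qed.

Lemma rank_one_family : exists2 D : 'I_1 -> divisor calQ,
  (forall i, rational_jacobian_class (D i)) & independent_classes D.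
Proof.
have [rs rsE s12] := fiber_roots; exists (fun=> fiber_divisor rs) => [_|a].
  split; first exact: deg_fiber_divisor.
  by move=> s; rewrite /linearly_equivalent (conj_fiber_divisor s rsE) subrr; exact: principal0.
rewrite /linearly_equivalent big_ord1 subr0 => -[d [F [G [Fd Gd nF nG ords]]]] i.
rewrite (ord1 i); move: (a ord0) ords => b ords.
have cE (P : point calQ) : coeff P (fiber_divisor rs *~ b) = b * coeff P (fiber_divisor rs).
  by rewrite raddfMz /= -mulrzr intz mulrC.
case: b cE ords => [[|n]|n] cE ords //; exfalso.
  apply: (fiber_divisor_nontorsion rsE s12 (ltn0Sn n) Fd Gd nF nG) => P.
  by have [m [l [om ol E]]] := ords P; exists m, l; rewrite -E cE.
(* For a negative multiple the roles of F and G are exchanged. *)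
apply: (fiber_divisor_nontorsion rsE s12 (ltn0Sn n) Gd Fd nG nF) => P.
have [m [l [om ol E]]] := ords P; exists l, m; split=> //.
by rewrite -opprB -E cE NegzE mulNr opprK.
Qed.

(* From an independent class to the rank *)
From mathcomp Require Import boolp classical_sets constructive_ereal.

(** [supremum] returns a default value when no supremum exists, so existence has to be shown: a
    nonempty set of naturals has a largest element or is unbounded, and then the supremum is
    infinite. *)
Lemma nat_ereal_supremum (A : set nat) : A 1%N ->
  exists s : \bar int, supremums [set n%:Z%:E | n in A]%classic s.
Proof.
move=> A1; have [[m mA]|unb] := pselect (exists m, forall n, A n -> (n <= m)%N).
  have ex : exists n, `[< A n >] by exists 1%N; apply/asboolP.
  have ub n : `[< A n >] -> (n <= m)%N by move=> /asboolP; exact: mA.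
  case: (ex_maxnP ex ub) => M /asboolP AM maxM; exists M%:Z%:E; split.
    by move=> _ [n An <-]; rewrite lee_fin lez_nat; apply: maxM; apply/asboolP.
  by move=> u uA; apply: uA; exists M.
exists +oo%E; split=> [u _|u uA]; first exact: leey.
case: u uA => [z uA|//|uA]; last by have := uA _ (ex_intro2 _ _ 1%N A1 erefl).
exfalso; apply: unb; exists `|z|%N => n An.
have := uA _ (ex_intro2 _ _ n An erefl); rewrite lee_fin => nz.
by rewrite -lez_nat abszE (le_trans nz) // ler_norm.
Qed.

Theorem mainTheorem7 : (0 < mordell_weil_rank calQ)%E.
Proof.
have [s sS] := nat_ereal_supremum (A := [set n : nat | exists2 D : 'I_n -> divisor calQ,
  (forall i, rational_jacobian_class (D i)) & independent_classes D]%classic) rank_one_family.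
rewrite /mordell_weil_rank /supremum; case: ifPn => [/eqP E|_].
  have : [set n%:Z%:E | n in [set n : nat | exists2 D : 'I_n -> divisor calQ,
       (forall i, rational_jacobian_class (D i)) & independent_classes D]]%classic (1%:Z%:E : \bar int).
    by exists 1%N => //; exact: rank_one_family.
  by rewrite E.
have := xgetPex 0%E (ex_intro _ s sS) => -[ub _].
apply: (lt_le_trans _ (ub _ (ex_intro2 _ _ 1%N rank_one_family erefl))).
by rewrite lte_fin.
Qed.
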